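(* Let $k$ be an algebraically closed field, $Q$ a finite quiver, $\mathcal{I}$ an admissible ideal of $kQ$, and $A=kQ/\mathcal{I}$. The following are equivalent. (1) $\mathcal{L}_t(A)$ is finite (hence so is $\mathrm{tors}\,A$) and the distributive closure of $\mathrm{tors}\,A$ can be identified with $\mathcal{L}_t(A)$. (2) $A$ is a locally representation directed algebra such that each vertex in $Q$ has at most one arrow ending at it and at most two arrows going out of it, and whenever a vertex has precisely one entering arrow $\alpha$ and two exiting arrows $\beta$ and $\gamma$, then $\alpha\beta\in\mathcal{I}$ or $\alpha\gamma\in\mathcal{I}$. (3) $Q$ is a quiver where each vertex has at most one arrow coming in and at most two arrows going out of it, whenever a vertex has precisely one entering arrow $\alpha$ and two exiting arrows $\beta$ and $\gamma$, then $\alpha\beta\in\mathcal{I}$ or $\alpha\gamma\in\mathcal{I}$, and, in addition, $Q$ has no loops and $C\in\mathcal{I}$ for every (oriented) cycle $C$ in $Q$.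
   Context: Paths are composed left to right: $\alpha\beta$ is $\alpha$ followed by $\beta$. A loop counts both as an arrow entering and as an arrow exiting its vertex. An oriented cycle is a path of length at least $1$ starting and ending at the same vertex. With $R_Q$ the ideal of $kQ$ generated by the arrows, $\mathcal{I}$ is admissible if $R_Q^m\subseteq\mathcal{I}\subseteq R_Q^2$ for some $m\ge 2$. $\mathrm{mod}\,A$ is the category of finitely generated right $A$-modules. All subcategories are full and closed under isomorphisms. A pretorsion class of $\mathrm{mod}\,A$ is a subcategory containing $0$ and closed under quotients and finite direct sums; a torsion class is a pretorsion class also closed under extensions. $\mathcal{L}_t(A)$ and $\mathrm{tors}\,A$ are the complete lattices of pretorsion classes and torsion classes of $\mathrm{mod}\,A$, ordered by inclusion. $\mathrm{Gen}(M)$ is the smallest pretorsion class containing the module $M$. A module is a brick if its endomorphism ring is a division ring; $A$ is locally representation directed if every indecomposable module in $\mathrm{mod}\,A$ is a brick. For a finite lattice $\mathcal{L}$, $Ji(\mathcal{L})$ is the poset of its join-irreducible elements (elements $x$ different from the bottom such that $x=a\vee b$ implies $x=a$ or $x=b$), with induced order. The distributive closure of $\mathcal{L}$ is the lattice $\mathcal{L}^*$ of order ideals (down-closed subsets) of $Ji(\mathcal{L})$, ordered by inclusion; $\mathcal{L}$ embeds as a poset in $\mathcal{L}^*$ via $\varepsilon(\ell)=\{x\in Ji(\mathcal{L})\mid x\le \ell\}$. The distributive closure of $\mathrm{tors}\,A$ ''can be identified with'' $\mathcal{L}_t(A)$ if the assignment $\varphi(\mathcal{T})=\{\mathrm{Gen}(M)\mid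 M \text{ indecomposable},\ \mathrm{Gen}(M)\subseteq\mathcal{T}\}$ is a well-defined lattice isomorphism $\varphi:\mathcal{L}_t(A)\to(\mathrm{tors}\,A)^*$ with $\varepsilon=\varphi\iota$, where $\iota:\mathrm{tors}\,A\to\mathcal{L}_t(A)$ is the inclusion. *)

(* Defs.v *)
From HB Require Import structures.
From mathcomp Require Import all_boot all_order all_algebra finmap monalg.
From mathcomp Require Import boolp classical_sets.
From Stdlib Require FinFun.

Set Implicit Arguments.
Unset Strict Implicit.
Unset Printing Implicit Defensive.

Import GRing.Theory.
Local Open Scope classical_set_scope.
Local Open Scope ring_scope.
Local Open Scope quotient_scope.

Record quiver := Quiver {
  vertex : finType;
  arrow : finType;
  src : arrow -> vertex;
  tgt : arrow -> vertex
}.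

Section Paths.
Variable Q : quiver.

Fixpoint composable (v : vertex Q) (s : seq (arrow Q)) : bool :=
  if s is a :: s' then (src a == v) && composable (tgt a) s' else true.

(* The start vertex is recorded so that each vertex has its own path of
   length 0. *)
Record qpath := QPath {
  path_data : vertex Q * seq (arrow Q);
  _ : composable path_data.1 path_data.2
}.

HB.instance Definition _ := [isSub for path_data].
HB.instance Definition _ := [Choice of qpath by <:].

Definition path_start (p : qpath) : vertex Q := (val p).1.
Definition path_arrows (p : qpath) : seq (arrow Q) := (val p).2.
Definition path_end (p : qpath) : vertex Q :=
  last (path_start p) [seq tgt a | a <- path_arrows p].

Definition vertex_path (v : vertex Q) : qpath := @QPath (v, [::]) isT.

Lemma composable1 (a : arrow Q) : composable (src a) [:: a].
Proof. by rewrite /= eqxx. Qed.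

Definition arrow_path (a : arrow Q) : qpath := @QPath (_, [:: a]) (composable1 a).

Lemma composable_cat v s1 s2 :
  composable v (s1 ++ s2) =
  composable v s1 && composable (last v [seq tgt a | a <- s1]) s2.
Proof. by elim: s1 v => //= a s1 IH v; rewrite IH andbA. Qed.

Lemma path_cat_subproof (p q : qpath) : path_end p == path_start q ->
  composable (path_start p) (path_arrows p ++ path_arrows q).
Proof.
move=> /eqP pq; rewrite composable_cat -/(path_end p) pq.
by apply/andP; split; [case: p {pq} | case: q {pq}].
Qed.

(* The composite "p followed by q", or [None] when q does not start where p
   ends; in the first case [insub] always succeeds, see [path_catE]. *)
Definition path_cat (p q : qpath) : option qpath :=
  if path_end p == path_start q
  then insub (path_start p, path_arrows p ++ path_arrows q) else None.

Definition oriented_cycle (p : qpath) : Prop :=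
  (0 < size (path_arrows p))%N /\ path_start p = path_end p.

Lemma path_catE p q : omap val (path_cat p q) =
  if path_end p == path_start q
  then Some (path_start p, path_arrows p ++ path_arrows q) else None.
Proof.
rewrite /path_cat; case: eqP => //= /eqP pq.
by rewrite insubT //; exact: path_cat_subproof.
Qed.

Lemma path_cat_omap_inj (x y : option qpath) : omap val x = omap val y -> x = y.
Proof. by case: x y => [x|] [y|] //= [] /val_inj ->. Qed.

Lemma path_cat_vl p v :
  path_cat (vertex_path v) p = if v == path_start p then Some p else None.
Proof.
apply: path_cat_omap_inj; rewrite path_catE /path_end /=.
by case: eqP => //= ->; case: p => -[].
Qed.

Lemma path_cat_vr p v :
  path_cat p (vertex_path v) = if v == path_end p then Some p else None.
Proof.
apply: path_cat_omap_inj; rewrite path_catE /= eq_sym.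
by case: eqP => //= _; rewrite cats0; case: p => -[].
Qed.

Lemma path_catA p q r :
  obind (path_cat p) (path_cat q r) = obind (path_cat^~ r) (path_cat p q).
Proof.
have E x y z : path_cat x y = Some z -> [/\ path_end x = path_start y,
    path_start z = path_start x, path_end z = path_end y
  & path_arrows z = path_arrows x ++ path_arrows y].
  move/(congr1 (omap val)); rewrite path_catE; case: eqP => //= e [] ez.
  rewrite {2}/path_start {1}/path_arrows /path_end /path_start /path_arrows /=.
  rewrite -ez /= map_cat last_cat.
  by split=> //; rewrite -[(path_data y).1]e.
have N x y : path_cat x y = None -> path_end x <> path_start y.
  by move/(congr1 (omap val)); rewrite path_catE; case: eqP.
apply: path_cat_omap_inj.
case qr: (path_cat q r) => [z|]; case pq: (path_cat p q) => [w|] //=.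
- have [e1 e2 e3 e4] := E _ _ _ qr; have [f1 f2 f3 f4] := E _ _ _ pq.
  by rewrite !path_catE e2 f1 f3 e1 !eqxx f2 e4 f4 catA.
- have [e1 e2 e3 e4] := E _ _ _ qr; have f := N _ _ pq.
  by rewrite path_catE e2; case: eqP.
- have [f1 f2 f3 f4] := E _ _ _ pq; have e := N _ _ qr.
  by rewrite path_catE f3; case: eqP.
Qed.

End Paths.

Definition path_algebra (k : fieldType) (Q : quiver) := {malg k[qpath Q]}.

HB.instance Definition _ k Q := GRing.Lmodule.on (path_algebra k Q).

HB.lock Definition path_term (k : fieldType) (Q : quiver) (c : k) (p : qpath Q) :
  path_algebra k Q := << c *g p >>.

Definition path_elt (k : fieldType) (Q : quiver) (p : qpath Q) :
  path_algebra k Q := path_term 1 p.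
Arguments path_elt : clear implicits.
Arguments path_elt k {Q} p.

Definition opath_term (k : fieldType) (Q : quiver) (c : k)
    (o : option (qpath Q)) : path_algebra k Q :=
  if o is Some r then path_term c r else 0.

HB.lock Definition pa_mul (k : fieldType) (Q : quiver)
    (f g : path_algebra k Q) : path_algebra k Q :=
  \sum_(p <- msupp f) \sum_(q <- msupp g) opath_term (f@_p * g@_q) (path_cat p q).

Definition pa_one (k : fieldType) (Q : quiver) : path_algebra k Q :=
  \sum_(v : vertex Q) path_elt k (vertex_path v).

Section PathAlgebra.
Variables (k : fieldType) (Q : quiver).
Local Notation kQ := (path_algebra k Q).
Local Notation pa_mul := (@pa_mul k Q).
Local Notation pa_one := (@pa_one k Q).
Implicit Types (f g h : kQ) (p q r : qpath Q) (c d : k) (o : option (qpath Q)).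

Lemma opath_term0 o : opath_term 0 o = 0 :> kQ.
Proof. by case: o => //= r; rewrite path_term.unlock monalgU0. Qed.

Lemma opath_termD c d o : opath_term (c + d) o = opath_term c o + opath_term d o.
Proof. by case: o => [r|] /=; [rewrite path_term.unlock monalgUD | rewrite addr0]. Qed.

Lemma pa_mulEw (d1 d2 : {fset qpath Q}) f g :
  (msupp f `<=` d1)%fset -> (msupp g `<=` d2)%fset ->
  pa_mul f g =
  \sum_(p <- d1) \sum_(q <- d2) opath_term (f@_p * g@_q) (path_cat p q).
Proof.
move=> le1 le2; rewrite pa_mul.unlock (big_fset_incl _ le1) /=; last first.
  move=> p _ /mcoeff_outdom ->; rewrite big1 // => q _.
  by rewrite mul0r opath_term0.
apply: eq_bigr => p _; apply: big_fset_incl => // q _ /mcoeff_outdom ->.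
by rewrite mulr0 opath_term0.
Qed.

Lemma pa_mulDl : left_distributive pa_mul +%R.
Proof.
move=> f g h; have subr := fsubset_refl (msupp h).
set d := (msupp f `|` msupp g)%fset.
rewrite (pa_mulEw (msuppD_le f g) subr).
rewrite (pa_mulEw (fsubsetUl _ _ : (msupp f `<=` d)%fset) subr).
rewrite (pa_mulEw (fsubsetUr _ _ : (msupp g `<=` d)%fset) subr) -big_split.
apply: eq_bigr => p _; rewrite -big_split; apply: eq_bigr => q _ /=.
by rewrite mcoeffD mulrDl opath_termD.
Qed.

Lemma pa_mulDr : right_distributive pa_mul +%R.
Proof.
move=> h f g; have subl := fsubset_refl (msupp h).
set d := (msupp f `|` msupp g)%fset.
rewrite (pa_mulEw subl (msuppD_le f g)).
rewrite (pa_mulEw subl (fsubsetUl _ _ : (msupp f `<=` d)%fset)).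
rewrite (pa_mulEw subl (fsubsetUr _ _ : (msupp g `<=` d)%fset)) -big_split.
apply: eq_bigr => p _; rewrite -big_split; apply: eq_bigr => q _ /=.
by rewrite mcoeffD mulrDr opath_termD.
Qed.

Lemma pa_mul0l g : pa_mul 0 g = 0.
Proof. by rewrite pa_mul.unlock msupp0 big_seq_fset0. Qed.

Lemma pa_mul0r g : pa_mul g 0 = 0.
Proof. by rewrite pa_mul.unlock big1 // => p _; rewrite msupp0 big_seq_fset0. Qed.

Lemma pa_ind (P : kQ -> Prop) :
  P 0 -> (forall x y, P x -> P y -> P (x + y)) -> (forall c p, P (path_term c p)) ->
  forall f, P f.
Proof.
rewrite path_term.unlock => P0 PD PU f.
by rewrite [f]monalgE; apply: big_ind.
Qed.

Lemma pa_mulUU a b p q :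
  pa_mul (path_term a p) (path_term b q) = opath_term (a * b) (path_cat p q).
Proof.
by rewrite path_term.unlock (pa_mulEw msuppU_le msuppU_le) !big_seq_fset1 !mcoeffUU.
Qed.

Lemma pa_mulA : associative pa_mul.
Proof.
move=> f g h; elim/pa_ind: f => [|f f' IH IH'|a p].
- by rewrite !(pa_mul0l g, pa_mul0l h, pa_mul0l (pa_mul g h)).
- by rewrite !pa_mulDl IH IH'.
elim/pa_ind: g => [|g g' IH IH'|b q].
- by rewrite (pa_mul0l h) (pa_mul0r (path_term a p)) (pa_mul0l h).
- by rewrite !(pa_mulDl, pa_mulDr) IH IH'.
elim/pa_ind: h => [|h h' IH IH'|c r].
- move: (path_term a p) (path_term b q) => u v.
  by rewrite (pa_mul0r v) (pa_mul0r u) (pa_mul0r (pa_mul u v)).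
- move: (path_term a p) (path_term b q) IH IH' => u v IH IH'.
  by rewrite !pa_mulDr IH IH'.
rewrite (pa_mulUU a b) (pa_mulUU b c); move: (path_catA p q r).
case: (path_cat q r) (path_cat p q) => [x|] [y|] /= E.
- by rewrite !pa_mulUU E mulrA.
- by rewrite (pa_mul0l (path_term c r)) pa_mulUU E.
- by rewrite (pa_mul0r (path_term a p)) pa_mulUU -E.
- by rewrite (pa_mul0l (path_term c r)) (pa_mul0r (path_term a p)).
Qed.

Lemma pa_one_mulU c p : pa_mul pa_one (path_term c p) = (path_term c p).
Proof.
rewrite /pa_one; transitivity (\sum_v pa_mul (path_elt k (vertex_path v)) (path_term c p)).
  apply: (big_morph (pa_mul^~ _)) => [x y|]; [exact: pa_mulDl | exact: pa_mul0l].
rewrite (bigD1 (path_start p)) //= big1 ?addr0 => [|v /negPf vp].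
  by rewrite pa_mulUU path_cat_vl eqxx mul1r.
by rewrite pa_mulUU path_cat_vl vp.
Qed.

Lemma pa_mulU_one c p : pa_mul (path_term c p) pa_one = (path_term c p).
Proof.
rewrite /pa_one; transitivity (\sum_v pa_mul (path_term c p) (path_elt k (vertex_path v))).
  apply: (big_morph (pa_mul _)) => [x y|]; [exact: pa_mulDr | exact: pa_mul0r].
rewrite (bigD1 (path_end p)) //= big1 ?addr0 => [|v /negPf vp].
  by rewrite pa_mulUU path_cat_vr eqxx mulr1.
by rewrite pa_mulUU path_cat_vr vp.
Qed.

Lemma pa_mul1l : left_id pa_one pa_mul.
Proof.
elim/pa_ind => [|x y IHx IHy|c p]; [exact: pa_mul0r | | exact: pa_one_mulU].
by rewrite pa_mulDr IHx IHy.
Qed.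

Lemma pa_mul1r : right_id pa_one pa_mul.
Proof.
elim/pa_ind => [|x y IHx IHy|c p]; [exact: pa_mul0l | | exact: pa_mulU_one].
by rewrite pa_mulDl IHx IHy.
Qed.

HB.instance Definition _ := GRing.Zmodule_isPzRing.Build (path_algebra k Q)
  pa_mulA pa_mul1l pa_mul1r pa_mulDl pa_mulDr.

Lemma path_eltM p q :
  path_elt k p * path_elt k q = if path_cat p q is Some r then path_elt k r else 0.
Proof.
rewrite [LHS]pa_mulUU mulr1 /opath_term.
by case: path_cat.
Qed.

Lemma path_termZ c d p : c *: path_term d p = path_term (c * d) p :> kQ.
Proof.
rewrite path_term.unlock; apply/malgP => q.
by rewrite (mcoeffZ c) [RHS]mcoeffU mcoeffU mulrnAr.
Qed.

Lemma path_algebra_scaleAl c f g : c *: (f * g) = (c *: f) * g.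
Proof.
elim/pa_ind: f => [|f f' IH IH'|a p].
- by rewrite (scaler0 _ c) !(mul0r g) (scaler0 _ c).
- by rewrite scalerDr !mulrDl scalerDr IH IH'.
elim/pa_ind: g => [|g g' IH IH'|b q].
- move: (path_term a p) => u.
  by rewrite (mulr0 u) (mulr0 (c *: u : kQ)) (scaler0 _ c).
- by rewrite !mulrDr scalerDr IH IH'.
rewrite path_termZ [X in c *: X]pa_mulUU [RHS]pa_mulUU.
by case: path_cat => [r|] /=; [rewrite path_termZ mulrA | exact: scaler0].
Qed.

Lemma path_algebra_scaleAr c f g : c *: (f * g) = f * (c *: g).
Proof.
elim/pa_ind: f => [|f f' IH IH'|a p].
- by rewrite (mul0r g) (mul0r (c *: g)) (scaler0 _ c).
- by rewrite !mulrDl scalerDr IH IH'.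
elim/pa_ind: g => [|g g' IH IH'|b q].
- by rewrite (mulr0 (path_term a p)) (scaler0 _ c) (mulr0 (path_term a p)).
- by rewrite mulrDr !scalerDr mulrDr IH IH'.
rewrite path_termZ [X in c *: X]pa_mulUU [RHS]pa_mulUU.
by case: path_cat => [r|] /=; [rewrite path_termZ mulrCA | exact: scaler0].
Qed.

End PathAlgebra.

Definition arrow_elt (k : fieldType) (Q : quiver) (a : arrow Q) :
  path_algebra k Q := path_elt k (arrow_path a).
Arguments arrow_elt : clear implicits.
Arguments arrow_elt k {Q} a.

Definition two_sided_closed (R : pzRingType) (I : {pred R}) : Prop :=
  forall a u, u \in I -> a * u \in I /\ u * a \in I.

HB.mixin Record isTwoSidedClosed (R : pzRingType) (I : R -> bool) := {
  two_sided_closed_subproof : two_sided_closed I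
}.

#[short(type="tsIdeal")]
HB.structure Definition TwoSidedIdeal (R : pzRingType) :=
  {I of GRing.ZmodClosed R I & isTwoSidedClosed R I}.

Section Ideals.
Variable R : pzRingType.

Definition ideal_gen (S : set R) : set R :=
  [set x | forall I : tsIdeal R, (forall y, S y -> y \in I) -> x \in I].

Definition ideal_prod (I J : set R) : set R :=
  ideal_gen [set z | exists x y, [/\ I x, J y & z = x * y]].

Definition ideal_pow (I : set R) (n : nat) : set R := iter n (ideal_prod I) setT.

Lemma tsideal_mull (I : tsIdeal R) a u : u \in I -> a * u \in I.
Proof. by move=> /(two_sided_closed_subproof (s := I) a) []. Qed.

Lemma tsideal_mulr (I : tsIdeal R) a u : u \in I -> u * a \in I.
Proof. by move=> /(two_sided_closed_subproof (s := I) a) []. Qed.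

End Ideals.

(* MathComp's [{ideal_quot _}] is restricted to commutative rings; only the
   additive quotient [{quot _}] is taken from there. *)
Definition quotient_ring (R : pzRingType) (I : tsIdeal R) := Quotient.quot I.

HB.instance Definition _ (R : pzRingType) (I : tsIdeal R) :=
  GRing.Zmodule.on (quotient_ring I).

Section QuotientRing.
Variables (R : pzRingType) (I : tsIdeal R).
Local Notation A := (quotient_ring I).

Definition qproj (x : R) : A := \pi_(Quotient.quot I) x.

Definition qr_one : A := qproj 1.
Definition qr_mul (x y : A) : A := qproj (repr x * repr y).

Lemma qproj_eq x y : (qproj x == qproj y) = (x - y \in I).
Proof. by rewrite /qproj -Quotient.idealrBE. Qed.

Lemma qproj_repr (x : A) : qproj (repr x) = x.
Proof. exact: reprK. Qed.

Lemma qproj0 : qproj 0 = 0.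
Proof. exact: raddf0. Qed.

Lemma qprojD : {morph qproj : x y / x + y}.
Proof. exact: raddfD. Qed.

Lemma qr_mulE x y : qr_mul (qproj x) (qproj y) = qproj (x * y).
Proof.
apply/eqP; rewrite qproj_eq.
set x' := repr _; set y' := repr _.
have hx : x' - x \in I by rewrite -qproj_eq qproj_repr.
have hy : y' - y \in I by rewrite -qproj_eq qproj_repr.
have -> : x' * y' - x * y = (x' - x) * y' + x * (y' - y).
  by rewrite mulrBl mulrBr addrA subrK.
by apply: rpredD; [exact: tsideal_mulr | exact: tsideal_mull].
Qed.

Lemma qr_mulA : associative qr_mul.
Proof.
move=> x y z; rewrite -[x]qproj_repr -[y]qproj_repr -[z]qproj_repr.
by rewrite !qr_mulE mulrA.
Qed.

Lemma qr_mul1l : left_id qr_one qr_mul.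
Proof. by move=> x; rewrite -[x]qproj_repr qr_mulE mul1r. Qed.

Lemma qr_mul1r : right_id qr_one qr_mul.
Proof. by move=> x; rewrite -[x]qproj_repr qr_mulE mulr1. Qed.

Lemma qr_mulDl : left_distributive qr_mul +%R.
Proof.
move=> x y z; rewrite -[x]qproj_repr -[y]qproj_repr -[z]qproj_repr.
by rewrite -qprojD !qr_mulE -qprojD mulrDl.
Qed.

Lemma qr_mulDr : right_distributive qr_mul +%R.
Proof.
move=> x y z; rewrite -[x]qproj_repr -[y]qproj_repr -[z]qproj_repr.
by rewrite -qprojD !qr_mulE -qprojD mulrDr.
Qed.

HB.instance Definition _ := GRing.Zmodule_isPzRing.Build (quotient_ring I)
  qr_mulA qr_mul1l qr_mul1r qr_mulDl qr_mulDr.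

Lemma qprojM : {morph qproj : x y / x * y}.
Proof. by move=> x y; rewrite [RHS]qr_mulE. Qed.

Lemma qproj1 : qproj 1 = 1.
Proof. by []. Qed.

End QuotientRing.

Definition arrow_ideal (k : fieldType) (Q : quiver) : set (path_algebra k Q) :=
  ideal_gen (range (arrow_elt k)).

Definition admissible (k : fieldType) (Q : quiver)
    (I : tsIdeal (path_algebra k Q)) : Prop :=
  (exists2 m, (2 <= m)%N & forall x, ideal_pow (@arrow_ideal k Q) m x -> x \in I)
  /\ (forall x, x \in I -> ideal_pow (@arrow_ideal k Q) 2 x).

(* A right A-module is a module over the converse ring A^c, the scalar action
   a *: x standing for xa. *)
Definition finitely_generated (A : pzRingType) (M : lmodType A^c) : Prop :=
  exists n (g : 'I_n -> M), forall x, exists c : 'I_n -> A^c,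
    x = \sum_i c i *: g i.

Record fgmod (A : pzRingType) := FGMod {
  fgmod_sort :> lmodType A^c;
  fgmodP : finitely_generated fgmod_sort
}.

Section Modules.
Variable A : pzRingType.
Implicit Types M N L X Y : fgmod A.

Definition zero_mod M : Prop := forall x : M, x = 0.

Definition mod_quotient M N : Prop :=
  exists f : {linear M -> N}, forall y, exists x, f x = y.

Definition mod_dsum M X Y : Prop :=
  exists f : {linear M -> (X * Y)%type}, bijective f.

Definition mod_extension L M N : Prop :=
  exists (f : {linear L -> M}) (g : {linear M -> N}),
    [/\ injective f, (forall z, exists y, g y = z)
      & forall y, g y = 0 <-> exists x, f x = y].

Definition indecomposable M : Prop :=
  ~ zero_mod M /\ forall X Y, mod_dsum M X Y -> zero_mod X \/ zero_mod Y.

(* The endomorphism ring of M is a division ring: it is nonzero, and each of its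
   nonzero elements has a two-sided inverse. *)
Definition brick M : Prop :=
  ~ zero_mod M /\
  forall f : {linear M -> M}, (exists x, f x <> 0) ->
    exists g : {linear M -> M}, cancel f g /\ cancel g f.

Definition locally_representation_directed : Prop :=
  forall M, indecomposable M -> brick M.

End Modules.

#[local] Obligation Tactic := idtac.

(* MathComp's order structures are not usable here: they require an [eqType],
   whose carrier lives in the same universe as the carrier of an [lmodType],
   whereas the elements of the lattices below are classes of modules. *)
Record lattice := Lattice {
  lat_sort :> Type;
  lat_le : lat_sort -> lat_sort -> Prop;
  lat_bot : lat_sort;
  lat_join : lat_sort -> lat_sort -> lat_sort;
  lat_meet : lat_sort -> lat_sort -> lat_sort;
  lat_refl : forall x, lat_le x x;
  lat_trans : forall y x z, lat_le x y -> lat_le y z -> lat_le x z;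
  lat_anti : forall x y, lat_le x y -> lat_le y x -> x = y;
  lat_botP : forall x, lat_le lat_bot x;
  lat_joinP : forall x y z, lat_le (lat_join x y) z <-> lat_le x z /\ lat_le y z;
  lat_meetP : forall x y z, lat_le z (lat_meet x y) <-> lat_le z x /\ lat_le z y
}.
Arguments lat_bot : clear implicits.

Definition lattice_isomorphism (L L' : lattice) (f : L -> L') : Prop :=
  [/\ bijective f,
      forall x y, f (lat_join x y) = lat_join (f x) (f y)
    & forall x y, f (lat_meet x y) = lat_meet (f x) (f y)].

Definition join_irreducible (L : lattice) (x : L) : Prop :=
  x <> lat_bot L /\ forall a b : L, x = lat_join a b -> x = a \/ x = b.

Lemma sig_pred_ext (T : Type) (P : (T -> Prop) -> Prop) (C D : {C | P C}) :
  (forall x, sval C x <-> sval D x) -> C = D.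
Proof.
case: C D => [C PC] [D PD] /= CD.
have E : C = D by apply: funext => x; apply: propext.
by subst D; rewrite (Prop_irrelevance PC PD).
Qed.

Section DistributiveClosure.
Variable L : lattice.

Definition order_ideal (D : L -> Prop) : Prop :=
  (forall x, D x -> join_irreducible x) /\
  (forall x y, join_irreducible x -> D y -> lat_le x y -> D x).

Lemma order_ideal0 : order_ideal (fun=> False).
Proof. by split. Qed.

Lemma order_idealU (D E : {D | order_ideal D}) :
  order_ideal (fun x => sval D x \/ sval E x).
Proof.
case: D E => [D [D1 D2]] [E [E1 E2]] /=; split=> [x [/D1|/E1] //|x y hx [Dy|Ey] xy].
  by left; apply: D2 xy.
by right; apply: E2 xy.
Qed.

Lemma order_idealI (D E : {D | order_ideal D}) :
  order_ideal (fun x => sval D x /\ sval E x).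
Proof.
case: D E => [D [D1 D2]] [E [E1 E2]] /=; split=> [x [/D1] //|x y hx [Dy Ey] xy].
by split; [apply: D2 xy | apply: E2 xy].
Qed.

Program Definition distributive_closure : lattice := @Lattice
  {D : L -> Prop | order_ideal D}
  (fun D E => forall x, sval D x -> sval E x)
  (exist _ _ order_ideal0)
  (fun D E => exist _ _ (order_idealU D E))
  (fun D E => exist _ _ (order_idealI D E))
  _ _ _ _ _ _.
Next Obligation. by auto. Qed.
Next Obligation. by move=> E D F DE EF x /DE /EF. Qed.
Next Obligation. by move=> D E DE ED; apply: sig_pred_ext => x; split; auto. Qed.
Next Obligation. by []. Qed.
Next Obligation.
move=> D E F /=; split=> [h|[h1 h2] x [/h1|/h2] //].
by split=> x hx; apply: h; auto.
Qed.
Next Obligation.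
move=> D E F /=; split=> [h|[h1 h2] x hx]; last by split; auto.
by split=> x /h [].
Qed.

Lemma dc_embed_subproof (l : L) :
  order_ideal (fun x => join_irreducible x /\ lat_le x l).
Proof.
split=> [x [] //|x y hx [_ yl] xy]; split=> //.
exact: lat_trans yl.
Qed.

Definition dc_embed (l : L) : distributive_closure :=
  exist _ _ (dc_embed_subproof l).

End DistributiveClosure.

(* The lattice of the classes of objects of T satisfying a property P that is
   stable under arbitrary intersections; meets are intersections, and joins are
   the classes generated by unions. *)
Section ClassLattice.
Variables (T : Type) (P : (T -> Prop) -> Prop).
Hypothesis PI : forall F : (T -> Prop) -> Prop,
  (forall C, F C -> P C) -> P (fun x => forall C, F C -> C x).

Definition generated (S : T -> Prop) : T -> Prop :=
  fun x => forall C, P C /\ (forall y, S y -> C y) -> C x.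

Lemma generatedP S : P (generated S).
Proof. by apply: PI => C []. Qed.

Definition class_gen (S : T -> Prop) : {C | P C} := exist _ _ (generatedP S).

Lemma class_meetP (C D : {C | P C}) : P (fun x => sval C x /\ sval D x).
Proof.
have := PI (F := fun E => E = sval C \/ E = sval D).
have -> : (fun x => forall E, E = sval C \/ E = sval D -> E x) =
          (fun x => sval C x /\ sval D x).
  apply: funext => x; apply: propext; split=> [h|[h1 h2] E [->|->] //].
  by split; apply: h; auto.
by apply=> E [->|->]; [case: C | case: D].
Qed.

Program Definition class_lattice : lattice := @Lattice
  {C : T -> Prop | P C}
  (fun C D => forall x, sval C x -> sval D x)
  (class_gen (fun=> False))
  (fun C D => class_gen (fun x => sval C x \/ sval D x))
  (fun C D => exist _ _ (class_meetP C D))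
  _ _ _ _ _ _.
Next Obligation. by auto. Qed.
Next Obligation. by move=> E D F DE EF x /DE /EF. Qed.
Next Obligation. by move=> D E DE ED; apply: sig_pred_ext => x; split; auto. Qed.
Next Obligation. by move=> [C PC] x /=; apply. Qed.
Next Obligation.
move=> C D E /=; split=> [h|[h1 h2] x].
  by split=> x hx; apply: h => F [_]; apply; auto.
by apply; split=> [|y [/h1|/h2] //]; case: E {h1 h2}.
Qed.
Next Obligation.
move=> C D E /=; split=> [h|[h1 h2] x hx]; last by split; auto.
by split=> x /h [].
Qed.

End ClassLattice.

Section TorsionClasses.
Variable A : pzRingType.
Implicit Types (C : fgmod A -> Prop) (M N L X Y : fgmod A).

(* Closure under isomorphism is a case of closure under quotients, and closure
   under finite direct sums reduces to empty and binary ones. *)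
Definition pretorsion C : Prop :=
  [/\ forall M, zero_mod M -> C M,
      forall M N, mod_quotient M N -> C M -> C N
    & forall M X Y, mod_dsum M X Y -> C X -> C Y -> C M].

Definition torsion C : Prop :=
  pretorsion C /\
  forall L M N, mod_extension L M N -> C L -> C N -> C M.

Lemma pretorsionI (F : (fgmod A -> Prop) -> Prop) :
  (forall C, F C -> pretorsion C) -> pretorsion (fun M => forall C, F C -> C M).
Proof.
move=> FP; split=> [M M0 C FC|M N MN CM C FC|M X Y MXY CX CY C FC].
- by have [+ _ _] := FP _ FC; apply.
- by have [_ + _] := FP _ FC; apply; [exact: MN | exact: CM].
- by have [_ _ +] := FP _ FC; apply; [exact: MXY | exact: CX | exact: CY].
Qed.

Lemma torsionI (F : (fgmod A -> Prop) -> Prop) :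
  (forall C, F C -> torsion C) -> torsion (fun M => forall C, F C -> C M).
Proof.
move=> FP; split=> [|L M N LMN CL CN C FC].
  by apply: pretorsionI => C /FP [].
by have [_ +] := FP _ FC; apply; [exact: LMN | exact: CL | exact: CN].
Qed.

Definition pretors : lattice := class_lattice pretorsionI.
Definition tors : lattice := class_lattice torsionI.

Definition tors_incl (T : tors) : pretors := exist _ (sval T) (proj1 (svalP T)).

Definition Gen M : pretors := class_gen pretorsionI (fun N => N = M).

(* "The distributive closure of tors A can be identified with L_t(A)".  An order
   ideal D of Ji(tors A) is compared with a set of pretorsion classes by means
   of its image under the inclusion; the first condition thus also says that
   the Gen(M) in question are join-irreducible elements of tors A. *)
Definition dc_tors_identified : Prop :=
  exists phi : pretors -> distributive_closure tors,
    [/\ forall (T : pretors) (G : pretors),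
          (exists2 G' : tors, sval (phi T) G' & tors_incl G' = G) <->
          (exists M, [/\ indecomposable M, G = Gen M & lat_le (Gen M) T]),
        lattice_isomorphism phi
      & forall T : tors, dc_embed T = phi (tors_incl T)].

Lemma tors_incl_inj : injective tors_incl.
Proof.
move=> T T' /(congr1 sval) /= e; apply: sig_pred_ext => M.
by rewrite e.
Qed.

Lemma tors_finite : FinFun.Finite pretors -> FinFun.Finite tors.
Proof.
case=> s sP.
suff [t tP] : exists t : seq tors, forall T, List.In (tors_incl T) s -> List.In T t.
  by exists t => T; apply: tP; apply: sP.
elim: s {sP} => [|C s [t tP]]; first by exists [::].
have [[T TC]|nC] := EM (exists T, tors_incl T = C); last first.
  by exists t => T [TC|/tP //]; case: nC; exists T.
exists (T :: t) => T' [/esym|/tP]; last by right.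
by rewrite -TC => /tors_incl_inj ->; left.
Qed.

End TorsionClasses.

Section QuiverConditions.
Variables (k : fieldType) (Q : quiver) (I : tsIdeal (path_algebra k Q)).

Definition at_most_one_in : Prop :=
  forall v : vertex Q, (#|[pred a : arrow Q | tgt a == v]| <= 1)%N.

Definition at_most_two_out : Prop :=
  forall v : vertex Q, (#|[pred a : arrow Q | src a == v]| <= 2)%N.

Definition branching_relations : Prop :=
  forall (v : vertex Q) (alpha beta gamma : arrow Q),
    (forall a, tgt a = v <-> a = alpha) ->
    (forall a, src a = v <-> a = beta \/ a = gamma) -> beta <> gamma ->
    arrow_elt k alpha * arrow_elt k beta \in I \/
    arrow_elt k alpha * arrow_elt k gamma \in I.

Definition no_loops : Prop := forall a : arrow Q, src a <> tgt a.

Definition cycles_vanish : Prop :=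
  forall C : qpath Q, oriented_cycle C -> path_elt k C \in I.

End QuiverConditions.

(* Main.v *)
Require Import Defs.
From HB Require Import structures.
From mathcomp Require Import all_boot all_order all_algebra finmap monalg.
From mathcomp Require Import boolp classical_sets.
From Stdlib Require FinFun.

(* (1) implies (3).  Identifying L_t(A) with the distributive closure of tors A
   makes Gen(M) a torsion class for M indecomposable, and forces an
   indecomposable quotient of a direct sum X + Y to lie in Gen(X) or in Gen(Y).
   The first property fails for M = e_v A / cA if c is a longest nonzero cycle
   at v; the second one fails for an explicit module of dimension 3 or 5
   generated by two elements as soon as a vertex has two entering arrows, three
   exiting arrows, or a branching without zero relation.
   (2) implies (3).  A nonzero cycle at v acts as a nonzero nilpotent
   endomorphism of the indecomposable module e_v A.
   (3) implies (2) and (1).  There is at most one nonzero path between two given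
   vertices, and every module is a direct sum of local modules xA with
   x = x e_v; such a module has (xA) e_v = kx, so it is a brick, and a quotient
   of a direct sum onto it is already onto from one of the summands.  Hence
   the indecomposable modules in Gen(M) are the quotients of M when M is
   indecomposable, and the order ideals of the finite poset of the Gen(M)
   correspond to the pretorsion classes. *)

Set Implicit Arguments.
Unset Strict Implicit.
Unset Printing Implicit Defensive.

Import GRing.Theory.
Local Open Scope ring_scope.
Local Open Scope quotient_scope.

(** * Right modules and their quotients *)

(** The sufficiency of (3) rests on no classification of indecomposable modules but on the shape of
    the nonzero paths. Those that start at a vertex form at most two arms, because after a first
    arrow the branching relations leave at most one continuation. Of two paths that end at the same
    vertex one is a suffix of the other, because the last arrow is forced. This is rigid enough for
    a complement of xA to be cut out by two linear forms, one at the end of each arm. The delicate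
    choice is that of x, since both forms must restrict to the same form at the start vertex.

    In the other direction the ideal is only known to be admissible, so a test module has to satisfy
    unknown relations. A module on which all paths of length 2 act as zero always does, and this
    settles two entering and three exiting arrows. On the module for a branching two paths of length
    2 act nontrivially. It therefore comes last, once cycles vanish and nonzero paths are determined
    by their ends, for then no element of I involves a path that is nonzero in A. *)

Definition linear_of (R : pzRingType) (U V : lmodType R) (f : U -> V)
    (f_lin : linear f) : {linear U -> V} :=
  HB.pack f (GRing.isLinear.Build R U V *:%R f f_lin).

Definition ract (A : pzRingType) (M : lmodType A^c) (x : M) (a : A) : M :=
  (a : A^c) *: x.
Notation "x *< a" := (ract x a) (at level 40, left associativity).

Section RightAction.
Variable A : pzRingType.
Implicit Types (M N : lmodType A^c) (a b : A).

Lemma ractDl M (x y : M) a : (x + y) *< a = x *< a + y *< a.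
Proof. exact: scalerDr. Qed.

Lemma ractDr M (x : M) a b : x *< (a + b) = x *< a + x *< b.
Proof. exact: scalerDl. Qed.

Lemma ractA M (x : M) a b : x *< (a * b) = x *< a *< b.
Proof. by rewrite /ract scalerA. Qed.

Lemma ract1 M (x : M) : x *< 1 = x.
Proof. exact: scale1r. Qed.

Lemma ract0l M a : (0 : M) *< a = 0.
Proof. exact: scaler0. Qed.

Lemma ract0r M (x : M) : x *< 0 = 0.
Proof. exact: scale0r. Qed.

Lemma ractNl M (x : M) a : (- x) *< a = - (x *< a).
Proof. exact: scalerN. Qed.

Lemma ractNr M (x : M) a : x *< (- a) = - (x *< a).
Proof. exact: scaleNr. Qed.

Lemma ractBl M (x y : M) a : (x - y) *< a = x *< a - y *< a.
Proof. exact: scalerBr. Qed.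

Lemma ractBr M (x : M) a b : x *< (a - b) = x *< a - x *< b.
Proof. exact: scalerBl. Qed.

Lemma ract_suml (J : Type) (r : seq J) (P : pred J) M (F : J -> M) a :
  (\sum_(j <- r | P j) F j) *< a = \sum_(j <- r | P j) F j *< a.
Proof. exact: scaler_sumr. Qed.

Lemma ract_sumr (J : Type) (r : seq J) (P : pred J) M (x : M) (F : J -> A) :
  x *< (\sum_(j <- r | P j) F j) = \sum_(j <- r | P j) x *< F j.
Proof. exact: scaler_suml. Qed.

Lemma ract_lin M N (f : {linear M -> N}) x a : f (x *< a) = f x *< a.
Proof. exact: linearZ. Qed.

Lemma linear_ract M N (f : M -> N) :
  {morph f : x y / x + y} -> (forall x a, f (x *< a) = f x *< a) -> linear f.
Proof. by move=> fD fZ a x y; rewrite fD; congr (_ + _); exact: fZ. Qed.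

End RightAction.

Section Submodules.
Variables (A : pzRingType) (M : lmodType A^c).

Record is_submod (S : M -> Prop) : Prop := IsSubmod {
  submod0 : S 0;
  submodD : forall x y, S x -> S y -> S (x + y);
  submodZ : forall x (a : A), S x -> S (x *< a)
}.

Variables (S : M -> Prop) (subS : is_submod S).

Lemma submodN x : S x -> S (- x).
Proof. by move=> Sx; rewrite -[x]ract1 -ractNr; apply: submodZ. Qed.

Lemma submodB x y : S x -> S y -> S (x - y).
Proof. by move=> Sx Sy; apply: submodD => //; apply: submodN. Qed.

Lemma submod_sum (J : Type) (r : seq J) (P : pred J) (F : J -> M) :
  (forall j, P j -> S (F j)) -> S (\sum_(j <- r | P j) F j).
Proof. move=> SF; apply: big_ind => //; [exact: submod0 | exact: submodD]. Qed.

End Submodules.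

Definition spred (A : pzRingType) (M : lmodType A^c) (S : M -> Prop)
  (subS : is_submod S) : {pred M} := fun x => `[< S x >].

Section QuotientModule.
Variables (A : pzRingType) (M : lmodType A^c) (S : M -> Prop).
Variable (subS : is_submod S).

Lemma spred_zmod_closed : zmod_closed (spred subS).
Proof.
split=> [|x y]; first by apply/asboolP; exact: submod0.
by move=> /asboolP Sx /asboolP Sy; apply/asboolP; exact: submodB.
Qed.

HB.instance Definition _ :=
  GRing.isZmodClosed.Build M (spred subS) spred_zmod_closed.

Definition qmod := Quotient.quot (spred subS).
HB.instance Definition _ := GRing.Zmodule.on qmod.

Definition qm_pi (x : M) : qmod := \pi_(Quotient.quot (spred subS)) x.

Lemma qm_pi_eq x y : qm_pi x = qm_pi y <-> S (x - y).
Proof.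
rewrite -(asboolE (S (x - y))) -[asbool _]/(x - y \in spred subS).
rewrite Quotient.idealrBE; split; first by move=> e; apply/eqP.
by move/eqP.
Qed.

Lemma qm_piD : {morph qm_pi : x y / x + y}.
Proof. exact: raddfD. Qed.

Lemma qm_repr (u : qmod) : qm_pi (repr u) = u.
Proof. exact: reprK. Qed.

Definition qm_scale (a : A^c) (u : qmod) : qmod := qm_pi (a *: repr u).

Lemma qm_scaleE a x : qm_scale a (qm_pi x) = qm_pi (a *: x).
Proof.
apply/qm_pi_eq; rewrite -scalerBr; apply: (submodZ subS).
by apply/qm_pi_eq; exact: qm_repr.
Qed.

Lemma qm_scaleA a b u : qm_scale a (qm_scale b u) = qm_scale (a * b) u.
Proof. by rewrite -[u]qm_repr !qm_scaleE scalerA. Qed.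

Lemma qm_scale1 : left_id 1 qm_scale.
Proof. by move=> u; rewrite -[u]qm_repr !qm_scaleE scale1r. Qed.

Lemma qm_scaleDr : right_distributive qm_scale +%R.
Proof.
by move=> a u v; rewrite -[u]qm_repr -[v]qm_repr -qm_piD !qm_scaleE -qm_piD scalerDr.
Qed.

Lemma qm_scaleDl u : {morph qm_scale^~ u : a b / a + b}.
Proof. by move=> a b; rewrite -[u]qm_repr !qm_scaleE -qm_piD scalerDl. Qed.

HB.instance Definition _ := GRing.Zmodule_isLmodule.Build A^c qmod
  qm_scaleA qm_scale1 qm_scaleDr qm_scaleDl.

Lemma qm_pi_linear : linear qm_pi.
Proof. by move=> a x y; rewrite qm_piD -qm_scaleE. Qed.

HB.instance Definition _ := GRing.isLinear.Build A^c M qmod *:%R qm_pi qm_pi_linear.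

End QuotientModule.

Section FinitelyGenerated.
Variable A : pzRingType.
Implicit Types (M N : lmodType A^c).

Lemma fg_image M N (f : {linear M -> N}) :
  (forall y, exists x, f x = y) -> finitely_generated M -> finitely_generated N.
Proof.
move=> f_surj [n [g gP]]; exists n, (fun i => f (g i)) => y.
have [x <-] := f_surj y; have [c ->] := gP x; exists c.
by rewrite linear_sum; apply: eq_bigr => i _; rewrite linearZ.
Qed.

Lemma fg_regular : finitely_generated ((A^c)^o : lmodType A^c).
Proof.
exists 1%N, (fun=> 1) => x; exists (fun=> x).
by rewrite big_ord1; exact: esym (mulr1 (x : A^c)).
Qed.

Lemma fg_prod M N :
  finitely_generated M -> finitely_generated N ->
  finitely_generated ((M * N)%type : lmodType A^c).
Proof.
move=> [m [g gP]] [n [h hP]]; exists (m + n)%N.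
exists (fun i => match split i with inl i => (g i, 0) | inr i => (0, h i) end).
move=> [x y]; have [c cP] := gP x; have [d dP] := hP y.
exists (fun i => match split i with inl i => c i | inr i => d i end).
rewrite big_split_ord /=.
have E1 i : split (lshift n i) = inl i := unsplitK (inl i).
have E2 i : split (rshift m i) = inr i := unsplitK (inr i).
under eq_bigr do rewrite !E1; under [X in _ + X]eq_bigr do rewrite !E2.
have -> : \sum_i (c i *: (g i, 0 : N)) = (x, 0).
  rewrite cP; elim/big_rec2: _ => [//|i u v _ ->].
  by apply: injective_projections; rewrite /= ?scaler0 ?addr0.
have -> : \sum_i (d i *: (0 : M, h i)) = (0, y).
  rewrite dP; elim/big_rec2: _ => [//|i u v _ ->].
  by apply: injective_projections; rewrite /= ?scaler0 ?addr0.
by apply: injective_projections; rewrite /= ?addr0 ?add0r.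
Qed.

Lemma linear_factor M N (P : lmodType A^c) (g : {linear M -> N})
    (f : {linear M -> P}) :
  (forall y, exists x, g x = y) -> (forall x, g x = 0 -> f x = 0) ->
  exists h : {linear N -> P}, forall x, h (g x) = f x.
Proof.
move=> g_surj gf; pose h y := f (sval (cid (g_surj y))).
have hE x : h (g x) = f x.
  rewrite /h; case: cid => /= z zx; apply/eqP; rewrite -subr_eq0 -linearB.
  by apply/eqP/gf; rewrite linearB /= zx subrr.
have h_lin : linear h.
  move=> a u v; have [x <-] := g_surj u; have [y <-] := g_surj v.
  by rewrite -linearP !hE linearP.
by exists (linear_of h_lin).
Qed.

End FinitelyGenerated.

(** * Pretorsion classes, cyclic modules and consequences of the identification *)

Section Pretorsion.
Variable A : pzRingType.
Implicit Types (M N X Y Z : fgmod A) (C : fgmod A -> Prop).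

Definition fgquot M (S : M -> Prop) (subS : is_submod S) : fgmod A :=
  FGMod (fg_image (f := qm_pi subS) (fun y => ex_intro _ _ (qm_repr y)) (fgmodP M)).

Definition regmod : fgmod A := FGMod (fg_regular A).

Definition prodmod X Y : fgmod A := FGMod (fg_prod (fgmodP X) (fgmodP Y)).

Lemma prodmod_dsum X Y : mod_dsum (prodmod X Y) X Y.
Proof.
have l : linear (fun x : prodmod X Y => x : (X * Y)%type) by [].
by exists (linear_of l); exists id.
Qed.

Lemma mod_quotient_refl M : mod_quotient M M.
Proof.
have l : linear (fun x : M => x) by [].
by exists (linear_of l) => y; exists y.
Qed.

Lemma mod_quotient_trans N M Z :
  mod_quotient M N -> mod_quotient N Z -> mod_quotient M Z.
Proof.
move=> [f f_surj] [g g_surj].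
have l : linear (fun x => g (f x)) by move=> a x y; rewrite !linearP.
exists (linear_of l) => z; have [y <-] := g_surj z; have [x <-] := f_surj y.
by exists x.
Qed.

Lemma mod_quotient_factor M N Z (g : {linear M -> N}) (f : {linear M -> Z}) :
  (forall y, exists x, g x = y) -> (forall y, exists x, f x = y) ->
  (forall x, g x = 0 -> f x = 0) -> mod_quotient N Z.
Proof.
move=> g_surj f_surj gf; have [h hE] := linear_factor g_surj gf.
by exists h => z; have [x <-] := f_surj z; exists (g x); exact: hE.
Qed.

Lemma fgquot_surj M (S : M -> Prop) (subS : is_submod S) (y : fgquot subS) :
  exists x, qm_pi subS x = y.
Proof. by exists (repr y); exact: qm_repr. Qed.

Lemma fgquot_ker M (S : M -> Prop) (subS : is_submod S) x :
  qm_pi subS x = 0 <-> S x.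
Proof. by rewrite -(linear0 (qm_pi subS)) qm_pi_eq subr0. Qed.

Lemma mod_dsum_quotientl M X Y : mod_dsum M X Y -> mod_quotient M X.
Proof.
move=> [f [g fg gf]].
have l : linear (fun x => (f x).1) by move=> a x y; rewrite linearP.
by exists (linear_of l) => y; exists (g (y, 0)); rewrite /= gf.
Qed.

Lemma mod_dsum_sym M X Y : mod_dsum M X Y -> mod_dsum M Y X.
Proof.
move=> [f [g fg gf]].
have l : linear (fun x => ((f x).2, (f x).1)) by move=> a x y; rewrite linearP.
exists (linear_of l); exists (fun p => g (p.2, p.1)) => [x|[x y]] /=.
  by rewrite -surjective_pairing fg.
by rewrite gf.
Qed.

Lemma mod_dsum_quotientr M X Y : mod_dsum M X Y -> mod_quotient M Y.
Proof. by move=> /mod_dsum_sym /mod_dsum_quotientl. Qed.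

Lemma mod_dsum_biprod M X Y : mod_dsum M X Y ->
  exists (f : {linear X -> M}) (g : {linear Y -> M})
         (p : {linear M -> X}) (q : {linear M -> Y}),
    [/\ cancel f p, cancel g q, forall y, p (g y) = 0, forall x, q (f x) = 0
      & forall z, z = f (p z) + g (q z)].
Proof.
move=> [F [h Fh hF]].
have hP : linear h.
  by move=> a u v; apply: (can_inj Fh); rewrite linearP !hF.
have l1 : linear (fun x : X => h (x, 0)).
  move=> a x y; rewrite -hP; congr (h _).
  by congr pair; rewrite /= scaler0 addr0.
have l2 : linear (fun x : Y => h (0, x)).
  move=> a x y; rewrite -hP; congr (h _).
  by congr pair; rewrite /= scaler0 addr0.
have l3 : linear (fun z => (F z).1) by move=> a x y; rewrite linearP.
have l4 : linear (fun z => (F z).2) by move=> a x y; rewrite linearP.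
exists (linear_of l1), (linear_of l2), (linear_of l3), (linear_of l4); split => /=.
- by move=> x /=; rewrite hF.
- by move=> x /=; rewrite hF.
- by move=> x /=; rewrite hF.
- by move=> x /=; rewrite hF.
- move=> z; apply: (can_inj Fh).
  by rewrite linearD !hF; apply: injective_projections; rewrite /= ?addr0 ?add0r.
Qed.

(** Both summands are written as quotients, [M / S] being isomorphic to [T]: quotients of a finitely
    generated module are finitely generated over any ring, submodules need not be. *)
Lemma submod_dsum M (S T : M -> Prop) (subS : is_submod S) (subT : is_submod T) :
  (forall x, S x -> T x -> x = 0) -> (forall x, exists s t, [/\ S s, T t & x = s + t]) ->
  mod_dsum M (fgquot subS) (fgquot subT).
Proof.
move=> ST0 STM.
pose f x : (fgquot subS * fgquot subT)%type := (qm_pi subS x, qm_pi subT x).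
have l : linear f by move=> a x y; rewrite /f !linearP.
have f_inj : injective f.
  move=> x y [/qm_pi_eq Sxy /qm_pi_eq Txy].
  by apply/eqP; rewrite -subr_eq0; apply/eqP; exact: ST0.
have f_surj (p : (fgquot subS * fgquot subT)%type) : exists x, f x = p.
  case: p => u v; have [x <-] := fgquot_surj u; have [y <-] := fgquot_surj v.
  have [s [t [Ss Tt e]]] := STM (x - y).
  exists (x - s); congr pair; apply/qm_pi_eq.
    by rewrite addrAC subrr add0r; apply: (submodN subS).
  by rewrite addrAC e addrAC subrr add0r.
exists (linear_of l); exists (fun p => sval (cid (f_surj p))) => [x|p].
  by apply: f_inj; case: cid.
by case: cid.
Qed.

Lemma Gen_self M : sval (Gen M) M.
Proof. by move=> C [_]; apply. Qed.

Lemma Gen_le C (PC : pretorsion C) M :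
  C M -> forall N, sval (Gen M) N -> C N.
Proof. by move=> CM N /(_ C); apply; split=> // _ ->. Qed.

Lemma Gen_pretorsion M : pretorsion (sval (Gen M)).
Proof. by case: (Gen M). Qed.

Lemma quotient_Gen M N : mod_quotient M N -> sval (Gen M) N.
Proof. by move=> MN C [[_ CQ _] CM]; apply: CQ MN (CM _ _). Qed.

Lemma dc_Gen_torsion M : dc_tors_identified A -> indecomposable M ->
  torsion (sval (Gen M)).
Proof.
move=> [phi [phiE _ _]] M_ind.
have [G' _ <-] := (phiE (Gen M) (Gen M)).2
  (ex_intro _ M (And3 M_ind erefl (lat_refl (Gen M)))).
exact: (svalP G').
Qed.

(** Joins of order ideals are unions, so [Gen M], which belongs to the ideal of the join of [Gen X]
    and [Gen Y], already belongs to one of the two ideals. *)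
Lemma dc_join_prime M Z X Y : dc_tors_identified A -> indecomposable M ->
  mod_dsum Z X Y -> mod_quotient Z M -> sval (Gen X) M \/ sval (Gen Y) M.
Proof.
move=> [phi [phiE [_ phiU _] _]] M_ind ZXY ZM.
have GM : lat_le (Gen M) (lat_join (Gen X) (Gen Y)).
  apply: Gen_le => [|C [[_ CQ CD] CXY]]; first exact: generatedP (@pretorsionI A) _.
  by apply: (CQ _ _ ZM); apply: (CD _ _ _ ZXY); apply: CXY; [left|right]; exact: Gen_self.
have [G'] := (phiE (lat_join (Gen X) (Gen Y)) (Gen M)).2
  (ex_intro _ M (And3 M_ind erefl GM)).
have main Z' : sval (phi (Gen Z')) G' -> tors_incl G' = Gen M -> sval (Gen Z') M.
  move=> G'Z e; have [N [_ eN NZ]] := (phiE (Gen Z') (Gen M)).1 (ex_intro2 _ _ G' G'Z e).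
  by apply: NZ; rewrite -eN; exact: Gen_self.
rewrite phiU => -[G'X|G'Y] e; [left|right]; exact: main e.
Qed.

Lemma regmod_hom Z (z : Z) : exists f : {linear regmod -> Z}, forall a, f a = z *< a.
Proof.
have l : linear (fun a : regmod => z *< (a : A)).
  by apply: linear_ract => [a b|a b]; [exact: ractDr | exact: ractA].
by exists (linear_of l).
Qed.

Section Cyclic.
Variables (S : regmod -> Prop) (subS : is_submod S).

Definition cyc_gen : fgquot subS := qm_pi subS (1 : A).

Lemma cyc_genE (a : A) : cyc_gen *< a = qm_pi subS (a : regmod).
Proof. by rewrite /cyc_gen -ract_lin; congr (qm_pi subS _); exact: (mul1r a). Qed.

Lemma cyc_gen0 (a : A) : cyc_gen *< a = 0 <-> S a.
Proof. by rewrite cyc_genE fgquot_ker. Qed.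

Lemma cyc_gen_surj (y : fgquot subS) : exists a : A, y = cyc_gen *< a.
Proof. by have [a <-] := fgquot_surj y; exists a; rewrite cyc_genE. Qed.

Lemma cyc_hom Z (z : Z) : (forall a : A, S a -> z *< a = 0) ->
  exists f : {linear fgquot subS -> Z}, forall a, f (cyc_gen *< a) = z *< a.
Proof.
move=> zS; have [g gE] := regmod_hom z.
have [|h hE] := @linear_factor _ _ _ _ (qm_pi subS) g (@fgquot_surj _ _ subS).
  by move=> a /fgquot_ker Sa; rewrite gE; exact: zS.
by exists h => a; rewrite cyc_genE hE gE.
Qed.

Lemma cyc_quotient Z (z : Z) : (forall a : A, S a -> z *< a = 0) ->
  (forall y, exists a, y = z *< a) -> mod_quotient (fgquot subS) Z.
Proof.
move=> zS zG; have [f fE] := cyc_hom zS.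
by exists f => y; have [a ->] := zG y; exists (cyc_gen *< a).
Qed.

End Cyclic.

Lemma submod_ann M (x : M) : is_submod (fun a : regmod => x *< (a : A) = 0).
Proof.
split=> [|a b xa xb|a b xa]; first exact: ract0r.
- by rewrite ractDr xa xb addr0.
- by rewrite [_ *< _](ractA x a b) xa ract0l.
Qed.

(** The submodule xA in the form A / ann(x), which makes its finite generation evident. *)
Definition cycmod M (x : M) : fgmod A := fgquot (submod_ann x).

(** The direct sum of xA and yA maps onto [M], so [dc_join_prime] puts [M] into the class generated
    by one of them. A contradiction then only needs two pretorsion classes that contain xA and yA
    respectively, but not [M]. *)
Lemma dc_two_generators M (x y : M) (C1 C2 : fgmod A -> Prop) :
  dc_tors_identified A -> indecomposable M -> pretorsion C1 -> pretorsion C2 ->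
  (forall z, exists a b, z = x *< a + y *< b) ->
  C1 (cycmod x) -> C2 (cycmod y) -> C1 M \/ C2 M.
Proof.
move=> dc M_ind P1 P2 gen Cx Cy.
have [f fE] := cyc_hom (submod_ann x) (z := x) (fun a => id).
have [g gE] := cyc_hom (submod_ann y) (z := y) (fun a => id).
pose Z := prodmod (cycmod x) (cycmod y).
have l : linear (fun z : Z => f z.1 + g z.2).
  by move=> a u v; rewrite !linearP /= scalerDr addrACA.
have ZM : mod_quotient Z M.
  exists (linear_of l) => z; have [a [b ->]] := gen z.
  by exists (cyc_gen _ *< a, cyc_gen _ *< b); rewrite /= fE gE.
have [] := dc_join_prime dc M_ind (prodmod_dsum _ _) ZM.
  by left; apply: Gen_le Cx _ _.
by right; apply: Gen_le Cy _ _.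
Qed.

Lemma pretorsion_ann (a : A) :
  pretorsion (fun M : fgmod A => forall x : M, x *< a = 0).
Proof.
split=> [M M0 x|M N [f f_surj] Ma y|M X Y [f [g fg gf]] Xa Ya x].
- exact: M0.
- by have [x <-] := f_surj y; rewrite -ract_lin Ma linear0.
- apply: (can_inj fg); rewrite linear0 ract_lin.
  by apply: injective_projections; [exact: Xa | exact: Ya].
Qed.

(** The class of all M with Ma contained in Mb. With a = e_v and b an arrow into v it says that
    everything at v comes through this arrow. *)
Lemma pretorsion_image (a b : A) :
  pretorsion (fun M : fgmod A => forall x : M, exists y, x *< a = y *< b).
Proof.
split=> [M M0 x|M N [f f_surj] Mab y|M X Y [f [g fg gf]] Xab Yab z].
- by exists 0; rewrite ract0l; exact: M0.
- by have [x <-] := f_surj y; have [x' e] := Mab x; exists (f x'); rewrite -!ract_lin e.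
have [x ex] := Xab (f z).1; have [y ey] := Yab (f z).2; exists (g (x, y)).
apply: (can_inj fg); rewrite !ract_lin gf.
by apply: injective_projections; [exact: ex | exact: ey].
Qed.

End Pretorsion.

(** * Path algebras and admissible ideals *)

Section PathDegree.
Variables (k : fieldType) (Q : quiver).
Local Notation kQ := (path_algebra k Q).
Implicit Types (f g : kQ) (p q r : qpath Q).

Definition plen p := size (path_arrows p).

Lemma path_cat_some p q r : path_cat p q = Some r ->
  [/\ path_end p = path_start q, path_start r = path_start p,
      path_end r = path_end q & path_arrows r = path_arrows p ++ path_arrows q].
Proof.
move/(congr1 (omap val)); rewrite path_catE; case: eqP => //= e [] er.
have [e1 e2] : path_start r = path_start p /\ path_arrows r = path_arrows p ++ path_arrows q.
  by split; [exact: (congr1 (@fst _ _) (esym er)) | exact: (congr1 (@snd _ _) (esym er))].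
by split=> //; rewrite /path_end e1 e2 map_cat last_cat -/(path_end p) e.
Qed.

Lemma path_cat_ex p q : path_end p = path_start q ->
  exists r, path_cat p q = Some r.
Proof.
move=> e; case E: (path_cat p q) => [r|]; first by exists r.
by move/(congr1 (omap val)): E; rewrite path_catE e eqxx.
Qed.

Lemma path_cat_none p q : path_end p <> path_start q -> path_cat p q = None.
Proof. by rewrite /path_cat; case: eqP. Qed.

Lemma path_eqP p q : path_start p = path_start q -> path_arrows p = path_arrows q ->
  p = q.
Proof.
case: p q => [[v s] ps] [[w t] qt]; rewrite /path_start /path_arrows /= => e1 e2.
by apply: val_inj; rewrite /= e1 e2.
Qed.

Lemma path_algebraE f : f = \sum_(p <- msupp f) f@_p *: path_elt k p.
Proof.
rewrite {1}[f]monalgE; apply: eq_bigr => p _.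
by rewrite /path_elt path_termZ mulr1 path_term.unlock.
Qed.

Lemma path_elt_coef p q : (path_elt k p)@_q = (p == q)%:R.
Proof. by rewrite /path_elt path_term.unlock mcoeffU. Qed.

(** The power R_Q^t expressed by coefficients, which turns admissibility into a condition on lengths
    of paths. *)
Definition highdeg t f : bool := `[< forall p, (plen p < t)%N -> f@_p = 0 >].

Lemma highdegP t f : reflect (forall p, (plen p < t)%N -> f@_p = 0) (f \in highdeg t).
Proof. exact: asboolP. Qed.

Lemma path_elt_highdeg p t : (path_elt k p \in highdeg t) = (t <= plen p)%N.
Proof.
apply/highdegP/idP => [h|le q lq].
  rewrite leqNgt; apply/negP => /h; rewrite path_elt_coef eqxx => /eqP.
  by rewrite oner_eq0.
by rewrite path_elt_coef; case: eqP => // e; move: lq; rewrite -e ltnNge le.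
Qed.

Lemma highdeg_zmod t : zmod_closed (highdeg t).
Proof.
split=> [|f g /highdegP hf /highdegP hg]; apply/highdegP => p lp.
  by rewrite mcoeff0.
by rewrite mcoeffB hf ?hg ?subrr.
Qed.

HB.instance Definition _ t := GRing.isZmodClosed.Build kQ (highdeg t) (highdeg_zmod t).

Lemma highdegZ t c f : f \in highdeg t -> c *: f \in highdeg t.
Proof. by move=> /highdegP h; apply/highdegP => p /h; rewrite mcoeffZ => ->; rewrite mulr0. Qed.

Lemma highdegM s t f g : f \in highdeg s -> g \in highdeg t -> f * g \in highdeg (s + t).
Proof.
move=> /highdegP hf /highdegP hg.
rewrite [f]path_algebraE [g]path_algebraE mulr_suml; apply: rpred_sum => p _.
rewrite mulr_sumr; apply: rpred_sum => q _.
have [lp|sp] := ltnP (plen p) s; first by rewrite hf // scale0r mul0r rpred0.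
have [lq|tq] := ltnP (plen q) t; first by rewrite hg // scale0r mulr0 rpred0.
rewrite -path_algebra_scaleAl -path_algebra_scaleAr path_eltM.
do 2 apply: highdegZ.
case E: path_cat => [r|]; last exact: rpred0.
have [_ _ _ e] := path_cat_some E.
by rewrite path_elt_highdeg /plen e size_cat leq_add.
Qed.

Lemma highdeg0 f : f \in highdeg 0.
Proof. exact/highdegP. Qed.

Lemma highdeg_two_sided t : two_sided_closed (highdeg t).
Proof.
move=> a u hu; split; first by rewrite -[t]add0n; exact: highdegM (highdeg0 a) hu.
by rewrite -[t]addn0; exact: highdegM hu (highdeg0 a).
Qed.

Definition highdeg_ideal t : tsIdeal kQ := HB.pack_for (tsIdeal kQ) (highdeg t)
  (GRing.isZmodClosed.Build kQ (highdeg t) (highdeg_zmod t))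
  (isTwoSidedClosed.Build kQ (highdeg t) (@highdeg_two_sided t)).

Lemma ideal_pow_highdeg n f : ideal_pow (@arrow_ideal k Q) n f -> f \in highdeg n.
Proof.
elim: n f => [|n IH] f; first by rewrite highdeg0.
move=> /= hf; apply: (hf (highdeg_ideal n.+1)) => _ [x [y [hx hy ->]]].
rewrite -add1n; apply: highdegM; last exact: IH.
apply: (hx (highdeg_ideal 1)) => _ [a _ <-].
by rewrite /arrow_elt path_elt_highdeg.
Qed.

Lemma arrow_cons_elt p a s : path_arrows p = a :: s ->
  exists q, [/\ path_start q = tgt a, path_arrows q = s
    & path_elt k p = arrow_elt k a * path_elt k q].
Proof.
case: p => [[v s'] /= ps]; rewrite /path_arrows /= => e; subst s'.
have /andP[/eqP av qs] := ps.
exists (@QPath _ (tgt a, s) qs); split=> //.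
rewrite /arrow_elt path_eltM.
case: (@path_cat_ex (arrow_path a) (@QPath _ (tgt a, s) qs)) => // r E.
rewrite E; have [_ e1 _ e2] := path_cat_some E.
by congr path_elt; apply: path_eqP; rewrite ?e1 ?e2.
Qed.

Lemma ideal_pow_path n p : (n <= plen p)%N ->
  ideal_pow (@arrow_ideal k Q) n (path_elt k p).
Proof.
elim: n p => [//|n IH] p; rewrite /plen; case E: (path_arrows p) => [//|a s] /= le.
have [q [_ eq_s ->]] := arrow_cons_elt E.
move=> J; apply; exists (arrow_elt k a), (path_elt k q); split=> //.
  by move=> J' ; apply; exists a.
by apply: IH; rewrite /plen eq_s.
Qed.

End PathDegree.

Section Admissible.
Variables (k : fieldType) (Q : quiver) (I : tsIdeal (path_algebra k Q)).
Hypothesis I_adm : admissible I.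
Local Notation kQ := (path_algebra k Q).
Local Notation A := (quotient_ring I).

Lemma admissible_long : exists m, forall f : kQ, f \in highdeg m -> f \in I.
Proof.
have [[m _ mP] _] := I_adm; exists m => f /highdegP hf.
rewrite [f]path_algebraE; apply: rpred_sum => p _.
have [lp|le] := ltnP (plen p) m; first by rewrite hf // scale0r rpred0.
rewrite -[path_elt k p]mul1r path_algebra_scaleAl; apply: tsideal_mull.
by apply: mP; exact: ideal_pow_path.
Qed.

Lemma admissible_short (f : kQ) : f \in I -> f \in highdeg 2.
Proof. by have [_ h] := I_adm; move=> /h /ideal_pow_highdeg. Qed.

End Admissible.

(** * Idempotents and cycles *)

HB.lock Definition alg_path (k : fieldType) (Q : quiver)
    (I : tsIdeal (path_algebra k Q)) (p : qpath Q) : quotient_ring I :=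
  qproj I (path_elt k p).

HB.lock Definition alg_scalar (k : fieldType) (Q : quiver)
    (I : tsIdeal (path_algebra k Q)) (c : k) : quotient_ring I :=
  qproj I (c *: (1 : path_algebra k Q)).

Definition alg_idem (k : fieldType) (Q : quiver)
    (I : tsIdeal (path_algebra k Q)) (v : vertex Q) : quotient_ring I :=
  alg_path I (vertex_path v).

Section BoundQuiverAlgebra.
Variables (k : fieldType) (Q : quiver) (I : tsIdeal (path_algebra k Q)).
Local Notation kQ := (path_algebra k Q).
Local Notation A := (quotient_ring I).
Implicit Types (p q r : qpath Q) (v w : vertex Q) (a b : A) (c d : k).

Local Notation pe := (@alg_path k Q I).
Local Notation sc := (@alg_scalar k Q I).
Local Notation ve := (@alg_idem k Q I).

Lemma qproj_eq0 f : (qproj I f == 0) = (f \in I).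
Proof. by rewrite -(qproj0 I) qproj_eq subr0. Qed.

Lemma pe_eq0 p : pe p = 0 <-> path_elt k p \in I.
Proof. by rewrite alg_path.unlock -qproj_eq0; split=> /eqP. Qed.

Lemma scE c : sc c = qproj I (c *: (1 : kQ)).
Proof. by rewrite alg_scalar.unlock. Qed.

Lemma qprojZ c f : qproj I (c *: f) = sc c * qproj I f.
Proof. by rewrite scE -qprojM -path_algebra_scaleAl mul1r. Qed.

Lemma sc_central c a : sc c * a = a * sc c.
Proof.
rewrite -[a]qproj_repr scE -!qprojM.
by rewrite -path_algebra_scaleAl -path_algebra_scaleAr mul1r mulr1.
Qed.

Lemma sc1 : sc 1 = 1.
Proof. by rewrite scE scale1r. Qed.

Lemma sc0 : sc 0 = 0.
Proof. by rewrite scE scale0r qproj0. Qed.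

Lemma scD c d : sc (c + d) = sc c + sc d.
Proof. by rewrite !scE scalerDl qprojD. Qed.

Lemma scM c d : sc (c * d) = sc c * sc d.
Proof. by rewrite (scE d) -qprojZ scalerA scE. Qed.

Lemma scN c : sc (- c) = - sc c.
Proof. by rewrite !scE scaleNr; exact: raddfN. Qed.

Lemma qproj_sum (J : Type) (s : seq J) (P : pred J) (F : J -> kQ) :
  qproj I (\sum_(j <- s | P j) F j) = \sum_(j <- s | P j) qproj I (F j).
Proof. exact: raddf_sum. Qed.

Lemma algebraE (f : kQ) : qproj I f = \sum_(p <- msupp f) sc f@_p * pe p.
Proof.
rewrite {1}[f]path_algebraE qproj_sum.
by apply: eq_bigr => p _; rewrite qprojZ alg_path.unlock.
Qed.

Lemma algebra_ind (P : A -> Prop) : P 0 -> (forall a b, P a -> P b -> P (a + b)) ->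
  (forall c p, P (sc c * pe p)) -> forall a, P a.
Proof.
move=> P0 PD PU a; rewrite -[a]qproj_repr algebraE.
by apply: big_ind => // p _; exact: PU.
Qed.

Lemma pe_cat p q r : path_cat p q = Some r -> pe p * pe q = pe r.
Proof. by rewrite alg_path.unlock -qprojM path_eltM => ->. Qed.

Lemma pe_ncat p q : path_end p <> path_start q -> pe p * pe q = 0.
Proof. by move=> /path_cat_none e; rewrite alg_path.unlock -qprojM path_eltM e qproj0. Qed.

Lemma ve_pe v p : ve v * pe p = if v == path_start p then pe p else 0.
Proof.
rewrite /alg_idem alg_path.unlock -qprojM path_eltM path_cat_vl.
by case: eqP; rewrite ?qproj0.
Qed.

Lemma pe_ve v p : pe p * ve v = if v == path_end p then pe p else 0.
Proof.
rewrite /alg_idem alg_path.unlock -qprojM path_eltM path_cat_vr.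
by case: eqP; rewrite ?qproj0.
Qed.

Lemma ve_ve v w : ve v * ve w = if v == w then ve w else 0.
Proof. by rewrite ve_pe. Qed.

Lemma ve_idem v : ve v * ve v = ve v.
Proof. by rewrite ve_ve eqxx. Qed.

Lemma sum_ve : \sum_v ve v = 1.
Proof. by rewrite -qproj1 /alg_idem alg_path.unlock -qproj_sum. Qed.

Lemma ract_sum_ve (M : lmodType A^c) (x : M) : x = \sum_v x *< ve v.
Proof. by rewrite -ract_sumr sum_ve ract1. Qed.

Lemma ract_scC (M : lmodType A^c) (x : M) c a : x *< sc c *< a = x *< a *< sc c.
Proof. by rewrite -!ractA sc_central. Qed.

Lemma ract_sc_eq0 (M : lmodType A^c) (x : M) c : x *< sc c = 0 -> c <> 0 -> x = 0.
Proof.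
move=> xc0 /eqP c0; rewrite -[x]ract1 -sc1 -(divff c0) scM ractA xc0.
exact: ract0l.
Qed.

(** Applied to the projection onto X along Y: the n-th power of f - l is the identity on X if l = 0,
    and the invertible scalar (-l)^n on Y otherwise, so one of the summands vanishes. *)
Lemma indec_nilp (M : fgmod A) : ~ zero_mod M ->
  (forall f : {linear M -> M}, exists l n, forall x,
     iter n (fun y => f y - y *< sc l) x = 0) -> indecomposable M.
Proof.
move=> M0 nilp; split=> // X Y /mod_dsum_biprod [f [g [p [q [fp gq pg qf _]]]]].
have l : linear (fun z => f (p z)) by move=> a x y; rewrite !linearP.
have [c [n cn]] := nilp (linear_of l).
have [c0|c0] := EM (c = 0).
  left=> x; have := cn (f x).
  have -> : iter n (fun y => linear_of l y - y *< sc c) (f x) = f x.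
    elim: n {cn} => //= n ->; rewrite fp c0 sc0.
    by rewrite (ract0r (f x)) subr0.
  by move/(congr1 p); rewrite fp linear0.
right=> y; have := cn (g y).
have -> : iter n (fun z => linear_of l z - z *< sc c) (g y) = g (y *< sc ((- c) ^+ n)).
  elim: n {cn} => [|n IH] /=; first by rewrite expr0 sc1 ract1.
  by rewrite IH pg linear0 add0r exprSr scM (ractA y) scN ractNr -ract_lin linearN.
move/(congr1 q); rewrite gq linear0 => /ract_sc_eq0; apply.
by apply/eqP; rewrite expf_neq0 // oppr_eq0; exact/eqP.
Qed.

Section CyclesVanish.
Hypothesis cyc : cycles_vanish I.

(** A path of positive length from v to v is a cycle, so only the multiples of e_v survive in e_v A
    e_v. *)
Lemma corner_cycles v a : exists c, ve v * a * ve v = sc c * ve v.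
Proof.
elim/algebra_ind: a => [|a b [c ac] [d bd]|c p].
- by exists 0; rewrite mulr0 mul0r sc0 mul0r.
- by exists (c + d); rewrite mulrDr mulrDl ac bd scD mulrDl.
rewrite mulrA -sc_central -mulrA -mulrA pe_ve.
case: eqP => [ev|]; last by exists 0; rewrite !mulr0 sc0 mul0r.
rewrite ve_pe; case: eqP => [sv|]; last by exists 0; rewrite !mulr0 sc0 mul0r.
have [p0|p0] := posnP (plen p).
  exists c; congr (_ * _); congr pe; apply: path_eqP; first by rewrite -sv.
  by apply: size0nil.
exists 0; rewrite sc0 mul0r; suff -> : pe p = 0 by rewrite mulr0.
by apply/pe_eq0; apply: cyc; split=> //; rewrite -ev -sv.
Qed.

(** A path from v to w followed by one from w to v is a cycle. This is what makes the top vertex of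
    a local module unique. *)
Lemma corner_round v w a b : v <> w -> ve v * a * ve w * b * ve v = 0.
Proof.
move=> vw; elim/algebra_ind: a => [|a a' IH IH'|c p].
- by rewrite mulr0 !mul0r.
- by rewrite !(mulrDr, mulrDl) IH IH' addr0.
rewrite (mulrA (ve v)) -(sc_central c (ve v)) -!mulrA.
suff -> : ve v * (pe p * (ve w * (b * ve v))) = 0 by rewrite mulr0.
elim/algebra_ind: b => [|b b' IH IH'|d q].
- by rewrite mul0r !mulr0.
- by rewrite mulrDl !mulrDr IH IH' addr0.
rewrite -!mulrA (mulrA (ve w)) -(sc_central d (ve w)) -mulrA.
rewrite (mulrA (pe p)) -(sc_central d (pe p)) -mulrA.
rewrite (mulrA (ve v)) -(sc_central d (ve v)) -mulrA.
suff -> : ve v * (pe p * (ve w * (pe q * ve v))) = 0 by rewrite mulr0.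
rewrite pe_ve; case: eqP => [qv|]; last by rewrite !mulr0.
rewrite ve_pe; case: eqP => [qw|]; last by rewrite !mulr0.
rewrite mulrA ve_pe; case: eqP => [pv|]; last by rewrite !mul0r.
have [/path_cat_ex [r E]|] := EM (path_end p = path_start q); last exact: pe_ncat.
rewrite (pe_cat E); apply/pe_eq0/cyc.
have [_ e1 e2 e3] := path_cat_some E.
split; last by rewrite e1 e2 -qv -pv.
rewrite e3 size_cat addn_gt0; have [q0|//] := posnP (plen q); last by rewrite orbT.
by case: vw; rewrite qv qw /path_end; move/size0nil: q0 => ->.
Qed.

End CyclesVanish.

Section AdmissibleIdeal.
Hypothesis I_adm : admissible I.

Lemma pe_neq0 p : (plen p < 2)%N -> pe p <> 0.
Proof. by move=> lp /pe_eq0 /(admissible_short I_adm); rewrite path_elt_highdeg leqNgt lp. Qed.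

Lemma ve_neq0 v : ve v <> 0.
Proof. exact: pe_neq0. Qed.

Lemma cycles_vanish_no_loops : cycles_vanish I -> no_loops Q.
Proof.
move=> cyc a e; apply: (@pe_neq0 (arrow_path a)) => //; apply/pe_eq0/cyc.
by split=> //; rewrite /path_end /path_start /= e.
Qed.

Lemma pe_long : exists m, forall p, (m <= plen p)%N -> pe p = 0.
Proof.
have [m mP] := admissible_long I_adm; exists m => p lp.
by apply/pe_eq0/mP; rewrite path_elt_highdeg.
Qed.

Lemma qproj_nilp : exists m, forall f, f \in highdeg 1 -> qproj I f ^+ m = 0.
Proof.
have [m mP] := admissible_long I_adm; exists m => f hf.
have -> : qproj I f ^+ m = qproj I (f ^+ m).
  by elim: m {mP} => [|m IH] //; rewrite !exprS IH qprojM.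
apply/eqP; rewrite qproj_eq0; apply: mP.
by elim: m => [|m IH]; [exact: highdeg0 | rewrite exprS -add1n; exact: highdegM].
Qed.

Lemma corner_nilp v a : exists c f, f \in highdeg 1 /\
  ve v * a * ve v = sc c * ve v + qproj I f.
Proof.
elim/algebra_ind: a => [|a b [c [f [hf ac]]] [d [g [hg bd]]]|c p].
- exists 0, 0; rewrite rpred0; split=> //.
  by rewrite mulr0 mul0r sc0 mul0r qproj0 addr0.
- exists (c + d), (f + g); rewrite rpredD //; split=> //.
  by rewrite mulrDr mulrDl ac bd scD mulrDl qprojD addrACA.
rewrite mulrA -sc_central -mulrA -mulrA pe_ve.
have E0 : exists c' f, f \in highdeg 1 /\ 0 = sc c' * ve v + qproj I f.
  by exists 0, 0; rewrite rpred0 sc0 mul0r qproj0 addr0.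
case: eqP => [ev|]; last by rewrite !mulr0.
rewrite ve_pe; case: eqP => [sv|]; last by rewrite !mulr0.
have [p0|p0] := posnP (plen p).
  exists c, 0; rewrite rpred0 qproj0 addr0; split=> //.
  congr (_ * _); congr pe; apply: path_eqP; first by rewrite -sv.
  exact: size0nil.
exists 0, (c *: path_elt k p); split; last by rewrite sc0 mul0r add0r qprojZ alg_path.unlock.
by apply: highdegZ; rewrite path_elt_highdeg.
Qed.

(** An endomorphism sends x to x times an element of e_v A e_v, which is a scalar c plus a radical
    element g; iterating f - c therefore multiplies x by powers of g, and g is nilpotent. *)
Lemma cyclic_indec (M : fgmod A) (x : M) v : x <> 0 -> x *< ve v = x ->
  (forall y, exists a, y = x *< a) -> indecomposable M.
Proof.
move=> x0 xv gen; apply: indec_nilp => [M0|f]; first exact/x0/M0.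
have [a fx] := gen (f x).
have {}fx : f x = x *< (ve v * a * ve v).
  by rewrite !ractA xv -fx -ract_lin xv.
have [c [g [hg e]]] := corner_nilp v a.
have [m mP] := qproj_nilp.
exists c, m => y; have [b ->] := gen y.
suff -> : iter m (fun y => f y - y *< sc c) (x *< b) = x *< (qproj I g ^+ m * b).
  by rewrite mP // mul0r ract0r.
elim: m {mP} => [|m IH]; first by rewrite expr0 mul1r.
have {}fx : f x = x *< sc c + x *< qproj I g.
  by rewrite fx e ractDr sc_central ractA xv.
rewrite iterS IH ract_lin fx ractDl ract_scC addrAC subrr add0r.
by rewrite -ractA mulrA -exprS.
Qed.

End AdmissibleIdeal.
End BoundQuiverAlgebra.

(** * Corner elements and longest cycles *)

Section CornerElements.
Variables (A : pzRingType) (e c : A).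
Hypotheses (ee : e * e = e) (ec : e * c = c) (ce : c * e = c) (c0 : c <> 0).
Local Notation P := (cycmod (e : regmod A)).
Local Notation u := (cyc_gen (submod_ann (e : regmod A))).

Lemma corner_gen0 (a : A) : u *< a = 0 <-> e * a = 0.
Proof. exact: cyc_gen0. Qed.

Lemma corner_gen_id : u *< e = u.
Proof.
apply/eqP; rewrite -subr_eq0 -{2}[u]ract1 -ractBr; apply/eqP/corner_gen0.
by rewrite mulrBr ee mulr1 subrr.
Qed.

(** Left multiplication by c is a nonzero endomorphism of eA; in a brick it is invertible, so none
    of its powers vanishes. *)
Lemma brick_corner_nilp m : brick P -> c ^+ m <> 0.
Proof.
move=> [_ br] cm.
have [|f fE] := @cyc_hom _ _ (submod_ann (e : regmod A)) P (u *< c).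
  by move=> a ea; rewrite -ractA -ce -mulrA [e * a]ea mulr0 ract0r.
have [|h [fh _]] := br f.
  by exists u; rewrite -[u]ract1 fE ract1 => /corner_gen0; rewrite ec.
have fm n : iter n f u = u *< (c ^+ n).
  by elim: n => [|n IH] /=; rewrite ?expr0 ?ract1 // IH fE -ractA exprS.
have hm n : iter n h (iter n f u) = u.
  by elim: n => // n IH; rewrite iterSr iterS fh.
have := hm m; rewrite fm cm ract0r => u0.
have {}u0 : u = 0 by rewrite -u0; elim: (m) => //= n ->; rewrite linear0.
by case: c0; rewrite -ec; apply/corner_gen0; rewrite u0 ract0l.
Qed.

Hypothesis local_e : forall (M : fgmod A) (x : M), x <> 0 -> x *< e = x ->
  (forall y, exists a, y = x *< a) -> indecomposable M.
Hypothesis cc : c * c = 0.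
(** It makes c annihilate eA/cA. For a longest nonzero cycle c the product [e * a * c] is even a
    scalar multiple of c. *)
Hypothesis top : forall a, exists b, e * a * c = c * b.

(* The module N = eA/cA generates the torsion class Gen(N), which contains eA,
   since cA is isomorphic to a quotient of N; but c annihilates N and not eA. *)
Lemma dc_corner_square : ~ dc_tors_identified A.
Proof.
move=> dc.
pose S (a : regmod A) := exists b : A, e * (a : A) = c * b.
have subS : is_submod S.
  split=> [|a b [a' ea] [b' eb]|a b [a' ea]].
  - by exists 0; rewrite !mulr0.
  - by exists (a' + b'); rewrite !mulrDr ea eb.
  - by exists (a' * b); rewrite [RHS]mulrA -ea; exact: (mulrA e a b).
set N := fgquot subS; set g := cyc_gen subS.
have g_e : g *< e = g.
  apply/eqP; rewrite -subr_eq0 -{2}[g]ract1 -ractBr; apply/eqP/cyc_gen0.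
  by exists 0; rewrite mulrBr ee !mulr1 subrr mulr0.
have Nc (z : N) : z *< c = 0.
  have [a ->] := cyc_gen_surj z; rewrite -/g -g_e -!ractA; apply/cyc_gen0.
  by have [b ab] := top a; exists b; rewrite !mulrA ee.
have g0 : g <> 0.
  rewrite -[g]ract1 => /cyc_gen0 [b]; rewrite mulr1 => eb.
  by apply: c0; rewrite -ce eb mulrA cc mul0r.
have N_ind := local_e g0 g_e (@cyc_gen_surj _ _ subS).
have [[_ NQ _] Next] := dc_Gen_torsion dc N_ind.
set L := cycmod (c : regmod A); set w := cyc_gen (submod_ann (c : regmod A)).
have w0 a : w *< a = 0 <-> c * a = 0 by exact: cyc_gen0.
have [f fE] : exists f : {linear L -> P}, forall a, f (w *< a) = u *< c *< a.
  by apply: cyc_hom => a ca; rewrite -ractA; apply/corner_gen0; rewrite mulrA ec.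
have [h hE] : exists h : {linear P -> N}, forall a, h (u *< a) = g *< a.
  by apply: cyc_hom => a va; apply/cyc_gen0; exists 0; rewrite mulr0.
(* [L] is a copy of cA, and the extension is 0 -> cA -> eA -> eA/cA -> 0. *)
have PGen : sval (Gen N) P.
  apply: (Next L P N); last exact: Gen_self.
    exists f, h; split=> [|z|y].
    - move=> x y /eqP; rewrite -subr_eq0 -linearB => /eqP.
      have [a exy] := cyc_gen_surj (x - y); rewrite exy fE -ractA => /corner_gen0.
      rewrite mulrA ec => /w0 wa; apply/eqP; rewrite -subr_eq0 exy.
      exact/eqP.
    - by have [a ->] := cyc_gen_surj z; exists (u *< a).
    have [a ->] := cyc_gen_surj y; split=> [|[z]].
      rewrite hE => /cyc_gen0 [b eb]; exists (w *< b).
      rewrite fE -ractA; apply/eqP; rewrite -subr_eq0 -ractBr; apply/eqP/corner_gen0.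
      by rewrite mulrBr mulrA ec eb subrr.
    have [b ->] := cyc_gen_surj z; rewrite fE -ractA => <-.
    by rewrite hE; apply/cyc_gen0; exists b; rewrite mulrA ec.
  (* Left multiplication by c maps eA onto cA and kills cA because [c * c = 0], so [L] is a quotient
     of [N]. *)
  apply: (NQ N); last exact: Gen_self.
  apply: (@cyc_quotient _ _ subS L w); last exact: cyc_gen_surj.
  by move=> a [b eb]; apply/w0; rewrite -ce -mulrA eb mulrA cc mul0r.
have /(_ u) := Gen_le (pretorsion_ann c) Nc PGen.
by move/corner_gen0; rewrite ec.
Qed.

End CornerElements.

Section Cycles.
Variables (k : fieldType) (Q : quiver) (I : tsIdeal (path_algebra k Q)).
Hypothesis I_adm : admissible I.
Local Notation kQ := (path_algebra k Q).
Local Notation A := (quotient_ring I).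
Local Notation ve := (@alg_idem k Q I).
Local Notation pe := (@alg_path k Q I).
Local Notation sc := (@alg_scalar k Q I).

Lemma bricks_cycles_vanish : locally_representation_directed A -> cycles_vanish I.
Proof.
move=> lrd C [C0 Ccyc]; apply/pe_eq0; apply: contrapT => c0.
have vC : ve (path_start C) * pe C = pe C by rewrite ve_pe eqxx.
have Cv : pe C * ve (path_start C) = pe C by rewrite pe_ve Ccyc eqxx.
have vv := ve_idem I (path_start C).
have [m mP] := qproj_nilp I_adm.
apply: (brick_corner_nilp vC Cv c0 (m := m)).
  apply: lrd; apply: (cyclic_indec I_adm _ (corner_gen_id vv)).
    rewrite -[cyc_gen _]ract1 => /corner_gen0; rewrite mulr1.
    exact: ve_neq0.
  exact: cyc_gen_surj.
by rewrite alg_path.unlock; apply: mP; rewrite path_elt_highdeg.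
Qed.

Lemma longest_cycle : ~ cycles_vanish I -> exists C, [/\ oriented_cycle C, pe C <> 0
  & forall p, path_start p = path_end p -> (plen C < plen p)%N -> pe p = 0].
Proof.
move=> nc; have [m mP] := pe_long I_adm.
pose P n := `[< exists C, [/\ oriented_cycle C, pe C <> 0 & plen C = n] >].
have exP : exists n, P n.
  apply: contrapT => nP; apply: nc => C Ccyc; apply/pe_eq0; apply: contrapT => C0.
  by apply: nP; exists (plen C); apply/asboolP; exists C.
have ubP n : P n -> (n <= m)%N.
  move=> /asboolP [C [_ C0 <-]]; rewrite leqNgt; apply/negP => lt; apply: C0.
  by apply: mP; exact: ltnW.
case: (ex_maxnP exP ubP) => n /asboolP [C [Ccyc C0 Cn]] max.
exists C; split=> // p pcyc lt; apply: contrapT => p0.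
have /max : P (plen p).
  by apply/asboolP; exists p; split=> //; split=> //; exact: leq_ltn_trans lt.
by rewrite -Cn leqNgt lt.
Qed.

(** For a longest nonzero cycle C the product of any nontrivial closed path with C is a longer
    cycle, hence zero. This gives both e_v A c = kc and c c = 0. *)
Lemma dc_cycles_vanish : dc_tors_identified A -> cycles_vanish I.
Proof.
move=> dc; apply: contrapT => /longest_cycle [C [[C0 Ccyc] c0 Cmax]].
set c := pe C in c0; set v := path_start C.
have vc : ve v * c = c by rewrite ve_pe eqxx.
have cv : c * ve v = c by rewrite pe_ve /v Ccyc eqxx.
have top a : exists l, ve v * a * c = sc l * c.
  elim/algebra_ind: a => [|a b [l al] [l' bl]|l p].
  - by exists 0; rewrite mulr0 sc0 !mul0r.
  - by exists (l + l'); rewrite mulrDr mulrDl al bl scD mulrDl.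
  rewrite mulrA -sc_central -!mulrA.
  rewrite (mulrA (ve v)) ve_pe; case: eqP => [vp|_]; last first.
    by exists 0; rewrite sc0 (mul0r c) mulr0.
  have [p0|p0] := posnP (plen p).
    exists l; congr (_ * _); rewrite -[RHS]vc; congr (pe _ * _).
    by apply: path_eqP; [rewrite -vp | exact: size0nil].
  exists 0; rewrite sc0 mul0r; suff -> : pe p * c = 0 by rewrite mulr0.
  have [/path_cat_ex [r E]|/pe_ncat-> //] := EM (path_end p = path_start C).
  rewrite (pe_cat _ E); have [e0 e1 e2 e3] := path_cat_some E.
  apply: Cmax; first by rewrite e1 e2 -vp -Ccyc.
  by rewrite /plen e3 size_cat -[X in (X < _)%N]add0n ltn_add2r.
have cc : c * c = 0.
  have [r E] : exists r, path_cat C C = Some r by apply: path_cat_ex.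
  rewrite /c (pe_cat _ E); have [e0 e1 e2 e3] := path_cat_some E.
  apply: Cmax; first by rewrite e1 e2.
  by rewrite /plen e3 size_cat -[X in (X < _)%N]add0n ltn_add2r.
apply: (dc_corner_square (ve_idem I v) vc cv c0 _ cc _ dc).
  by move=> M x; apply: cyclic_indec.
by move=> a; have [l al] := top a; exists (sc l); rewrite al sc_central.
Qed.

End Cycles.

(** * Uniqueness of nonzero paths *)

Section UniquePaths.
Variable Q : quiver.
Implicit Types (v w : vertex Q) (s t : seq (arrow Q)).

Lemma at_most_one_inP (a b : arrow Q) : at_most_one_in Q -> tgt a = tgt b -> a = b.
Proof.
move=> /(_ (tgt b)) /card_le1_eqP h e; apply: h; rewrite inE //; exact/eqP.
Qed.

(** Read backwards from the common end, each arrow is determined by its target. *)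
Lemma one_in_suffix v w s t : at_most_one_in Q ->
  composable v s -> composable w t ->
  last v [seq tgt a | a <- s] = last w [seq tgt a | a <- t] ->
  (size t <= size s)%N -> exists s', s = s' ++ t.
Proof.
move=> in1; elim/last_ind: t s => [|t b IH] s; first by exists s; rewrite cats0.
case/lastP: s => [|s a]; first by rewrite size_rcons.
rewrite -!cats1 !composable_cat !map_cat !last_cat !size_cat !addn1 /= !andbT.
move=> /andP[vs /eqP sa] /andP[wt /eqP tb] /(at_most_one_inP in1) e.
rewrite ltnS => le; subst b.
have [|s' ->] := IH s vs wt _ le; first by rewrite -sa -tb.
by exists s'; rewrite catA.
Qed.

End UniquePaths.

Section UniqueNonzeroPath.
Variables (k : fieldType) (Q : quiver) (I : tsIdeal (path_algebra k Q)).
Local Notation kQ := (path_algebra k Q).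
Local Notation A := (quotient_ring I).
Local Notation ve := (@alg_idem k Q I).
Local Notation pe := (@alg_path k Q I).
Local Notation sc := (@alg_scalar k Q I).
Hypotheses (in1 : at_most_one_in Q) (cyc : cycles_vanish I).

(** The longer path is r followed by the shorter one, where r is a closed path at the common start;
    if r has positive length, it is a cycle and the longer path is zero. *)
Lemma unique_path p q : pe p <> 0 -> pe q <> 0 ->
  path_start p = path_start q -> path_end p = path_end q -> p = q.
Proof.
wlog le : p q / (plen q <= plen p)%N => [H p0 q0 s e|p0 q0 s e].
  by case/orP: (leq_total (plen q) (plen p)) => le; [|symmetry]; apply: H.
have cp : composable (path_start p) (path_arrows p) := valP p.
have cq : composable (path_start q) (path_arrows q) := valP q.
have [s' ps'] := one_in_suffix in1 cp cq e le.
have : composable (path_start p) s'.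
  by move: cp; rewrite ps' composable_cat => /andP[].
move=> cs'; pose r : qpath Q := @QPath _ (path_start p, s') cs'.
have re : path_end r = path_start q.
  move: cp; rewrite ps' composable_cat => /andP[_].
  case qs: (path_arrows q) cq => [|a t] /=; last first.
    by move=> /andP[/eqP<- _] /andP[/eqP e1 _]; rewrite e1.
  by move: e; rewrite /path_end ps' qs cats0.
have [s0|s0] := posnP (size s').
  by apply: path_eqP => //; rewrite ps' (size0nil s0).
case: p0; suff <- : pe r * pe q = pe p.
  suff -> : pe r = 0 by rewrite mul0r.
  by apply/pe_eq0/cyc; split=> //; rewrite re -s.
have [z E] := path_cat_ex re; rewrite (pe_cat _ E); congr (pe _).
have [_ e1 _ e2] := path_cat_some E.
by apply: path_eqP; rewrite ?e1 ?e2.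
Qed.

Lemma corner_path v w a q : path_start q = v -> path_end q = w -> pe q <> 0 ->
  exists c, ve v * a * ve w = sc c * pe q.
Proof.
move=> qv qw q0; elim/algebra_ind: a => [|a b [c ac] [d bd]|c p].
- by exists 0; rewrite mulr0 mul0r sc0 mul0r.
- by exists (c + d); rewrite mulrDr mulrDl ac bd scD mulrDl.
rewrite mulrA -sc_central -mulrA -mulrA pe_ve.
case: eqP => [pw|]; last by exists 0; rewrite !mulr0 sc0 mul0r.
rewrite ve_pe; case: eqP => [pv|]; last by exists 0; rewrite !mulr0 sc0 mul0r.
have [p0|p0] := EM (pe p = 0); first by exists 0; rewrite p0 mulr0 sc0 mul0r.
by exists c; congr (_ * pe _); apply: unique_path => //; rewrite -?pv -?pw.
Qed.

(** Multiplying by the idempotents at the ends of q isolates the q-term of f modulo I, as every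
    other path with these ends is zero in A. *)
Lemma ideal_coef0 f q : f \in I -> pe q <> 0 -> f@_q = 0.
Proof.
move=> fI q0; have : qproj I f = 0 by apply/eqP; rewrite qproj_eq0.
rewrite algebraE => sum0; apply: contrapT => /eqP fq; apply: (q0).
have corner p : ve (path_start q) * (sc f@_p * pe p) * ve (path_end q) =
    if p == q then sc f@_q * pe q else 0.
  rewrite mulrA -sc_central -!mulrA pe_ve.
  case: (p =P q) => [->|pq]; first by rewrite eqxx ve_pe eqxx.
  case: eqP => [e|_]; last by rewrite !mulr0.
  rewrite ve_pe; case: eqP => [s|_]; last by rewrite !mulr0.
  have [->|p0] := EM (pe p = 0); first by rewrite mulr0.
  by case: pq; exact: unique_path p0 q0 (esym s) (esym e).
have := congr1 (fun a => ve (path_start q) * a * ve (path_end q)) sum0.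
rewrite mulr_sumr mulr_suml (eq_bigr _ (fun p _ => corner p)).
have qs : q \in msupp f by rewrite -mcoeff_neq0.
rewrite (bigD1_seq q qs) ?fset_uniq //= eqxx big1; last first.
  by move=> p /negPf->.
rewrite addr0 mulr0 mul0r => e.
by rewrite -[pe q]mul1r -sc1 -(mulVf fq) scM -mulrA e mulr0.
Qed.

End UniqueNonzeroPath.

(** * Modules given by coefficient quivers *)

(* A representation given by its coefficient quiver: the basis vector i lives at
   the vertex diag_pos i, and an edge (a, (i, j)) means that j occurs in the
   image of i under the arrow a. *)
Record diagram (Q : quiver) := Diagram {
  diag_dim : nat;
  diag_pos : 'I_diag_dim -> vertex Q;
  diag_edges : seq (arrow Q * ('I_diag_dim * 'I_diag_dim));
  diag_edgesP : forall e, e \in diag_edges ->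
    diag_pos e.2.1 = src e.1 /\ diag_pos e.2.2 = tgt e.1
}.

Section DiagramAction.
Variables (k : fieldType) (Q : quiver) (D : diagram Q).
Local Notation n := (diag_dim D).
Local Notation kQ := (path_algebra k Q).

Definition diag_vertex (v : vertex Q) : 'M[k]_n :=
  \matrix_(i, j) ((i == j) && (diag_pos i == v))%:R.

Definition diag_arrow (a : arrow Q) : 'M[k]_n :=
  \sum_(e <- diag_edges D | e.1 == a) delta_mx e.2.1 e.2.2.

Lemma delta_mx_vertex i j v :
  delta_mx i j *m diag_vertex v = (diag_pos j == v)%:R *: (delta_mx i j : 'M[k]_n).
Proof.
apply/matrixP => r s; rewrite !mxE (bigD1 j) //= big1 => [|l /negPf lj].
  rewrite !mxE eqxx addr0 (eq_sym j s) -!natrM !mulnb.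
  by case: (r == i); case: (s == j); case: (_ == v).
by rewrite !mxE lj andbF mul0r.
Qed.

Lemma vertex_delta_mx i j v :
  diag_vertex v *m delta_mx i j = (diag_pos i == v)%:R *: (delta_mx i j : 'M[k]_n).
Proof.
apply/matrixP => r s; rewrite !mxE (bigD1 i) //= big1 => [|l /negPf li].
  rewrite !mxE eqxx addr0 -!natrM !mulnb.
  by case: (r =P i) => [->|_]; rewrite /= ?andbF //; case: (s == j); case: (_ == v).
by rewrite !mxE li mulr0.
Qed.

Lemma diag_arrow_tgt a : diag_arrow a *m diag_vertex (tgt a) = diag_arrow a.
Proof.
rewrite /diag_arrow mulmx_suml big_seq_cond [RHS]big_seq_cond.
apply: eq_bigr => e /andP[eE /eqP ea].
by rewrite delta_mx_vertex (diag_edgesP eE).2 ea eqxx scale1r.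
Qed.

Lemma diag_arrow_src a : diag_vertex (src a) *m diag_arrow a = diag_arrow a.
Proof.
rewrite /diag_arrow mulmx_sumr big_seq_cond [RHS]big_seq_cond.
apply: eq_bigr => e /andP[eE /eqP ea].
by rewrite vertex_delta_mx (diag_edgesP eE).1 ea eqxx scale1r.
Qed.

Lemma diag_vertexM v w :
  diag_vertex v *m diag_vertex w = if v == w then diag_vertex w else 0.
Proof.
apply/matrixP => i j; rewrite !mxE (bigD1 i) //= big1 ?addr0 => [|l /negPf li]; last first.
  by rewrite !mxE eq_sym li mul0r.
rewrite !mxE eqxx /= -natrM mulnb; case: (v =P w) => [->|vw]; rewrite !mxE.
  by case: (i == j); case: (_ == w).
by case: (diag_pos i =P v) => [->|]; case: (v =P w) vw => //; case: (i == j).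
Qed.

Lemma diag_vertex_sum : \sum_v diag_vertex v = 1%:M.
Proof.
apply/matrixP => i j; rewrite summxE mxE (bigD1 (diag_pos i)) //= big1 ?addr0.
  by rewrite mxE eqxx andbT.
by move=> v /negPf iv; rewrite mxE (eq_sym _ v) iv andbF.
Qed.

Definition diag_word (s : seq (arrow Q)) : 'M[k]_n :=
  foldr (fun a X => diag_arrow a *m X) 1%:M s.

Definition diag_path (p : qpath Q) : 'M[k]_n :=
  diag_vertex (path_start p) *m diag_word (path_arrows p).

Lemma diag_word_cat s t : diag_word (s ++ t) = diag_word s *m diag_word t.
Proof. by elim: s => [|a s IH] /=; rewrite ?mul1mx // IH mulmxA. Qed.

Lemma diag_path_end p : diag_path p *m diag_vertex (path_end p) = diag_path p.
Proof.
rewrite /diag_path /path_end; case/lastP: (path_arrows p) => [|s a] /=.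
  by rewrite mulmx1 diag_vertexM eqxx.
rewrite map_rcons last_rcons -cats1 diag_word_cat /= mulmx1 -!mulmxA.
by rewrite diag_arrow_tgt.
Qed.

Lemma diag_pathM p q :
  diag_path p *m diag_path q = if path_cat p q is Some r then diag_path r else 0.
Proof.
have [e|ne] := EM (path_end p = path_start q).
  have [r E] := path_cat_ex e; rewrite E; have [_ e1 _ e2] := path_cat_some E.
  rewrite {2}/diag_path -e mulmxA diag_path_end /diag_path e1 e2 diag_word_cat.
  by rewrite mulmxA.
rewrite path_cat_none // -diag_path_end /diag_path -mulmxA (mulmxA (diag_vertex _)).
by rewrite diag_vertexM; case: eqP => // _; rewrite mul0mx mulmx0.
Qed.

Definition diag_rep (f : kQ) : 'M[k]_n := \sum_(p <- msupp f) f@_p *: diag_path p.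

Lemma diag_repEw (d : {fset qpath Q}) f : (msupp f `<=` d)%fset ->
  diag_rep f = \sum_(p <- d) f@_p *: diag_path p.
Proof.
move=> le; apply: big_fset_incl => // p _ /mcoeff_outdom ->.
by rewrite scale0r.
Qed.

Lemma diag_repD f g : diag_rep (f + g) = diag_rep f + diag_rep g.
Proof.
set d := (msupp f `|` msupp g)%fset.
rewrite (diag_repEw (msuppD_le f g)).
rewrite (diag_repEw (fsubsetUl _ _ : (msupp f `<=` d)%fset)).
rewrite (diag_repEw (fsubsetUr _ _ : (msupp g `<=` d)%fset)) -big_split.
by apply: eq_bigr => p _; rewrite mcoeffD scalerDl.
Qed.

Lemma diag_rep0 : diag_rep 0 = 0.
Proof. by rewrite /diag_rep msupp0 big_seq_fset0. Qed.

Lemma diag_repN f : diag_rep (- f) = - diag_rep f.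
Proof. by apply/eqP; rewrite -addr_eq0 -diag_repD addNr diag_rep0. Qed.

Lemma diag_rep_term c p : diag_rep (path_term c p) = c *: diag_path p.
Proof.
by rewrite path_term.unlock (diag_repEw msuppU_le) big_seq_fset1 mcoeffUU.
Qed.

Lemma diag_rep_elt p : diag_rep (path_elt k p) = diag_path p.
Proof. by rewrite /path_elt diag_rep_term scale1r. Qed.

Lemma diag_repM f g : diag_rep (f * g) = diag_rep f *m diag_rep g.
Proof.
elim/pa_ind: f => [|f f' IH IH'|c p].
- by rewrite mul0r diag_rep0 mul0mx.
- by rewrite mulrDl !diag_repD mulmxDl IH IH'.
elim/pa_ind: g => [|g g' IH IH'|d q].
- by rewrite mulr0 diag_rep0 mulmx0.
- by rewrite mulrDr !diag_repD mulmxDr IH IH'.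
rewrite [_ * _](pa_mulUU c d) !diag_rep_term -scalemxAl -scalemxAr scalerA diag_pathM.
by case: path_cat => [r|] /=; rewrite ?diag_rep_term ?diag_rep0 ?scaler0.
Qed.

Lemma diag_rep1 : diag_rep 1 = 1%:M.
Proof.
rewrite -diag_vertex_sum.
transitivity (\sum_v diag_rep (path_elt k (vertex_path v))).
  exact: (big_morph diag_rep diag_repD diag_rep0).
by apply: eq_bigr => v _; rewrite diag_rep_elt /diag_path /= mulmx1.
Qed.

Lemma diag_repZ c f : diag_rep (c *: f) = c *: diag_rep f.
Proof.
elim/pa_ind: f => [|f f' IH IH'|d p].
- by rewrite scaler0 diag_rep0 scaler0.
- rewrite scalerDr (diag_repD (c *: f)) (diag_repD f) [RHS]scalerDr.
  exact: congr2 IH IH'.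
by rewrite path_termZ !diag_rep_term scalerA.
Qed.

End DiagramAction.

Section DiagramModule.
Variables (k : fieldType) (Q : quiver) (I : tsIdeal (path_algebra k Q)).
Variable (D : diagram Q).
(** It makes I act as zero term by term: a path that occurs in an element of I acts as zero. *)
Hypothesis DI : forall p, diag_path k D p <> 0 -> forall f, f \in I -> f@_p = 0.
Local Notation n := (diag_dim D).
Local Notation A := (quotient_ring I).
Local Notation rep := (diag_rep (k := k) D).

Lemma diag_rep_ideal f : f \in I -> rep f = 0.
Proof.
move=> fI; apply: big1 => p _; have [->|p0] := EM (diag_path k D p = 0).
  by rewrite scaler0.
by rewrite (DI p0 fI) scale0r.
Qed.

(** The proof is a phantom argument: row vectors form an A-module only relative to a proof that I
    acts as zero. *)
Definition diag_carrier of (forall p, diag_path k D p <> 0 -> forall f, f \in I -> f@_p = 0) :=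
  'rV[k]_n.
Local Notation V := (diag_carrier DI).
HB.instance Definition _ := GRing.Zmodule.on V.

Definition diag_scale (a : A^c) (x : V) : V := x *m rep (repr (a : A)).

Lemma diag_scaleE f (x : V) : diag_scale (qproj I f) x = x *m rep f.
Proof.
rewrite /diag_scale; congr (_ *m _); apply/eqP; rewrite -subr_eq0 -diag_repN -diag_repD.
by rewrite diag_rep_ideal // -qproj_eq qproj_repr.
Qed.

Lemma diag_scaleA a b x : diag_scale a (diag_scale b x) = diag_scale (a * b) x.
Proof.
rewrite -[a](qproj_repr (I := I)) -[b](qproj_repr (I := I)).
rewrite [_ * _](_ : _ = qproj I (repr b * repr a)); last by rewrite qprojM.
by rewrite !diag_scaleE diag_repM mulmxA.
Qed.

Lemma diag_scale1 : left_id 1 diag_scale.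
Proof. by move=> x; rewrite [1](qproj1 I) diag_scaleE diag_rep1 mulmx1. Qed.

Lemma diag_scaleDr : right_distributive diag_scale +%R.
Proof. by move=> a x y; exact: mulmxDl. Qed.

Lemma diag_scaleDl x : {morph diag_scale^~ x : a b / a + b}.
Proof.
move=> a b; rewrite -[a](qproj_repr (I := I)) -[b](qproj_repr (I := I)).
by rewrite -qprojD !diag_scaleE diag_repD; exact: mulmxDr.
Qed.

HB.instance Definition _ := GRing.Zmodule_isLmodule.Build A^c V
  diag_scaleA diag_scale1 diag_scaleDr diag_scaleDl.

Lemma diag_ract (x : V) f : x *< qproj I f = x *m rep f :> 'rV[k]_n.
Proof. exact: diag_scaleE. Qed.

Lemma diag_ract_sc (x : V) c : x *< alg_scalar I c = c *: (x : 'rV[k]_n).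
Proof. by rewrite scE diag_ract diag_repZ diag_rep1 -scalemxAr mulmx1. Qed.

Lemma diag_fg : finitely_generated (V : lmodType A^c).
Proof.
exists n, (fun i => delta_mx 0 i : 'rV[k]_n) => x.
exists (fun i => alg_scalar I ((x : 'rV[k]_n) 0 i)).
rewrite [LHS](row_sum_delta (x : 'rV[k]_n)); apply: eq_bigr => i _.
exact: (esym (diag_ract_sc _ _)).
Qed.

Definition diagmod : fgmod A := FGMod diag_fg.

End DiagramModule.

Section DiagramModuleTheory.
Variables (k : fieldType) (Q : quiver) (I : tsIdeal (path_algebra k Q)).
Variable (D : diagram Q).
Hypothesis DI : forall p, diag_path k D p <> 0 -> forall f, f \in I -> f@_p = 0.
Local Notation n := (diag_dim D).
Local Notation A := (quotient_ring I).
Local Notation V := (diagmod DI).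

Definition basis_vec (i : 'I_n) : V := delta_mx 0 i : 'rV[k]_n.
Definition dcoord (x : V) (i : 'I_n) : k := (x : 'rV[k]_n) 0 i.

Lemma dcoordP (x y : V) : (forall i, dcoord x i = dcoord y i) -> x = y.
Proof. by move=> e; apply/rowP => i; exact: e. Qed.

Lemma dcoordD (x y : V) i : dcoord (x + y) i = dcoord x i + dcoord y i.
Proof. exact: mxE. Qed.

Lemma dcoord0 i : dcoord 0 i = 0.
Proof. exact: mxE. Qed.

Lemma dcoordB (x y : V) i : dcoord (x - y) i = dcoord x i - dcoord y i.
Proof. by rewrite dcoordD; congr (_ + _); exact: mxE. Qed.

Lemma dcoord_sc (x : V) c i : dcoord (x *< alg_scalar I c) i = c * dcoord x i.
Proof. by rewrite /dcoord diag_ract_sc mxE. Qed.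

Lemma dcoord_basis i j : dcoord (basis_vec i) j = (i == j)%:R.
Proof. by rewrite /dcoord mxE eqxx eq_sym. Qed.

Lemma dcoord_sum (J : Type) (r : seq J) (P : pred J) (F : J -> V) i :
  dcoord (\sum_(j <- r | P j) F j) i = \sum_(j <- r | P j) dcoord (F j) i.
Proof. exact: summxE. Qed.

Lemma basis_expand (x : V) : x = \sum_i basis_vec i *< alg_scalar I (dcoord x i).
Proof.
apply: dcoordP => j; rewrite dcoord_sum (bigD1 j) //= big1 => [|i /negPf ij].
  by rewrite dcoord_sc dcoord_basis eqxx mulr1 addr0.
by rewrite dcoord_sc dcoord_basis ij mulr0.
Qed.

Lemma dcoord_ve (x : V) v i : dcoord (x *< alg_idem I v) i = (diag_pos i == v)%:R * dcoord x i.
Proof.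
rewrite /dcoord ?/alg_idem alg_path.unlock diag_ract diag_rep_elt.
rewrite /diag_path /= mulmx1 mxE (bigD1 i) //=.
rewrite big1 ?addr0 => [|j /negPf ji]; last by rewrite mxE ji mulr0.
by rewrite mxE eqxx mulrC.
Qed.

Lemma basis_ve i : basis_vec i *< alg_idem I (diag_pos i) = basis_vec i.
Proof.
apply: dcoordP => j; rewrite dcoord_ve dcoord_basis.
by case: (i =P j) => [->|]; rewrite ?eqxx ?mulr1 ?mulr0.
Qed.

Lemma dcoord_arrow (x : V) a j : dcoord (x *< alg_path I (arrow_path a)) j =
  \sum_(e <- diag_edges D | e.1 == a) dcoord x e.2.1 * (e.2.2 == j)%:R.
Proof.
rewrite /dcoord ?/alg_idem alg_path.unlock diag_ract diag_rep_elt /diag_path /= mulmx1.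
rewrite [path_start _]/(src a) diag_arrow_src /diag_arrow mulmx_sumr summxE.
apply: eq_bigr => e _; rewrite mxE (bigD1 e.2.1) //= big1 ?addr0.
  by rewrite mxE eqxx eq_sym.
by move=> l /negPf le; rewrite mxE le mulr0.
Qed.

(** Arrows act along edges, so a set of basis vectors closed under the edges spans a submodule; this
    bounds the submodule generated by one basis vector. *)
Lemma dcoord_ract_support (P : pred 'I_n) :
  (forall e, e \in diag_edges D -> P e.2.1 -> P e.2.2) ->
  forall (x : V) (a : A), (forall i, ~~ P i -> dcoord x i = 0) ->
  forall i, ~~ P i -> dcoord (x *< a) i = 0.
Proof.
move=> PD x a; pose S (x : V) := forall i, ~~ P i -> dcoord x i = 0.
have Sar y b : S y -> S (y *< alg_path I (arrow_path b)).
  move=> Sy j Pj; rewrite dcoord_arrow big_seq_cond big1 // => e /andP[eD _].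
  have [Pe|/Sy->] := boolP (P e.2.1); last by rewrite mul0r.
  case: eqP => [ej|]; last by rewrite mulr0.
  by case/negP: Pj; rewrite -ej; exact: PD eD Pe.
have Spath s : forall y p, path_arrows p = s -> S y -> S (y *< alg_path I p).
  elim: s => [|b s IH] y p ps Sy.
    have -> : p = vertex_path (path_start p) by exact: path_eqP.
    by move=> i /Sy y0; rewrite dcoord_ve y0 mulr0.
  have [q [_ qs e]] := arrow_cons_elt k ps.
  have -> : alg_path I p = alg_path I (arrow_path b) * alg_path I q by rewrite alg_path.unlock e qprojM.
  by rewrite ractA; apply: IH => //; exact: Sar.
elim/algebra_ind: a x => [|a b IHa IHb|c p] x Sx i Pi.
- by rewrite ract0r dcoord0.
- by rewrite ractDr dcoordD IHa ?IHb ?addr0.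
rewrite ractA; apply: (Spath _ _ p erefl) => // j Pj.
by rewrite dcoord_sc Sx ?mulr0.
Qed.

(** Coordinate l of the identity f(b_i a) = f(b_i) a for the basis vector b_i, read as a linear
    equation between matrix entries of f. *)
Lemma diag_endo_arrow (f : {linear V -> V}) a i l :
  \sum_(e <- diag_edges D | e.1 == a) (i == e.2.1)%:R * dcoord (f (basis_vec e.2.2)) l =
  \sum_(e <- diag_edges D | e.1 == a) dcoord (f (basis_vec i)) e.2.1 * (e.2.2 == l)%:R.
Proof.
rewrite -dcoord_arrow -ract_lin.
have -> : basis_vec i *< alg_path I (arrow_path a) =
    \sum_(e <- diag_edges D | e.1 == a) basis_vec e.2.2 *< alg_scalar I (i == e.2.1)%:R.
  apply: dcoordP => j; rewrite dcoord_arrow dcoord_sum; apply: eq_bigr => e _.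
  by rewrite dcoord_sc !dcoord_basis.
rewrite linear_sum dcoord_sum; apply: eq_bigr => e _.
by rewrite ract_lin dcoord_sc.
Qed.

Lemma diag_endo_vertex (f : {linear V -> V}) i l :
  diag_pos l != diag_pos i -> dcoord (f (basis_vec i)) l = 0.
Proof. by move=> /negPf li; rewrite -basis_ve ract_lin dcoord_ve li mul0r. Qed.

(* The difference between an endomorphism as in the hypothesis and the scalar l
   has square zero: it maps the basis vectors outside B into the span of B and
   vanishes on B. *)
Lemma diag_indec (B : pred 'I_n) : (0 < n)%N ->
  (forall f : {linear V -> V}, exists l, forall i j, B i || ~~ B j ->
     dcoord (f (basis_vec i)) j = l * (i == j)%:R) ->
  indecomposable V.
Proof.
move=> n0 fB; apply: indec_nilp => [V0|f].
  have := dcoord_basis (Ordinal n0) (Ordinal n0).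
  by rewrite (V0 (basis_vec _)) dcoord0 eqxx => /eqP; rewrite eq_sym oner_eq0.
have [l fl] := fB f; exists l, 2%N => x.
pose g y := f y - y *< alg_scalar I l.
have gE y j : dcoord (g y) j =
    \sum_i dcoord y i * (dcoord (f (basis_vec i)) j - l * (i == j)%:R).
  rewrite {1}/g [in f y](basis_expand y) linear_sum dcoordB dcoord_sum dcoord_sc.
  rewrite {2}[y]basis_expand dcoord_sum mulr_sumr -sumrB; apply: eq_bigr => i _.
  by rewrite ract_lin !dcoord_sc dcoord_basis mulrBr mulrCA.
apply: dcoordP => j; rewrite -/(g _) dcoord0 gE; apply: big1 => i _ /=.
rewrite -/(g x); have [Bi|nBi] := boolP (B i); first by rewrite fl ?Bi // subrr mulr0.
rewrite gE big1 ?mul0r // => i' _; by rewrite fl ?nBi ?orbT // subrr mulr0.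
Qed.

Lemma diag_generators (x y : V) :
  (forall i, exists a b, basis_vec i = x *< a + y *< b) ->
  forall z, exists a b, z = x *< a + y *< b.
Proof.
move=> gen z; rewrite [z]basis_expand.
apply: (big_ind (fun z => exists a b, z = x *< a + y *< b)).
- by exists 0, 0; rewrite !ract0r addr0.
- move=> _ _ [a [b ->]] [a' [b' ->]]; exists (a + a'), (b + b').
  by rewrite !ractDr addrACA.
move=> i _; have [a [b ->]] := gen i; set l := alg_scalar I _.
exists (a * l), (b * l).
by rewrite ractDl !ractA.
Qed.

End DiagramModuleTheory.

Section DiagramRelations.
Variables (k : fieldType) (Q : quiver) (D : diagram Q).

Lemma diag_arrowM0 a b :
  (forall e e', e \in diag_edges D -> e' \in diag_edges D ->
     e.1 = a -> e'.1 = b -> e.2.2 <> e'.2.1) ->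
  diag_arrow k D a *m diag_arrow k D b = 0.
Proof.
move=> h; rewrite /diag_arrow mulmx_suml big_seq_cond big1 // => e /andP[eD /eqP ea].
rewrite mulmx_sumr big_seq_cond big1 // => e' /andP[eD' /eqP eb].
by rewrite mul_delta_mx_cond; case: eqP => // /(h _ _ eD eD' ea eb).
Qed.

Variables (I : tsIdeal (path_algebra k Q)) (I_adm : admissible I).

(** No path of length 2 acts nontrivially on such a diagram, and an element of an admissible ideal
    has no term of length less than 2. *)
Lemma diag_short : (forall e e', e \in diag_edges D -> e' \in diag_edges D ->
     e.2.2 <> e'.2.1) ->
  forall p, diag_path k D p <> 0 -> forall f, f \in I -> f@_p = 0.
Proof.
move=> h p p0 f /(admissible_short I_adm) /highdegP; apply.
rewrite ltnNge; apply/negP => lp; apply: p0; rewrite /diag_path; move: lp.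
rewrite /plen; case: (path_arrows p) => [|a [|b s]] //= _.
by rewrite (mulmxA (diag_arrow k D a)) diag_arrowM0 ?mul0mx ?mulmx0 // => e e' *; apply: h.
Qed.

End DiagramRelations.

(** * Three forbidden configurations *)

Lemma ord3_ind (P : 'I_3 -> Prop) :
  P (@Ordinal 3 0 isT) -> P (@Ordinal 3 1 isT) -> P (@Ordinal 3 2 isT) -> forall i, P i.
Proof.
by move=> P0 P1 P2 [[|[|[|i]]] lt] //; rewrite (bool_irrelevance lt isT).
Qed.

Lemma ord5_ind (P : 'I_5 -> Prop) :
  P (@Ordinal 5 0 isT) -> P (@Ordinal 5 1 isT) -> P (@Ordinal 5 2 isT) ->
  P (@Ordinal 5 3 isT) -> P (@Ordinal 5 4 isT) -> forall i, P i.
Proof.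
move=> P0 P1 P2 P3 P4 [[|[|[|[|[|i]]]]] lt] //; by rewrite (bool_irrelevance lt isT).
Qed.

Section TwoIn.
Variables (Q : quiver) (a b : arrow Q).
Hypotheses (ab : a != b) (tab : tgt a = tgt b).
Local Notation o i := (@Ordinal 3 i isT).

(* xa = z = yb for the basis x, y, z: then b annihilates xA and a annihilates
   yA, although neither annihilates xA + yA. *)
Definition two_in_pos (i : 'I_3) : vertex Q := nth (tgt a) [:: src a; src b] i.
Definition two_in_edges : seq (arrow Q * ('I_3 * 'I_3)) :=
  [:: (a, (o 0, o 2)); (b, (o 1, o 2))].

Lemma two_in_edgesP e : e \in two_in_edges ->
  two_in_pos e.2.1 = src e.1 /\ two_in_pos e.2.2 = tgt e.1.
Proof. by rewrite !inE => /orP[] /eqP->. Qed.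

Definition two_in : diagram Q := Diagram two_in_edgesP.

Variables (k : fieldType) (I : tsIdeal (path_algebra k Q)) (I_adm : admissible I).

Lemma two_in_short p : diag_path k two_in p <> 0 -> forall f, f \in I -> f@_p = 0.
Proof.
apply: diag_short => // e e'; rewrite !inE.
by move=> /orP[] /eqP-> /orP[] /eqP->.
Qed.

Lemma dc_not_two_in : ~ dc_tors_identified (quotient_ring I).
Proof.
move=> dc; have ba : (b == a) = false by rewrite eq_sym; exact: negPf.
have nab := negPf ab.
pose V := diagmod two_in_short; pose d := basis_vec two_in_short.
have V_ind : indecomposable V.
  apply: (@diag_indec _ _ _ _ two_in_short (pred1 (o 2))) => // f.
  pose M (i j : 'I_3) := dcoord (f (basis_vec two_in_short i)) j.
  exists (M (o 0) (o 0)); rewrite -[forall i j, _]/(forall i j : 'I_3,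
    (i == o 2) || (j != o 2) -> M i j = M (o 0) (o 0) * (i == j)%:R).
  have F c i l : \sum_(e <- two_in_edges | e.1 == c) (i == e.2.1)%:R * M e.2.2 l =
      \sum_(e <- two_in_edges | e.1 == c) M i e.2.1 * (e.2.2 == l)%:R.
    exact: (@diag_endo_arrow _ _ _ _ two_in_short f c i l).
  move: M F => M F.
  (* These equations determine all entries except [M (o 0) (o 2)] and [M (o 1) (o 2)], which need
     not vanish if a or b is a loop; [diag_indec] leaves them free. *)
  move: (F a (o 0)) (F a (o 1)) (F b (o 0)) (F b (o 1)); rewrite /= unlock /= ?eqxx ?nab ?ba.
  move=> F1 F2 F3 F4.
  have {}F1 l : M (o 2) l = M (o 0) (o 0) * (o 2 == l)%:R.
    by have := F1 l; rewrite mul1r !addr0.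
  have {}F2 : M (o 1) (o 0) = 0 by have := F2 (o 2); rewrite mul0r !addr0 mulr1 => <-.
  have {}F3 : M (o 0) (o 1) = 0 by have := F3 (o 2); rewrite mul0r !addr0 mulr1 => <-.
  have {}F4 : M (o 1) (o 1) = M (o 0) (o 0).
    by have := F4 (o 2); rewrite mul1r !addr0 mulr1 F1 mulr1.
  by elim/ord3_ind; elim/ord3_ind => //= _; rewrite ?F1 ?F2 ?F3 ?F4 ?mulr1 ?mulr0.
have da l : dcoord (d (o 0) *< alg_path I (arrow_path a)) l = (o 2 == l)%:R.
  by rewrite dcoord_arrow /= unlock /= eqxx ba !dcoord_basis addr0 mul1r.
have ann0 (z : cycmod (d (o 0))) : z *< alg_path I (arrow_path b) = 0.
  have [x ->] := cyc_gen_surj z; rewrite -ractA; apply/cyc_gen0; rewrite ractA.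
  apply: dcoordP => j; rewrite dcoord_arrow dcoord0 /= unlock /= nab eqxx addr0.
  rewrite (@dcoord_ract_support _ _ _ _ two_in_short (predC1 (o 1))) ?mul0r //.
    by move=> e; rewrite !inE => /orP[] /eqP->.
  by elim/ord3_ind => //= _; rewrite dcoord_basis.
have ann1 (z : cycmod (d (o 1))) : z *< alg_path I (arrow_path a) = 0.
  have [x ->] := cyc_gen_surj z; rewrite -ractA; apply/cyc_gen0; rewrite ractA.
  apply: dcoordP => j; rewrite dcoord_arrow dcoord0 /= unlock /= ba eqxx addr0.
  rewrite (@dcoord_ract_support _ _ _ _ two_in_short (predC1 (o 0))) ?mul0r //.
    by move=> e; rewrite !inE => /orP[] /eqP->.
  by elim/ord3_ind => //= _; rewrite dcoord_basis.
have gen : forall z : V, exists s t, z = d (o 0) *< s + d (o 1) *< t.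
  apply: diag_generators; elim/ord3_ind.
  - by exists 1, 0; rewrite ract1 ract0r addr0.
  - by exists 0, 1; rewrite ract1 ract0r add0r.
  exists (alg_path I (arrow_path a)), 0; rewrite ract0r addr0.
  by apply: dcoordP => l; rewrite da dcoord_basis.
pose c2 (x : V) : k := dcoord x (o 2).
have [] := dc_two_generators dc V_ind (pretorsion_ann _) (pretorsion_ann _) gen ann0 ann1.
  move=> /(_ (d (o 1))) /(congr1 c2); rewrite /c2.
  rewrite dcoord_arrow dcoord0 /= unlock /= nab eqxx dcoord_basis /= mulr1 addr0.
  by move=> /eqP; rewrite oner_eq0.
move=> /(_ (d (o 0))) /(congr1 c2); rewrite /c2.
rewrite da dcoord0 => /eqP; exact/negP/oner_neq0.
Qed.


End TwoIn.

Section ThreeOut.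
Variables (Q : quiver) (a b c : arrow Q).
Hypotheses (ab : a != b) (ac : a != c) (bc : b != c).
Hypotheses (sab : src b = src a) (sac : src c = src a).
Local Notation o i := (@Ordinal 5 i isT).

(* xa = z, yb = z' and xc = yc = z'' for the basis x, y, z, z', z'': then b
   annihilates xA and a annihilates yA. *)
Definition three_out_pos (i : 'I_5) : vertex Q :=
  nth (src a) [:: src a; src a; tgt a; tgt b; tgt c] i.
Definition three_out_edges : seq (arrow Q * ('I_5 * 'I_5)) :=
  [:: (a, (o 0, o 2)); (b, (o 1, o 3)); (c, (o 0, o 4)); (c, (o 1, o 4))].

Lemma three_out_edgesP e : e \in three_out_edges ->
  three_out_pos e.2.1 = src e.1 /\ three_out_pos e.2.2 = tgt e.1.
Proof. by rewrite !inE => /or4P[] /eqP->. Qed.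

Definition three_out : diagram Q := Diagram three_out_edgesP.

Variables (k : fieldType) (I : tsIdeal (path_algebra k Q)) (I_adm : admissible I).

Lemma three_out_short p : diag_path k three_out p <> 0 -> forall f, f \in I -> f@_p = 0.
Proof.
apply: diag_short => // e e'; rewrite !inE.
by move=> /or4P[] /eqP-> /or4P[] /eqP->.
Qed.

Lemma dc_not_three_out : ~ dc_tors_identified (quotient_ring I).
Proof.
move=> dc.
have [ba ca cb] : [/\ (b == a) = false, (c == a) = false & (c == b) = false].
  by split; rewrite eq_sym; exact: negPf.
have [nab nac nbc] := And3 (negPf ab) (negPf ac) (negPf bc).
have eqs := (nab, nac, nbc, ba, ca, cb).
pose V := diagmod three_out_short; pose d := basis_vec three_out_short.
have V_ind : indecomposable V.
  apply: (@diag_indec _ _ _ _ three_out_short (fun i => 2 <= i)%N) => // f.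
  pose M (i j : 'I_5) := dcoord (f (basis_vec three_out_short i)) j.
  exists (M (o 0) (o 0)); rewrite -[forall i j, _]/(forall i j : 'I_5,
    (2 <= i)%N || ~~ (2 <= j)%N -> M i j = M (o 0) (o 0) * (i == j)%:R).
  have F e i l : \sum_(e' <- three_out_edges | e'.1 == e) (i == e'.2.1)%:R * M e'.2.2 l =
      \sum_(e' <- three_out_edges | e'.1 == e) M i e'.2.1 * (e'.2.2 == l)%:R.
    exact: (@diag_endo_arrow _ _ _ _ three_out_short f e i l).
  move: M F => M F.
  move: (F a (o 0)) (F a (o 1)) (F b (o 0)) (F b (o 1)) (F c (o 0)) (F c (o 1)).
  rewrite /= unlock /= ?eqxx ?eqs => F1 F2 F3 F4 F5 F6.
  have {}F1 l : M (o 2) l = M (o 0) (o 0) * (o 2 == l)%:R.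
    by have := F1 l; rewrite mul1r !addr0.
  have {}F2 : M (o 1) (o 0) = 0 by have := F2 (o 2); rewrite mul0r !addr0 mulr1 => <-.
  have {}F3 : M (o 0) (o 1) = 0 by have := F3 (o 3); rewrite mul0r !addr0 mulr1 => <-.
  have {}F5 l : M (o 4) l = M (o 0) (o 0) * (o 4 == l)%:R.
    by have := F5 l; rewrite mul1r mul0r F3 mul0r !addr0.
  (* Only c, which sends x and y to the same vector, links the two eigenvalues. *)
  have {}F6 : M (o 1) (o 1) = M (o 0) (o 0).
    by have := F6 (o 4); rewrite mul1r mul0r F2 mul0r !add0r !addr0 F5 !mulr1.
  have {}F4 l : M (o 3) l = M (o 0) (o 0) * (o 3 == l)%:R.
    by have := F4 l; rewrite mul1r F6 !addr0.
  by elim/ord5_ind; elim/ord5_ind => //= _;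
    rewrite ?F1 ?F2 ?F3 ?F4 ?F5 ?F6 ?mulr1 ?mulr0.
have da l : dcoord (d (o 0) *< alg_path I (arrow_path a)) l = (o 2 == l)%:R.
  by rewrite dcoord_arrow /= unlock /= eqxx !eqs !dcoord_basis !addr0 mul1r.
have db l : dcoord (d (o 1) *< alg_path I (arrow_path b)) l = (o 3 == l)%:R.
  by rewrite dcoord_arrow /= unlock /= eqxx !eqs !dcoord_basis !addr0 mul1r.
have dcc l : dcoord (d (o 0) *< alg_path I (arrow_path c)) l = (o 4 == l)%:R.
  by rewrite dcoord_arrow /= unlock /= eqxx !eqs !dcoord_basis mul1r mul0r !addr0.
have ann0 (z : cycmod (d (o 0))) : z *< alg_path I (arrow_path b) = 0.
  have [x ->] := cyc_gen_surj z; rewrite -ractA; apply/cyc_gen0; rewrite ractA.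
  apply: dcoordP => j; rewrite dcoord_arrow dcoord0 /= unlock /= !eqs eqxx addr0.
  rewrite (@dcoord_ract_support _ _ _ _ three_out_short
    [pred i : 'I_5 | (i != o 1) && (i != o 3)]) ?mul0r //.
    by move=> e; rewrite !inE => /or4P[] /eqP->.
  by elim/ord5_ind => //= _; rewrite dcoord_basis.
have ann1 (z : cycmod (d (o 1))) : z *< alg_path I (arrow_path a) = 0.
  have [x ->] := cyc_gen_surj z; rewrite -ractA; apply/cyc_gen0; rewrite ractA.
  apply: dcoordP => j; rewrite dcoord_arrow dcoord0 /= unlock /= !eqs eqxx addr0.
  rewrite (@dcoord_ract_support _ _ _ _ three_out_short
    [pred i : 'I_5 | (i != o 0) && (i != o 2)]) ?mul0r //.
    by move=> e; rewrite !inE => /or4P[] /eqP->.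
  by elim/ord5_ind => //= _; rewrite dcoord_basis.
have gen : forall z : V, exists s t, z = d (o 0) *< s + d (o 1) *< t.
  apply: diag_generators; elim/ord5_ind.
  - by exists 1, 0; rewrite ract1 ract0r addr0.
  - by exists 0, 1; rewrite ract1 ract0r add0r.
  - exists (alg_path I (arrow_path a)), 0; rewrite ract0r addr0.
    by apply: dcoordP => l; rewrite da dcoord_basis.
  - exists 0, (alg_path I (arrow_path b)); rewrite ract0r add0r.
    by apply: dcoordP => l; rewrite db dcoord_basis.
  exists (alg_path I (arrow_path c)), 0; rewrite ract0r addr0.
  by apply: dcoordP => l; rewrite dcc dcoord_basis.
pose c2 (x : V) : k := dcoord x (o 2); pose c3 (x : V) : k := dcoord x (o 3).
have [] := dc_two_generators dc V_ind (pretorsion_ann _) (pretorsion_ann _) gen ann0 ann1.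
  move=> /(_ (d (o 1))) /(congr1 c3); rewrite /c3.
  by rewrite db dcoord0 => /eqP; exact/negP/oner_neq0.
move=> /(_ (d (o 0))) /(congr1 c2); rewrite /c2.
by rewrite da dcoord0 => /eqP; exact/negP/oner_neq0.
Qed.

End ThreeOut.

Section Branching.
Variables (Q : quiver) (a b c : arrow Q).
Hypotheses (bc : b != c) (ab : src b = tgt a) (ac : src c = tgt a).
Local Notation o i := (@Ordinal 5 i isT).

(* wa = x + y, xb = z and yc = z' for the basis w, x, y, z, z', which is
   generated by w and x: with u -> v the arrow a, the submodule N = wA satisfies
   N e_v = N a, and xA has no composition factor at u. *)
Definition branching_pos (i : 'I_5) : vertex Q :=
  nth (src a) [:: src a; tgt a; tgt a; tgt b; tgt c] i.
Definition branching_edges : seq (arrow Q * ('I_5 * 'I_5)) :=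
  [:: (a, (o 0, o 1)); (a, (o 0, o 2)); (b, (o 1, o 3)); (c, (o 2, o 4))].

Lemma branching_edgesP e : e \in branching_edges ->
  branching_pos e.2.1 = src e.1 /\ branching_pos e.2.2 = tgt e.1.
Proof. by rewrite !inE => /or4P[] /eqP->. Qed.

Definition branching : diagram Q := Diagram branching_edgesP.

Variables (k : fieldType) (I : tsIdeal (path_algebra k Q)) (I_adm : admissible I).
Local Notation A := (quotient_ring I).
Hypotheses (in1 : at_most_one_in Q) (cyc : cycles_vanish I).
Local Notation al := (alg_path I (arrow_path a)).
Local Notation be := (alg_path I (arrow_path b)).
Local Notation ga := (alg_path I (arrow_path c)).
Hypotheses (albe : al * be <> 0) (alga : al * ga <> 0).

Lemma branching_not_loop : src a <> tgt a.
Proof.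
move=> sa; apply: albe; suff -> : al = 0 by rewrite mul0r.
by apply/pe_eq0/cyc.
Qed.

Lemma branching_not_cycle y : src y = tgt a -> al * alg_path I (arrow_path y) <> 0 ->
  tgt y <> src a.
Proof.
move=> sy ay0 ty; apply: ay0.
have [r E] : exists r, path_cat (arrow_path a) (arrow_path y) = Some r.
  by apply: path_cat_ex.
rewrite (pe_cat I E); apply/pe_eq0/cyc.
have [_ e1 e2 e3] := path_cat_some E; split; first by rewrite e3.
by rewrite e1 e2 /path_end /= ty.
Qed.

Lemma branching_neq : [/\ (a == b) = false, (a == c) = false,
  (b == a) = false, (c == a) = false & (c == b) = false].
Proof.
have [nab nac] : a != b /\ a != c.
  by split; apply/eqP => e; apply: branching_not_loop; rewrite {1}e.
by split; apply/negbTE => //; rewrite eq_sym.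
Qed.

(** Paths of length at least 3 act as zero, and those of length less than 2 do not occur in I. The
    remaining ones, ab and ac, are nonzero in A, so [ideal_coef0] applies. *)
Lemma branching_coef0 p : diag_path k branching p <> 0 -> forall f, f \in I -> f@_p = 0.
Proof.
move=> p0 f fI.
have [lp|lp] := ltnP (plen p) 2; first by have /highdegP := admissible_short I_adm fI; apply.
apply: (ideal_coef0 in1 cyc fI); move: p0 lp.
rewrite /plen /diag_path; case E: (path_arrows p) => [|x [|y s]] //= p0 _.
have [xa yE] : x = a /\ (y = b \/ y = c).
  apply: contrapT => n; apply: p0.
  rewrite /= (mulmxA (diag_arrow k branching x)) diag_arrowM0 ?mul0mx ?mulmx0 //= => e e'.
  by rewrite !inE => /or4P[] /eqP-> /or4P[] /eqP-> //= ? ? _; apply: n; auto.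
have ya : y <> a.
  by have [/eqP nab /eqP nac _ _ _] := branching_neq; case: yE => -> e; [apply: nab|apply: nac].
case: s => [|z s] in E p0 *; last first.
  case: p0; rewrite /= (mulmxA (diag_arrow k branching y)).
  rewrite diag_arrowM0 ?mul0mx ?mulmx0 //= => e e'.
  by rewrite !inE => /or4P[] /eqP-> /or4P[] /eqP-> //= /esym.
have [q [sq qs pq]] := arrow_cons_elt k E.
have -> : alg_path I p = al * alg_path I q by rewrite alg_path.unlock pq qprojM xa.
have -> : q = arrow_path y.
  by apply: path_eqP => //; rewrite sq xa /path_start /=; case: yE => ->.
by case: yE => ->.
Qed.

Lemma dc_not_branching : ~ dc_tors_identified A.
Proof.
move=> dc; have eqs := branching_neq; case: eqs => e1 e2 e3 e4 e5.
have eqs := (e1, e2, e3, e4, e5, negPf bc) => {e1 e2 e3 e4 e5}.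
pose V := diagmod branching_coef0; pose d := basis_vec branching_coef0.
have uv : (src a == tgt a) = false by apply/negbTE/eqP/branching_not_loop.
have vu : (tgt a == src a) = false by rewrite eq_sym.
have V_ind : indecomposable V.
  apply: (@diag_indec _ _ _ _ branching_coef0 (fun i => 3 <= i)%N) => // f.
  pose M (i j : 'I_5) := dcoord (f (basis_vec branching_coef0 i)) j.
  exists (M (o 0) (o 0)); rewrite -[forall i j, _]/(forall i j : 'I_5,
    (3 <= i)%N || ~~ (3 <= j)%N -> M i j = M (o 0) (o 0) * (i == j)%:R).
  have F e i l : \sum_(e' <- branching_edges | e'.1 == e) (i == e'.2.1)%:R * M e'.2.2 l =
      \sum_(e' <- branching_edges | e'.1 == e) M i e'.2.1 * (e'.2.2 == l)%:R.
    exact: (@diag_endo_arrow _ _ _ _ branching_coef0 f e i l).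
  have G i l : branching_pos l != branching_pos i -> M i l = 0.
    exact: (@diag_endo_vertex _ _ _ _ branching_coef0 f i l).
  move: M F G => M F G.
  move: (F a (o 0)) (F b (o 1)) (F b (o 2)) (F c (o 1)) (F c (o 2)).
  rewrite /= unlock /= ?eqxx ?eqs => F1 F2 F3 F4 F5.
  have {G} [G1 G2 G3 G4] : [/\ M (o 0) (o 1) = 0, M (o 0) (o 2) = 0,
      M (o 1) (o 0) = 0 & M (o 2) (o 0) = 0].
    by split; apply: G; rewrite /branching_pos /= ?uv ?vu.
  have {}F3 : M (o 2) (o 1) = 0 by have := F3 (o 3); rewrite mul0r !addr0 mulr1 => <-.
  have {}F4 : M (o 1) (o 2) = 0 by have := F4 (o 4); rewrite mul0r !addr0 mulr1 => <-.
  have F6 : M (o 1) (o 1) = M (o 0) (o 0).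
    by have := F1 (o 1); rewrite !mul1r F3 !addr0 mulr1 mulr0 addr0.
  have {}F1 : M (o 2) (o 2) = M (o 0) (o 0).
    by have := F1 (o 2); rewrite !mul1r F4 !add0r !addr0 mulr1 mulr0 add0r.
  have {}F2 l : M (o 3) l = M (o 0) (o 0) * (o 3 == l)%:R.
    by have := F2 l; rewrite mul1r F6 !addr0.
  have {}F5 l : M (o 4) l = M (o 0) (o 0) * (o 4 == l)%:R.
    by have := F5 l; rewrite mul1r F1 !addr0.
  by elim/ord5_ind; elim/ord5_ind => //= _;
    rewrite ?F1 ?F2 ?F3 ?F4 ?F5 ?F6 ?G1 ?G2 ?G3 ?G4 ?mulr1 ?mulr0.
have actA (x : V) l : dcoord (x *< al) l =
    dcoord x (o 0) * ((o 1 == l)%:R + (o 2 == l)%:R).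
  by rewrite dcoord_arrow /= unlock /= eqxx !eqs addr0 mulrDr.
have actB (x : V) l : dcoord (x *< be) l = dcoord x (o 1) * (o 3 == l)%:R.
  by rewrite dcoord_arrow /= unlock /= eqxx !eqs addr0.
have actC (x : V) l : dcoord (x *< ga) l = dcoord x (o 2) * (o 4 == l)%:R.
  by rewrite dcoord_arrow /= unlock /= eqxx !eqs addr0.
pose C1 (N : fgmod A) := forall z : N, exists y, z *< alg_idem I (tgt a) = y *< al.
have PC1 : pretorsion C1 := pretorsion_image _ _.
have C1w : C1 (cycmod (d (o 0))).
  move=> z; have [x ->] := cyc_gen_surj z; set u := cyc_gen _.
  have uu : u = u *< alg_idem I (src a).
    apply/eqP; rewrite -subr_eq0 -{1}[u]ract1 -ractBr; apply/eqP/cyc_gen0.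
    by rewrite ractBr ract1 /d (basis_ve branching_coef0 (o 0)) subrr.
  (* With u and v the source and target of a, the arrow a is the only nonzero path from u to v, so
     e_u A e_v = ka. *)
  have [l e] : exists l, alg_idem I (src a) * x * alg_idem I (tgt a) = alg_scalar I l * al.
    apply: (corner_path in1 cyc) => // al0; apply: albe; by rewrite al0 mul0r.
  by exists (u *< alg_scalar I l); rewrite [in LHS]uu -!ractA ?mulrA e ?ractA.
have C2x (z : cycmod (d (o 1))) : z *< alg_idem I (src a) = 0.
  have [x ->] := cyc_gen_surj z; rewrite -ractA; apply/cyc_gen0; rewrite ractA.
  have supp := @dcoord_ract_support _ _ _ _ branching_coef0
    [pred i : 'I_5 | (i == o 1) || (i == o 3)].
  apply: dcoordP => j; rewrite dcoord_ve dcoord0.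
  have [/orP[]/eqP->|Pj] := boolP ((j == o 1) || (j == o 3)).
  - by rewrite /= /branching_pos /= vu mul0r.
  - rewrite /= /branching_pos /=.
    by have /eqP/negPf-> := branching_not_cycle ab albe; rewrite mul0r.
  rewrite supp ?mulr0 //; first by move=> e; rewrite !inE => /or4P[] /eqP->.
  by elim/ord5_ind => //= _; rewrite dcoord_basis.
have d2 : d (o 2) = d (o 0) *< al + d (o 1) *< (-1).
  apply: dcoordP => l; rewrite ractNr ract1 dcoordB actA !dcoord_basis mul1r.
  by rewrite addrC addKr.
have gen : forall z : V, exists s t, z = d (o 0) *< s + d (o 1) *< t.
  apply: diag_generators; elim/ord5_ind.
  - by exists 1, 0; rewrite ract1 ract0r addr0.
  - by exists 0, 1; rewrite ract1 ract0r add0r.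
  - by exists al, (-1).
  - exists 0, be; rewrite ract0r add0r.
    by apply: dcoordP => l; rewrite actB !dcoord_basis mul1r.
  exists (al * ga), (- 1 * ga); rewrite !ractA -ractDl -d2.
  by apply: dcoordP => l; rewrite actC !dcoord_basis mul1r.
pose c0 (x : V) : k := dcoord x (o 0).
pose c1 (x : V) : k := dcoord x (o 1); pose c2 (x : V) : k := dcoord x (o 2).
(* [V] lies in neither class: x = x e_v is not in Va, which is the line of x + y, and w e_u = w is
   not zero. *)
have [] := dc_two_generators dc V_ind PC1 (pretorsion_ann _) gen C1w C2x.
  move=> /(_ (d (o 1))) [y]; rewrite /d (basis_ve branching_coef0 (o 1)) -/d => e.
  have := congr1 c1 e; have := congr1 c2 e.
  rewrite /c1 /c2 !actA !dcoord_basis /= add0r addr0 mulr1 => <- /eqP.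
  exact/negP/oner_neq0.
move=> /(_ (d (o 0))); rewrite /d (basis_ve branching_coef0 (o 0)) => /(congr1 c0).
by rewrite /c0 dcoord_basis dcoord0 => /eqP; exact/negP/oner_neq0.
Qed.

End Branching.

(** * Finite dimension over the ground field *)

Section RowSubspaces.
Variables (k : fieldType) (n : nat) (S : 'rV[k]_n -> Prop).
Hypotheses (S0 : S 0) (SD : forall u v, S u -> S v -> S (u + v))
  (SZ : forall c u, S u -> S (c *: u)).

(** A matrix of largest rank with row space inside [S] works: a vector of [S] outside its row space
    could be added and would raise the rank. *)
Lemma row_subspace_mx : exists U : 'M[k]_n, forall v, S v <-> (v <= U)%MS.
Proof.
pose P r := `[< exists U : 'M[k]_n, (forall v, (v <= U)%MS -> S v) /\ \rank U = r >].
have exP : exists r, P r.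
  exists 0%N; apply/asboolP; exists 0; rewrite mxrank0; split=> // v.
  by rewrite submx0 => /eqP->.
have ubP r : P r -> (r <= n)%N by move=> /asboolP [U [_ <-]]; exact: rank_leq_row.
case: (ex_maxnP exP ubP) => r /asboolP [U [US Ur]] max.
exists U => v; split=> [Sv|]; last exact: US.
have /max : P (\rank (U + v)%MS).
  apply/asboolP; exists (U + v)%MS; split=> // w /sub_addsmxP [[a b] /= ->].
  apply: SD; first by apply: US; exact: submxMl.
  by rewrite [b]mx11_scalar mul_scalar_mx; exact: SZ.
rewrite -Ur => le; have := addsmxSl U v.
by move=> /mxrank_leqif_sup/geq_leqif; rewrite le => /esym; rewrite addsmx_sub => /andP[].
Qed.

Lemma row_functional x : ~ S x ->
  exists c : 'cV[k]_n, (forall v, S v -> v *m c = 0) /\ x *m c = 1%:M.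
Proof.
have [U UP] := row_subspace_mx; move=> Sx.
have : x *m cokermx U != 0 by rewrite -submxE; apply/negP => /UP.
case/rV0Pn => j xj; exists (((x *m cokermx U) 0 j)^-1 *: col j (cokermx U)).
have vc (v : 'rV[k]_n) : v *m col j (cokermx U) = ((v *m cokermx U) 0 j)%:M.
  rewrite [LHS]mx11_scalar; congr (_%:M); rewrite !mxE.
  by apply: eq_bigr => l _; rewrite mxE.
split=> [v /UP|].
  rewrite submxE => /eqP v0; rewrite -scalemxAr vc v0; apply/matrixP => r s.
  by rewrite !mxE mul0rn mulr0.
by rewrite -scalemxAr vc scale_scalar_mx mulVf.
Qed.

End RowSubspaces.

Lemma finite_paths (Q : quiver) m :
  exists L : seq (qpath Q), uniq L /\ forall p, (plen p < m)%N -> p \in L.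
Proof.
pose ws := flatten [seq [seq (v, tval t) | v <- enum (vertex Q), t <- enum {: l.-tuple (arrow Q)}]
                  | l <- iota 0 m].
exists (undup (pmap insub ws)); split; first exact: undup_uniq.
move=> p lp; rewrite mem_undup mem_pmap_sub; apply/flatten_mapP.
exists (plen p); first by rewrite mem_iota.
apply/allpairsP; exists (path_start p, in_tuple (path_arrows p)) => /=.
split; [by rewrite mem_enum | by rewrite mem_enum |].
exact: surjective_pairing.
Qed.

Section FiniteDimension.
Variables (k : fieldType) (Q : quiver) (I : tsIdeal (path_algebra k Q)).
Hypothesis I_adm : admissible I.
Local Notation A := (quotient_ring I).
Local Notation sc := (@alg_scalar k Q I).
Local Notation pe := (@alg_path k Q I).
Implicit Types M X Y : fgmod A.

(** A linear form over k, which acts on [M] only through the image of the scalars in A. *)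
Definition kform M (h : M -> k) : Prop :=
  (forall x y, h (x + y) = h x + h y) /\ (forall x c, h (x *< sc c) = c * h x).

Definition kembed M n (phi : M -> 'rV[k]_n) : Prop :=
  [/\ forall x y, phi (x + y) = phi x + phi y,
      forall x c, phi (x *< sc c) = c *: phi x & injective phi].

Lemma algebra_span : exists L : seq (qpath Q), forall a : A,
  exists c : 'I_(size L) -> k, a = \sum_j sc (c j) * pe (tnth (in_tuple L) j).
Proof.
have [m mP] := pe_long I_adm; have [L [Lu LP]] := finite_paths Q m; exists L => a.
elim/algebra_ind: a => [|a b [c ac] [d bd]|c p].
- by exists (fun=> 0); rewrite big1 // => j _; rewrite sc0 mul0r.
- exists (fun j => c j + d j); rewrite ac bd -big_split /=.
  by apply: eq_bigr => j _; rewrite scD mulrDl.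
have [lp|/mP->] := ltnP (plen p) m; last first.
  by exists (fun=> 0); rewrite big1 ?mulr0 // => j _; rewrite sc0 mul0r.
have pL := LP _ lp; have idx : (index p L < size L)%N by rewrite index_mem.
exists (fun j => if j == Ordinal idx then c else 0).
rewrite (bigD1 (Ordinal idx)) //= eqxx big1 ?addr0 => [|j /negPf->]; last first.
  by rewrite sc0 mul0r.
by rewrite (tnth_nth p) /= nth_index.
Qed.

(** Generators times paths of bounded length span [M], so [M] is the quotient of a matrix space by a
    subspace U. Multiplication by [cokermx U] has kernel U and so realizes this quotient inside a
    space of row vectors. *)
Lemma fgmod_embed M : exists n (phi : M -> 'rV[k]_n), kembed phi.
Proof.
have [r [g gP]] := fgmodP M; have [L LP] := algebra_span.
pose w (ij : 'I_r * 'I_(size L)) := g ij.1 *< pe (tnth (in_tuple L) ij.2).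
pose s (B : 'M[k]_(r, size L)) : M := \sum_i \sum_j w (i, j) *< sc (B i j).
have sD B C : s (B + C) = s B + s C.
  rewrite /s -big_split; apply: eq_bigr => i _; rewrite -big_split.
  by apply: eq_bigr => j _; rewrite mxE scD ractDr.
have sZ c B : s (c *: B) = s B *< sc c.
  rewrite /s ract_suml; apply: eq_bigr => i _; rewrite ract_suml.
  by apply: eq_bigr => j _; rewrite mxE mulrC scM ractA.
have s_surj y : exists B, s B = y.
  have [a ->] := gP y; pose c i := sval (cid (LP (a i))).
  exists (\matrix_(i, j) c i j); apply: eq_bigr => i _.
  rewrite -[a i *: g i]/(g i *< (a i : A)) [in RHS](svalP (cid (LP (a i)))) ract_sumr.
  by apply: eq_bigr => j _; rewrite mxE sc_central ractA.
pose S v := s (vec_mx v) = 0.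
have s0 : s 0 = 0 by rewrite -(scale0r 0) sZ sc0 ract0r.
have [U UP] : exists U : 'M[k]_(r * size L), forall v, S v <-> (v <= U)%MS.
  apply: row_subspace_mx; rewrite /S.
  - by rewrite linear0.
  - by move=> u v su sv; rewrite linearD sD su sv addr0.
  - by move=> c u su; rewrite linearZ sZ su ract0l.
pose t y := sval (cid (s_surj y)); have tE y : s (t y) = y := svalP (cid (s_surj y)).
have sN B : s (- B) = - s B.
  by apply/eqP; rewrite -addr_eq0 -sD addNr s0.
have same B C : s B = s C -> mxvec B *m cokermx U = mxvec C *m cokermx U.
  move=> e; apply/eqP; rewrite -subr_eq0 -mulmxBl -submxE; apply/UP.
  by rewrite /S -linearB mxvecK sD sN e subrr.
exists (r * size L)%N, (fun y => mxvec (t y) *m cokermx U); split=> [x y|x c|x y].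
- by rewrite -mulmxDl -linearD; apply: same; rewrite sD !tE.
- by rewrite scalemxAl -linearZ; apply: same; rewrite sZ !tE.
move=> /eqP; rewrite -subr_eq0 -mulmxBl -submxE => /UP.
by rewrite /S -linearB mxvecK sD sN !tE => /eqP; rewrite subr_eq0 => /eqP.
Qed.

Lemma fgmod_form M (W : M -> Prop) x : W 0 ->
  (forall y z, W y -> W z -> W (y + z)) -> (forall y c, W y -> W (y *< sc c)) ->
  ~ W x -> exists h : M -> k, [/\ kform h, forall y, W y -> h y = 0 & h x = 1].
Proof.
move=> W0 WD WZ Wx; have [n [phi [phiD phiZ phi_inj]]] := fgmod_embed M.
pose S v := exists2 y, W y & phi y = v.
have [||||c [cS cx]] := @row_functional k n S _ _ _ (phi x).
- by exists 0 => //; rewrite -(ract0r 0) -sc0 phiZ scale0r.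
- by move=> _ _ [y Wy <-] [z Wz <-]; exists (y + z); [exact: WD | rewrite phiD].
- by move=> l _ [y Wy <-]; exists (y *< sc l); [exact: WZ | rewrite phiZ].
- by move=> [y Wy /phi_inj yx]; apply: Wx; rewrite -yx.
exists (fun y => (phi y *m c) 0 0); split=> [|y Wy|].
- by split=> [y z|y l]; rewrite ?phiD ?mulmxDl ?phiZ -?scalemxAl mxE.
- by rewrite cS ?mxE //; exists y.
- by rewrite cx mxE.
Qed.

Definition embeds_in M n : bool := `[< exists phi : M -> 'rV[k]_n, kembed phi >].

Lemma embeds_in_ex M : exists n, embeds_in M n.
Proof. by have [n h] := fgmod_embed M; exists n; apply/asboolP. Qed.

(** The dimension of [M] over k, as the least n for which [M] embeds in k^n; it serves as an
    induction measure through its strict decrease on proper summands. *)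
Definition kdim M : nat := ex_minn (embeds_in_ex M).

(** The image lies in the hyperplane defined by c, where a coordinate with nonzero coefficient is
    determined by the others and can be deleted. *)
Lemma kembed_drop X n (psi : X -> 'rV[k]_n) (c : 'cV[k]_n) : kembed psi ->
  (forall x, psi x *m c = 0) -> c != 0 -> (0 < n)%N /\ embeds_in X n.-1.
Proof.
case: n psi c => [psi c _ _|n psi c [psiD psiZ psi_inj] psic].
  by rewrite [c]flatmx0 eqxx.
move=> /cV0Pn [i ci]; split=> //; apply/asboolP; exists (fun x => col' i (psi x)).
split=> [u v|u l|u v e]; rewrite ?psiD ?psiZ ?linearD ?linearZ //.
apply/psi_inj/eqP; rewrite -subr_eq0; apply/eqP.
have w0 j : (psi u - psi v) 0 (lift i j) = 0.
  by have /rowP/(_ j) := e; rewrite !mxE => ->; rewrite subrr.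
have wi : (psi u - psi v) 0 i = 0.
  have : (psi u - psi v) *m c = 0 by rewrite mulmxBl !psic subrr.
  move=> /matrixP/(_ 0 0); rewrite [LHS]mxE (bigD1_ord i) //= big1 ?addr0 => [|j _].
    by rewrite [RHS]mxE => /eqP; rewrite mulf_eq0 (negPf ci) orbF => /eqP.
  by rewrite w0 mul0r.
by apply/rowP => j; rewrite [RHS]mxE; case: (unliftP i j) => [j' ->|->].
Qed.

Lemma kdim_dsum M X Y : mod_dsum M X Y -> ~ zero_mod Y -> (kdim X < kdim M)%N.
Proof.
move=> /mod_dsum_biprod [f [g [p [q [fp gq pg qf _]]]]] Y0.
have [y y0] : exists y : Y, y <> 0.
  by apply: contrapT => nY; apply: Y0 => y; apply: contrapT => y0; apply: nY; exists y.
rewrite /kdim; case: (ex_minnP (embeds_in_ex M)) => n /asboolP [phi [phiD phiZ phi_inj]] _.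
case: (ex_minnP (embeds_in_ex X)) => m _ min.
pose S v := exists x, phi (f x) = v.
have phi0 : phi 0 = 0 by rewrite -(ract0r 0) -sc0 phiZ scale0r.
have [||||c [cS cy]] := @row_functional k n S _ _ _ (phi (g y)).
- by exists 0; rewrite linear0.
- by move=> _ _ [u <-] [v <-]; exists (u + v); rewrite linearD phiD.
- by move=> l _ [u <-]; exists (u *< sc l); rewrite ract_lin phiZ.
- by move=> [x /phi_inj e]; apply: y0; rewrite -[y]gq -e qf.
have c0 : c != 0.
  apply/eqP => c0; move: cy; rewrite c0 mulmx0 => /matrixP/(_ 0 0).
  by rewrite !mxE => /eqP; rewrite eq_sym oner_eq0.
have psiE : kembed (fun x => phi (f x)).
  split=> [u v|u l|u v /phi_inj /(can_inj fp) //].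
    by rewrite linearD phiD.
  by rewrite ract_lin phiZ.
have [|n0 /min] := kembed_drop psiE _ c0; first by move=> x; apply: cS; exists x.
by case: (n) n0.
Qed.

End FiniteDimension.

(** * Local direct summands *)

Section Words.
Variables (k : fieldType) (Q : quiver) (I : tsIdeal (path_algebra k Q)).
Local Notation A := (quotient_ring I).
Local Notation sc := (@alg_scalar k Q I).
Local Notation pe := (@alg_path k Q I).
Local Notation ve := (@alg_idem k Q I).
Local Notation aa a := (pe (arrow_path a)).
Implicit Types (s t : seq (arrow Q)) (v w : vertex Q).

(** No start vertex is recorded: the empty word acts as 1, prefixes and suffixes are those of
    sequences, and a word that is not composable gives 0. *)
Definition alg_word s : A := foldr (fun a x => aa a * x) 1 s.
Local Notation arr := alg_word.

Lemma arr_cat s t : arr (s ++ t) = arr s * arr t.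
Proof. by elim: s => [|a s IH] /=; rewrite ?mul1r // IH mulrA. Qed.

Lemma pe_arr p : pe p = ve (path_start p) * arr (path_arrows p).
Proof.
move: {2}(path_arrows p) (erefl (path_arrows p)) => s; elim: s p => [|a s IH] p ps.
  by rewrite ps mulr1; congr (pe _); exact: path_eqP.
have [q [sq qs e]] := arrow_cons_elt k ps.
have -> : pe p = aa a * pe q by rewrite alg_path.unlock e qprojM.
have sp : path_start p = src a.
  by have := valP p; rewrite -/(path_start p) -/(path_arrows p) ps => /andP[/eqP].
rewrite (IH q qs) ps qs sq sp /= !mulrA ve_pe eqxx; congr (_ * _).
by rewrite pe_ve eqxx.
Qed.

Definition word_end v s := last v [seq tgt a | a <- s].

Lemma composable_path v s : composable v s ->
  exists p : qpath Q, [/\ path_start p = v, path_arrows p = s & path_end p = word_end v s].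
Proof. by move=> vs; exists (@QPath _ (v, s) vs). Qed.

Lemma composable_neq0 v s : ve v * arr s <> 0 -> composable v s.
Proof.
elim: s v => //= a s IH v; rewrite mulrA ve_pe eq_sym.
case: eqP => [e|]; last by rewrite mul0r.
have -> : aa a = aa a * ve (tgt a) by rewrite pe_ve eqxx.
rewrite -mulrA => n; apply: IH => e0; apply: n; by rewrite e0 mulr0.
Qed.

Lemma arr_end v s : composable v s -> ve v * arr s * ve (word_end v s) = ve v * arr s.
Proof.
move=> /composable_path [p [pv ps pe']]; rewrite -pv -ps -pe_arr.
by rewrite ps pv -pe' pe_ve eqxx.
Qed.

Hypothesis in1 : at_most_one_in Q.
Hypothesis cyc : cycles_vanish I.

Lemma unique_word v s t : ve v * arr s <> 0 -> ve v * arr t <> 0 ->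
  word_end v s = word_end v t -> s = t.
Proof.
move=> s0 t0 e; have [p [pv ps pE]] := composable_path (composable_neq0 s0).
have [q [qv qs qE]] := composable_path (composable_neq0 t0).
rewrite -ps -qs; congr path_arrows.
by apply: (unique_path in1 cyc); rewrite ?pe_arr ?pv ?qv ?ps ?qs ?pE ?qE.
Qed.

Lemma corner_dim1 v w a : ve v * a * ve w = 0 \/
  exists s c, [/\ ve v * arr s <> 0, word_end v s = w
                & ve v * a * ve w = sc c * (ve v * arr s)].
Proof.
have [[q [qv qw q0]]|nq] := EM (exists q, [/\ path_start q = v, path_end q = w & pe q <> 0]).
  right; have [c e] := corner_path in1 cyc a qv qw q0.
  by exists (path_arrows q), c; rewrite e -qv -pe_arr -qw.
left; elim/algebra_ind: a => [|a b ha hb|c p].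
- by rewrite mulr0 mul0r.
- by rewrite mulrDr mulrDl ha hb addr0.
rewrite mulrA -sc_central -!mulrA pe_ve; case: eqP => [pw|]; last by rewrite !mulr0.
rewrite ve_pe; case: eqP => [pv|]; last by rewrite mulr0.
have [->|p0] := EM (pe p = 0); first by rewrite mulr0.
by case: nq; exists p.
Qed.

Lemma corner_word v s a : ve v * arr s <> 0 ->
  exists c, ve v * a * ve (word_end v s) = sc c * (ve v * arr s).
Proof.
move=> s0; have [->|[t [c [t0 e ->]]]] := corner_dim1 v (word_end v s) a.
  by exists 0; rewrite sc0 mul0r.
by exists c; rewrite (unique_word t0 s0 e).
Qed.

Lemma word_suffix v w s t : composable v s -> composable w t ->
  word_end v s = word_end w t ->
  (exists s', s = s' ++ t) \/ (exists2 t', t = t' ++ s & (0 < size t')%N).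
Proof.
move=> vs wt e; have [le|lt] := leqP (size t) (size s).
  by left; have [s' ->] := one_in_suffix in1 vs wt e le; exists s'.
right; have [t' et] := one_in_suffix in1 wt vs (esym e) (ltnW lt).
exists t' => //; move: lt; rewrite et size_cat; by case: t' {et}; rewrite ?ltnn.
Qed.

Hypothesis out2 : at_most_two_out Q.
Hypothesis br : branching_relations I.

Lemma at_most_two_outP (a b c : arrow Q) : src b = src a -> src c = src a ->
  [\/ a = b, a = c | b = c].
Proof.
move=> sb sc'; apply: contrapT => n.
have := out2 (src a); rewrite leqNgt => /negP; apply; apply/card_geqP.
exists [:: a; b; c]; split=> //=.
  rewrite !inE negb_or andbT -andbA; apply/and3P.
  by split; apply/eqP => e; apply: n; [constructor 1|constructor 2|constructor 3].
by move=> x; rewrite !inE => /or3P[] /eqP->; apply/eqP.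
Qed.

(** If b and c were distinct, they would be all the arrows that leave the target of a, and the
    branching relation would kill ab or ac. Hence a nonzero word is determined by its first arrow
    and its length. *)
Lemma arm_unique a b c : aa a * aa b <> 0 -> aa a * aa c <> 0 -> b = c.
Proof.
have src_tgt y : aa a * aa y <> 0 -> src y = tgt a.
  by move=> ay; apply: contrapT => n; apply: ay; apply: pe_ncat => /esym.
move=> ab ac; apply: contrapT => bc.
have ta (y : arrow Q) : tgt y = tgt a <-> y = a by split=> [/(at_most_one_inP in1)|->].
have sa (y : arrow Q) : src y = tgt a <-> y = b \/ y = c.
  split=> [sy|[]->]; [|exact: src_tgt|exact: src_tgt].
  have [||e|e|e //] := @at_most_two_outP y b c; rewrite ?sy ?src_tgt //; [by left|by right].
by case: (br ta sa bc) => h; [apply: ab | apply: ac];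
  rewrite alg_path.unlock -qprojM; apply/eqP; rewrite qproj_eq0.
Qed.

End Words.

Section LocalSummand.
Variables (k : fieldType) (Q : quiver) (I : tsIdeal (path_algebra k Q)).
Hypothesis I_adm : admissible I.
Hypotheses (in1 : at_most_one_in Q) (cyc : cycles_vanish I).
Hypotheses (out2 : at_most_two_out Q) (br : branching_relations I).
Local Notation A := (quotient_ring I).
Local Notation sc := (@alg_scalar k Q I).
Local Notation pe := (@alg_path k Q I).
Local Notation ve := (@alg_idem k Q I).
Local Notation arr := (@alg_word k Q I).
Implicit Types (s t w : seq (arrow Q)) (v : vertex Q).

Lemma arm_prefix a s t : arr (a :: s) <> 0 -> arr (a :: t) <> 0 ->
  (size s <= size t)%N -> prefix s t.
Proof.
elim: s a t => [|b s IH] a [|c t] //= ab ac le.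
have bc : b = c.
  by apply: (arm_unique in1 out2 br (a := a)) => e; [apply: ab|apply: ac];
    rewrite mulrA e mul0r.
rewrite bc eqxx /=; apply: (IH c) => // e; [apply: ab|apply: ac]; move: e => /= e.
  by rewrite bc e mulr0.
by rewrite e mulr0.
Qed.

Lemma arr_long : exists m, forall s, (m <= size s)%N -> arr s = 0.
Proof.
have [m mP] := pe_long I_adm; exists m => s le.
rewrite -[arr s]mul1r -(sum_ve I) mulr_suml big1 // => v _.
apply: contrapT => n; apply: (n).
have [p [pv ps _]] := composable_path (composable_neq0 n).
by rewrite -pv -ps -pe_arr; apply: mP; rewrite /plen ps.
Qed.

Variable M : fgmod A.
Implicit Types x m : M.

Lemma ract_arr_ve x s i : x *< ve i = x -> x *< arr s <> 0 -> ve i * arr s <> 0.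
Proof. by move=> xi xs e; apply: xs; rewrite -xi -ractA e ract0r. Qed.

Lemma longest_word : ~ zero_mod M -> exists i p,
  (exists2 m : M, m *< ve i = m & m *< arr p <> 0) /\
  forall s m, (size p < size s)%N -> m *< arr s = 0.
Proof.
move=> M0; have [b bP] := arr_long.
pose P n := `[< exists i s m, [/\ size s = n, m *< ve i = m & m *< arr s <> 0] >].
have exP' s m : m *< arr s <> 0 -> P (size s).
  move=> ms; apply: contrapT => nP; apply: ms.
  rewrite (ract_sum_ve m) ract_suml big1 // => v _; apply: contrapT => n.
  apply: nP; apply/asboolP; exists v, s, (m *< ve v); split=> //.
  by rewrite -ractA ve_idem.
have exP : exists n, P n.
  apply: contrapT => nP; apply: M0 => m; apply: contrapT => m0; apply: nP.
  by exists 0%N; apply: (exP' [::] m); rewrite ract1.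
have ubP n : P n -> (n <= b)%N.
  move=> /asboolP [i [s [m [<- _ ms]]]]; rewrite leqNgt; apply/negP => lt.
  by apply: ms; rewrite bP ?ract0r // ltnW.
case: (ex_maxnP exP ubP) => n /asboolP [i [p [m [pn mi mp]]]] max.
exists i, p; split=> [|s m' lt]; first by exists m.
apply: contrapT => /exP' /max; by rewrite -pn leqNgt lt.
Qed.

(** * Choice of the second arm and of the generator *)

Section Choice.
Variables (i : vertex Q) (p : seq (arrow Q)).
Hypothesis p_neq0 : exists2 m : M, m *< ve i = m & m *< arr p <> 0.
Hypothesis p_max : forall s m, (size p < size s)%N -> m *< arr s = 0.

(** The subspace ker p + ker q of M e_i. *)
Definition kernel_sum q m := exists m1 m2 : M, m = m1 + m2 /\
  [/\ m1 *< ve i = m1, m2 *< ve i = m2, m1 *< arr p = 0 & m2 *< arr q = 0].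

Definition other_arm s := (s = [::] \/ p <> [::] /\ ohead s <> ohead p) /\
  exists2 m : M, m *< ve i = m & m *< arr s <> 0.

(** Take the longest q for which ker p + ker q is proper. The empty word is a candidate, as its
    kernel is zero and p does not annihilate M e_i; the length is bounded by that of p. *)
Lemma other_arm_exists : exists q, [/\ other_arm q,
    exists2 m : M, m *< ve i = m & ~ kernel_sum q m
  & forall q' m, other_arm q' -> (size q < size q')%N -> m *< ve i = m -> kernel_sum q' m].
Proof.
pose P n := `[< exists q, [/\ size q = n, other_arm q &
  exists2 m : M, m *< ve i = m & ~ kernel_sum q m] >].
have [m0 m0i m0p] := p_neq0.
have exP : exists n, P n.
  exists 0%N; apply/asboolP; exists [::]; split=> //.
    split; first by left.
    by exists m0; rewrite ?ract1 // => e; apply: m0p; rewrite e ract0l.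
  exists m0 => // -[m1 [m2 [e [_ _ m1p]]]]; rewrite ract1 => m2z.
  by apply: m0p; rewrite e m2z addr0.
have ubP n : P n -> (n <= size p)%N.
  move=> /asboolP [q [<- [_ [m _ mq]] _]]; rewrite leqNgt; apply/negP => lt.
  by apply: mq; exact: p_max.
case: (ex_maxnP exP ubP) => n /asboolP [q [qn qarm qm]] max.
exists q; split=> // q' m q'arm lt mi; apply: contrapT => nk.
have /max : P (size q').
  by apply/asboolP; exists q'; split=> //; exists m.
by rewrite -qn leqNgt lt.
Qed.

Lemma other_arm_prefix s t : other_arm s -> other_arm t -> (size s <= size t)%N ->
  prefix s t.
Proof.
move=> [sp [m mi ms]] [tp [m' m'i m't]] le.
case: s => [|a s] in sp ms le *; first exact: prefix0s.
case: t => [//|b t] in tp m't le *.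
case: sp => // -[p0 ap]; case: tp => // -[_ bp].
have [m0 m0i m0p] := p_neq0.
case Ep: p p0 => [//|c u] _.
have /= /andP[/eqP sa _] := composable_neq0 (ract_arr_ve mi ms).
have /= /andP[/eqP sb _] := composable_neq0 (ract_arr_ve m'i m't).
have := composable_neq0 (ract_arr_ve m0i m0p); rewrite Ep /= => /andP[/eqP sc' _].
have ab : a = b.
  case: (at_most_two_outP out2 (a := c) (b := a) (c := b)); rewrite ?sa ?sb //.
    by move=> e; case: ap; rewrite Ep e.
  by move=> e; case: bp; rewrite Ep e.
subst b; rewrite /= eqxx; apply: (arm_prefix (a := a)) => // e; [apply: ms|apply: m't].
  by rewrite e ract0r.
by rewrite e ract0r.
Qed.

(** Start from m outside ker p + ker q. If the second arm has a next word q', then M e_i = ker p +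
    ker q' by maximality of q, so m = m1 + m2 accordingly. Replacing m by m2 changes it by an
    element of ker p, hence m2 is still outside, and it is killed by q'. So x survives only along p
    and q. *)
Lemma generator_exists : exists q x, [/\ other_arm q, x *< ve i = x, ~ kernel_sum q x
  & forall s, x *< arr s <> 0 -> prefix s p \/ prefix s q].
Proof.
have [q [qarm [m mi mq] qmax]] := other_arm_exists; exists q.
have [x [xi xq xnext]] : exists x, [/\ x *< ve i = x, ~ kernel_sum q x
    & forall q', other_arm q' -> size q' = (size q).+1 -> x *< arr q' = 0].
  have [[q' q'arm sq']|nq'] := EM (exists2 q', other_arm q' & size q' = (size q).+1).
    have [m1 [m2 [e [m1i m2i m1p m2q']]]] : kernel_sum q' m.
      by apply: qmax => //; rewrite sq'.
    exists m2; split=> //.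
      move=> [n1 [n2 [e' [n1i n2i n1p n2q]]]]; apply: mq.
      exists (m1 + n1), n2; rewrite e e' addrA; split=> //.
      by rewrite !ractDl m1i n1i m1p n1p addr0.
    move=> q'' q''arm sq''; have : prefix q' q'' by apply: other_arm_prefix; rewrite ?sq' ?sq''.
    by rewrite prefixE sq' -sq'' take_size => /eqP->.
  exists m; split=> // q' q'arm sq'; case: nq'; by exists q'.
exists x; split=> // s xs; have [|sp] := boolP (prefix s p); [by left|right].
have le_s : (size s <= size p)%N.
  by rewrite leqNgt; apply/negP => lt; apply: xs; exact: p_max.
have sarm : other_arm s.
  split; last by exists x.
  case: s => [|a s] in xs sp le_s *; [by left|right].
  case Ep: p => [|b u]; first by rewrite Ep in le_s.
  split=> // -[ab]; move: sp; rewrite Ep ab prefix_cons eqxx /= => /negP; apply.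
  have [m0 m0i m0p] := p_neq0.
  apply: (arm_prefix (a := b)); last by rewrite Ep in le_s.
    by rewrite -ab => e; apply: xs; rewrite e ract0r.
  by rewrite -Ep => e; apply: m0p; rewrite e ract0r.
apply: other_arm_prefix => //; rewrite leqNgt; apply/negP => lt.
pose s' := take (size q).+1 s.
have ss' : size s' = (size q).+1 by rewrite size_takel.
apply: xs; rewrite -(cat_take_drop (size q).+1 s) arr_cat ractA.
rewrite (_ : x *< _ = 0) ?ract0l //; apply: contrapT => n.
apply: (n); apply: xnext => //; split; last by exists x.
have [ps|[ps hs]] := sarm.1; first by rewrite ps in lt.
right; split=> //; by case: (s) hs.
Qed.

End Choice.
Lemma arr_ve t i : (0 < size t)%N -> arr t * ve i = arr t \/ arr t * ve i = 0.
Proof.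
case/lastP: t => // t a _; rewrite -cats1 arr_cat /= mulr1 -mulrA pe_ve.
by case: eqP; [left|right; rewrite mulr0].
Qed.

Lemma word_end_cat v s t : word_end v (s ++ t) = word_end (word_end v s) t.
Proof. by rewrite /word_end map_cat last_cat. Qed.

Lemma composable_mid v v' s t : composable v (s ++ t) -> composable v' t ->
  word_end v (s ++ t) = word_end v' t -> word_end v s = v'.
Proof.
rewrite composable_cat word_end_cat => /andP[_]; case: t => [|a t] //=.
by move=> /andP[/eqP e1 _] /andP[/eqP e2 _] _; rewrite /word_end -e1 e2.
Qed.

(** * Splitting off xA by linear forms *)

Section Splitting.
Variables (i : vertex Q) (p q : seq (arrow Q)) (x : M).
Hypothesis p_max : forall s m, (size p < size s)%N -> m *< arr s = 0.
Hypotheses (xi : x *< ve i = x) (xq : ~ kernel_sum i p q x) (q_arm : other_arm i p q).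
Hypothesis x_prefix : forall s, x *< arr s <> 0 -> prefix s p \/ prefix s q.

Lemma kernel_sum_form : exists h : M -> k, [/\ kform h, h x = 1,
    forall m, h (m *< ve i) = h m
  & forall m, m *< ve i = m -> m *< arr p = 0 \/ m *< arr q = 0 -> h m = 0].
Proof.
have ks0 : kernel_sum i p q 0 by exists 0, 0; rewrite addr0 !ract0l.
(* This subspace also contains every m with m e_i = 0, so that h factors through m -> m e_i. *)
have [||||h [[hD hZ] h0 hx]] := @fgmod_form _ _ _ I_adm M
  (fun m => kernel_sum i p q (m *< ve i)) x.
- by rewrite ract0l.
- move=> y z [m1 [m2 [e [m1i m2i m1p m2q]]]] [n1 [n2 [e' [n1i n2i n1p n2q]]]].
  exists (m1 + n1), (m2 + n2); rewrite (ractDl y z) e e' addrACA; split=> //.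
  by rewrite !ractDl m1i m2i n1i n2i m1p m2q n1p n2q !addr0.
- move=> y c [m1 [m2 [e [m1i m2i m1p m2q]]]].
  exists (m1 *< sc c), (m2 *< sc c).
  rewrite (ract_scC y c (ve i)) e (ractDl m1 m2); split=> //.
  by rewrite !(ract_scC _ c) m1i m2i m1p m2q !ract0l.
- by rewrite xi.
exists h; split=> // [m|m mi mpq].
  have : h (m - m *< ve i) = 0 by apply: h0; rewrite ractBl -ractA ve_idem subrr.
  have -> : m - m *< ve i = m + m *< ve i *< sc (-1) by rewrite scN sc1 ractNr ract1.
  by rewrite hD hZ mulN1r => /eqP; rewrite subr_eq0 => /eqP.
apply: h0; rewrite mi; case: mpq => [mp|mq].
  by exists m, 0; rewrite addr0 !ract0l.
by exists 0, m; rewrite add0r !ract0l.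
Qed.

Variable h : M -> k.
Hypotheses (h_form : kform h) (hx : h x = 1) (h_ve : forall m, h (m *< ve i) = h m).

(** As h vanishes on the kernel of w, it factors through M e_i w. The factor f is obtained on all of
    [M] by requiring it to vanish on the images of ker h and to be 1 on xw. *)
Lemma arm_form w :
  (forall m, m *< ve i = m -> m *< arr w = 0 -> h m = 0) ->
  exists f : M -> k, kform f /\ forall m, m *< ve i = m -> f (m *< arr w) = h m.
Proof.
have [hD hZ] := h_form; move=> hw.
have hB y z : h (y - z) = h y - h z.
  have -> : - z = z *< sc (-1) by rewrite scN sc1 ractNr ract1.
  by rewrite hD hZ mulN1r.
have [||||f [[fD fZ] f0 fx]] := @fgmod_form _ _ _ I_adm M
  (fun y => exists m, [/\ m *< ve i = m, h m = 0 & y = m *< arr w]) (x *< arr w).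
- by exists 0; rewrite !ract0l; split=> //; rewrite -(ract0r 0) -sc0 hZ mul0r.
- move=> _ _ [m [mi m0 ->]] [n [ni n0 ->]]; exists (m + n).
  by rewrite !ractDl mi ni hD m0 n0 addr0.
- move=> _ c [m [mi m0 ->]]; exists (m *< sc c).
  by rewrite (ract_scC _ c (ve i)) mi hZ m0 mulr0 ract_scC.
- move=> [m [mi m0 e]]; have : h (x - m) = 0.
    by apply: hw; rewrite ractBl ?xi ?mi ?e ?subrr.
  by rewrite hB hx m0 subr0 => /eqP; rewrite oner_eq0.
exists f; split=> // m mi.
have : f ((m - x *< sc (h m)) *< arr w) = 0.
  apply: f0; exists (m - x *< sc (h m)); split=> //.
    by rewrite ractBl ract_scC xi mi.
  by rewrite hB hZ hx mulr1 subrr.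
rewrite ractBl ract_scC -ractNr -scN fD fZ fx mulr1 => /eqP.
by rewrite subr_eq0 => /eqP.
Qed.

Definition is_arm w (f : M -> k) : Prop :=
  [/\ kform f, forall m, m *< ve i = m -> f (m *< arr w) = h m & x *< arr w <> 0].

Variables (f g : M -> k).
Hypotheses (f_arm : is_arm p f) (g_arm : is_arm q g).

Lemma kform0 (h' : M -> k) : kform h' -> h' 0 = 0.
Proof. by move=> [_ hZ]; rewrite -(ract0r 0) -sc0 hZ mul0r. Qed.

(** Here h is f after p, and p preceded by a nonempty word is longer than p, hence zero on [M]. Both
    arms use this, since they share h. *)
Lemma form_through_i m t : (0 < size t)%N -> h (m *< arr t *< ve i) = 0.
Proof.
move=> t0; have [f_form fh _] := f_arm.
rewrite -fh; last by rewrite -!ractA ve_idem.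
rewrite -!ractA mulrA.
have [->|->] := arr_ve i t0; last by rewrite mul0r ract0r kform0.
rewrite -arr_cat p_max ?kform0 // size_cat -[X in (X < _)%N]add0n.
by rewrite ltn_add2r.
Qed.

Lemma arm_neq0 w f' : is_arm w f' -> ve i * arr w <> 0.
Proof. by move=> [_ _ xw]; exact: ract_arr_ve xw. Qed.

Definition on_arm w v := exists w1 r, w = w1 ++ r /\ word_end i w1 = v.

(** Let s be a nonzero path from v to the end of w. If s is a suffix of w, then v lies on w.
    Otherwise s passes through i before following w, and [form_through_i] applies. *)
Lemma arm_off w f' v m a : is_arm w f' -> m *< ve v = m -> ~ on_arm w v ->
  f' (m *< (a * ve (word_end i w))) = 0.
Proof.
move=> fw mv off; have [f'_form fh _] := fw.
have -> : m *< (a * ve (word_end i w)) = m *< (ve v * a * ve (word_end i w)).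
  by rewrite -(mulrA (ve v)) (ractA m (ve v)) mv.
have [->|[s [c [s0 sw ->]]]] := corner_dim1 in1 cyc v (word_end i w) a.
  by rewrite ract0r kform0.
have cs := composable_neq0 s0; have cw := composable_neq0 (arm_neq0 fw).
have [[s' es]|[t ew _]] := word_suffix in1 cs cw sw; last first.
  case: off; exists t, s; split=> //; apply: (composable_mid (t := s)) => //.
    by rewrite -ew.
  by rewrite -ew sw.
have s'i : word_end v s' = i.
  by apply: (composable_mid (t := w)); rewrite -?es.
have [s'0|s'0] := posnP (size s').
  case: off; exists [::], w; split=> //.
  by rewrite /word_end /= -s'i /word_end (size0nil s'0).
have cs' : composable v s' by move: cs; rewrite es composable_cat => /andP[].
rewrite es arr_cat (mulrA (ve v)) -(arr_end I cs') s'i !ractA fh.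
  exact: form_through_i.
by rewrite -(ractA _ (ve i)) ve_idem.
Qed.

(** The only nonzero path from this vertex of w to the end of w is the rest r of w. *)
Lemma arm_on w f' w1 r m a : is_arm w f' -> w = w1 ++ r ->
  m *< ve (word_end i w1) = m -> f' (m *< arr r) = 0 ->
  f' (m *< (a * ve (word_end i w))) = 0.
Proof.
move=> fw ew mv f'r; have [[f'D f'Z] fh xw] := fw.
have iw1 : composable i w1.
  by have := composable_neq0 (arm_neq0 fw); rewrite ew composable_cat => /andP[].
have r0 : ve (word_end i w1) * arr r <> 0.
  move=> e; apply: (arm_neq0 fw).
  by rewrite ew arr_cat mulrA -(arr_end I iw1) -mulrA e mulr0.
rewrite ew word_end_cat -mv -ractA mulrA.
have [c ->] := corner_word in1 cyc a r0.
by rewrite sc_central ractA ractA mv f'Z f'r mulr0.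
Qed.

(** Following the rest of w from the end of s gives c xw, on which the form takes the value c h(x) =
    c. *)
Lemma arm_detects w f' a : is_arm w f' ->
  (forall b, f' (x *< a *< (b * ve (word_end i w))) = 0) ->
  forall s, prefix s w -> forall c, x *< a *< ve (word_end i s) = x *< sc c *< arr s ->
  c = 0.
Proof.
move=> fw fa s /prefixP [t ew] c e; have [[f'D f'Z] fh xw] := fw.
have cw := composable_neq0 (arm_neq0 fw).
have st : composable (word_end i s) t.
  by move: cw; rewrite ew composable_cat => /andP[].
have := fa (ve (word_end i s) * arr t); rewrite ew word_end_cat arr_end // ractA e.
by rewrite -(ractA _ (arr s)) -arr_cat -ew ract_scC f'Z fh // hx mulr1.
Qed.

(** The idempotents matter: f and g are prescribed only on M e_i p and M e_i q, hence only at the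
    end vertices of p and q. *)
Definition complement m := forall a, f (m *< (a * ve (word_end i p))) = 0 /\
  g (m *< (a * ve (word_end i q))) = 0.

Lemma complement_submod : is_submod complement.
Proof.
have [[[fD _] _ _] [[gD _] _ _]] := (f_arm, g_arm).
split=> [a|m n cm cn a|m b cm a].
- by rewrite !ract0l !kform0 //; [case: g_arm | case: f_arm].
- by rewrite !ractDl fD gD; have [-> ->] := cm a; have [-> ->] := cn a; rewrite !addr0.
- by rewrite -!ractA !mulrA; exact: cm.
Qed.

(** Each component x a e_v is a multiple c of some xs. If xs is nonzero, s is a prefix of p or q,
    and the form of that arm forces c = 0. *)
Lemma complement_cap a : complement (x *< a) -> x *< a = 0.
Proof.
move=> ca; rewrite (ract_sum_ve (x *< a)) big1 // => v _.
have e : x *< a *< ve v = x *< (ve i * a * ve v) by rewrite !ractA xi.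
have [c0|[s [c [s0 sv es]]]] := corner_dim1 in1 cyc i v a; first by rewrite e c0 ract0r.
have {}e : x *< a *< ve v = x *< sc c *< arr s.
  by rewrite e es ractA ractA (ract_scC x c (ve i)) xi.
rewrite e; have [xs|xs] := EM (x *< arr s = 0); first by rewrite ract_scC xs ract0l.
suff -> : c = 0 by rewrite sc0 ract0r ract0l.
rewrite -sv in e.
case: (x_prefix xs) => pre;
  [apply: (arm_detects f_arm _ pre e)|apply: (arm_detects g_arm _ pre e)];
  by move=> b; case: (ca b).
Qed.

(** The vector x w1 sits at the same vertex as m and has value f'(x w1 r) = h(x) = 1, so subtracting
    f'(m r) times it does the job. *)
Lemma arm_correct w f' w1 r m : is_arm w f' -> w = w1 ++ r ->
  m *< ve (word_end i w1) = m ->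
  exists y a, [/\ y = m - x *< a, y *< ve (word_end i w1) = y
    & forall b, f' (y *< (b * ve (word_end i w))) = 0].
Proof.
move=> fw ew mv; have [[f'D f'Z] fh xw] := fw.
have iw1 : composable i w1.
  by have := composable_neq0 (arm_neq0 fw); rewrite ew composable_cat => /andP[].
pose l := f' (m *< arr r); pose y := m - x *< (arr w1 * sc l).
have yv : y *< ve (word_end i w1) = y.
  rewrite /y ractBl mv; congr (_ - _).
  by rewrite -{1}xi -!ractA -sc_central (mulrA (ve i)) !mulrA -sc_central -!mulrA
             (mulrA (ve i)) arr_end // sc_central !ractA xi -!ractA -sc_central.
exists y, (arr w1 * sc l); split=> // b.
apply: (arm_on _ fw ew yv).
rewrite /y ractBl -ractA -sc_central -mulrA -arr_cat -ew ractA -ractNl.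
have -> : - (x *< sc l) = x *< sc (- l) by rewrite scN ractNr.
by rewrite ract_scC f'D f'Z fh // hx mulr1 -/l subrr.
Qed.

(** Vertex by vertex: off both arms nothing is to be corrected; on exactly one arm a multiple of a
    vector of xA corrects one form, the other being zero there; both arms meet only at i. *)
Lemma complement_add m : exists a n, complement n /\ m = x *< a + n.
Proof.
suff homog v y : y *< ve v = y -> exists a, complement (y - x *< a).
  have hv v : exists a, complement (m *< ve v - x *< a).
    by apply: (homog v); rewrite -ractA ve_idem.
  pose a v := sval (cid (hv v)); exists (\sum_v a v), (m - x *< \sum_v a v).
  split; last by rewrite addrC subrK.
  rewrite {1}(ract_sum_ve m) ract_sumr -sumrB.
  apply: (submod_sum complement_submod) => v _; exact: (svalP (cid (hv v))).
move=> yv; have [onp|offp] := EM (on_arm p v); have [onq|offq] := EM (on_arm q v).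
- have [p1 [r [ep ev]]] := onp; have [q1 [r' [eq ev']]] := onq.
  have p1q1 : p1 = q1.
    apply: (unique_word in1 cyc (v := i)); last by rewrite ev ev'.
      by move=> e; apply: (arm_neq0 f_arm); rewrite ep arr_cat mulrA e mul0r.
    by move=> e; apply: (arm_neq0 g_arm); rewrite eq arr_cat mulrA e mul0r.
  have p10 : p1 = [::].
    case: p1 p1q1 ep {ev} => [//|c u] e ep; have [[q0|[_ hd]] _] := q_arm.
      by rewrite q0 -e in eq.
    by case: hd; rewrite eq ep -e.
  have vi : v = i by rewrite -ev p10.
  (* At i one correction serves both forms, because f after p and g after q are the same form h on M
     e_i. *)
  rewrite vi in yv; exists (sc (h y)).
  have zi : (y - x *< sc (h y)) *< ve i = y - x *< sc (h y).
    by rewrite ractBl yv ract_scC xi.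
  have hz : h (y - x *< sc (h y)) = 0.
    have [hD hZ] := h_form; rewrite -ractNr -scN hD hZ hx mulr1; exact: subrr.
  have [[_ fp _] [_ gq _]] := (f_arm, g_arm).
  move=> b; split.
    by apply: (arm_on (w1 := [::]) _ f_arm (erefl _) zi); rewrite fp.
  by apply: (arm_on (w1 := [::]) _ g_arm (erefl _) zi); rewrite gq.
- have [p1 [r [ep ev]]] := onp; rewrite -ev in yv offq.
  have [z [a [-> zv fz]]] := arm_correct f_arm ep yv; exists a => b.
  by split; [exact: fz | exact: arm_off zv offq].
- have [q1 [r [eq ev]]] := onq; rewrite -ev in yv offp.
  have [z [a [-> zv gz]]] := arm_correct g_arm eq yv; exists a => b.
  by split; [exact: arm_off zv offp | exact: gz].
exists 0 => b; rewrite ract0r subr0.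
by split; [exact: arm_off yv offp | exact: arm_off yv offq].
Qed.

End Splitting.

(* x generates a direct summand: let p be a longest path not annihilating M and
   q a longest path in the other arm at its source i such that ker p + ker q is
   not all of M e_i, let x be outside ker p + ker q, and let h be a linear form
   on M e_i with h x = 1 vanishing on ker p + ker q.  Writing h = f o p = g o q,
   a complement of xA is the largest submodule contained in ker f and ker g. *)
Theorem local_summand : ~ zero_mod M -> exists i x N,
  [/\ x <> 0, x *< ve i = x, is_submod N, forall a, N (x *< a) -> x *< a = 0
    & forall m, exists a n, N n /\ m = x *< a + n].
Proof.
move=> /longest_word [i [p [p0 p_max]]].
have [q [x [qarm xi xq xpre]]] := generator_exists p0 p_max.
have [h [h_form hx h_ve hpq]] := kernel_sum_form xi xq.
have [f [f_form fp]] := arm_form xi h_form hx (fun m mi mp => hpq m mi (or_introl mp)).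
have [g [g_form gq]] := arm_form xi h_form hx (fun m mi mq => hpq m mi (or_intror mq)).
have nz w : (w = p \/ w = q) -> x *< arr w <> 0.
  move=> wpq e; have := hpq x xi; rewrite hx => h0.
  suff /eqP : (1 : k) = 0 by rewrite oner_eq0.
  by apply: h0; case: wpq e => ->; [left|right].
have fa : is_arm i x h p f by split=> //; apply: nz; left.
have ga : is_arm i x h q g by split=> //; apply: nz; right.
exists i, x, (complement i p q f g); split=> //.
- by move=> x0; apply: (nz p); [left | rewrite x0 ract0l].
- exact: complement_submod fa ga.
- move=> a; exact: (complement_cap xi xpre hx fa ga).
- move=> m; exact: (complement_add p_max xi qarm h_form hx fa ga m).
Qed.

End LocalSummand.

(** * Local modules and torsion classes *)

Section Lattices.

Lemma order_isomorphism (L L' : lattice) (f : L -> L') :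
  (forall x y, lat_le (f x) (f y) <-> lat_le x y) -> (forall z, exists x, f x = z) ->
  lattice_isomorphism f.
Proof.
move=> f_le f_surj.
have f_inj x y : f x = f y -> x = y.
  by move=> e; apply: lat_anti; apply/f_le; rewrite e; exact: lat_refl.
split=> [|x y|x y].
- pose g z := sval (cid (f_surj z)); have gK z : f (g z) = z := svalP (cid (f_surj z)).
  by exists g => [x|z]; [apply: f_inj | ]; exact: gK.
- have [jx jy] := (lat_joinP x y _).1 (lat_refl _).
  apply: lat_anti; last by apply/lat_joinP; split; apply/f_le.
  have [z ez] := f_surj (lat_join (f x) (f y)); rewrite -ez; apply/f_le/lat_joinP.
  have [jx' jy'] := (lat_joinP (f x) (f y) _).1 (lat_refl _).
  by split; apply/f_le; rewrite ez.
- have [mx my] := (lat_meetP x y _).1 (lat_refl _).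
  apply: lat_anti; first by apply/lat_meetP; split; apply/f_le.
  have [z ez] := f_surj (lat_meet (f x) (f y)); rewrite -ez; apply/f_le/lat_meetP.
  have [mx' my'] := (lat_meetP (f x) (f y) _).1 (lat_refl _).
  by split; apply/f_le; rewrite ez.
Qed.

Lemma join_irreducible_big (L : lattice) (T : Type) (F : T -> L) (s : seq T) x :
  join_irreducible x -> (forall t, lat_le (F t) x) ->
  lat_le x (foldr (fun t y => lat_join (F t) y) (lat_bot L) s) -> exists t, x = F t.
Proof.
move=> [x0 xji] Fx; elim: s => [|t s IH] /= le.
  by case: x0; apply: lat_anti => //; exact: lat_botP.
have join_le : lat_le (foldr (fun t y => lat_join (F t) y) (lat_bot L) s) x.
  elim: s {IH le} => [|u s IH] /=; first exact: lat_botP.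
  by apply/lat_joinP.
have [||e] := xji (F t) (foldr (fun t y => lat_join (F t) y) (lat_bot L) s).
- by apply: lat_anti => //; apply/lat_joinP.
- by exists t.
by apply: IH; rewrite {1}e; exact: lat_refl.
Qed.

Lemma le_foldr_join (L : lattice) (T : eqType) (F : T -> L) (s : seq T) t :
  t \in s -> lat_le (F t) (foldr (fun t y => lat_join (F t) y) (lat_bot L) s).
Proof.
elim: s => [//|u s IH]; rewrite inE /=.
have [ju js] := (lat_joinP (F u) (foldr (fun t y => lat_join (F t) y) (lat_bot L) s) _).1
  (lat_refl _).
by case/orP => [/eqP->//|/IH le]; exact: lat_trans le js.
Qed.

Lemma finite_of_injective (X : Type) (T : finType) (f : X -> T) :
  (forall x y, f x = f y -> x = y) -> FinFun.Finite X.
Proof.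
move=> f_inj.
suff [l lP] : exists l : seq X, forall x, f x \in enum T -> List.In x l.
  by exists l => x; apply: lP; rewrite mem_enum.
elim: (enum T) => [|t s [l lP]]; first by exists [::].
have [[x xt]|nx] := EM (exists x, f x = t); last first.
  exists l => x; rewrite inE => /orP[/eqP xt|/lP //]; by case: nx; exists x.
exists (x :: l) => y; rewrite inE => /orP[/eqP yt|/lP]; last by right.
by left; apply: f_inj; rewrite xt.
Qed.

End Lattices.

Section LocalModules.
Variables (k : fieldType) (Q : quiver) (I : tsIdeal (path_algebra k Q)).
Hypothesis I_adm : admissible I.
Local Notation A := (quotient_ring I).
Local Notation sc := (@alg_scalar k Q I).
Local Notation ve := (@alg_idem k Q I).
Local Notation arr := (@alg_word k Q I).
Implicit Types (M N L E X Y Z P : fgmod A).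

(** Induction on the dimension: the two summands of a decomposable module are smaller quotients of
    it. *)
Lemma pretorsion_of_indec (C : fgmod A -> Prop) M : pretorsion C ->
  (forall L, indecomposable L -> mod_quotient M L -> C L) -> C M.
Proof.
move=> [C0 CQ CD]; elim/ltn_ind: {M}(kdim I_adm M) {-2}M (erefl (kdim I_adm M)).
move=> d IH M dM ML; have [M0|M0] := EM (zero_mod M); first exact: C0.
have [Mi|Mi] := EM (indecomposable M); first exact: ML Mi (mod_quotient_refl M).
have [X [Y [MXY X0 Y0]]] : exists X Y, [/\ mod_dsum M X Y, ~ zero_mod X & ~ zero_mod Y].
  apply: contrapT => n; apply: Mi; split=> // X Y MXY; apply: contrapT => XY.
  by apply: n; exists X, Y; split=> // z; apply: XY; [left|right].
have [MX MY] := (mod_dsum_quotientl MXY, mod_dsum_quotientr MXY).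
apply: (CD _ _ _ MXY).
  apply: (IH (kdim I_adm X)) => // [|L Li XL].
    by rewrite -dM; exact: kdim_dsum MXY Y0.
  by apply: ML => //; exact: mod_quotient_trans MX XL.
apply: (IH (kdim I_adm Y)) => // [|L Li YL].
  by rewrite -dM; exact: kdim_dsum (mod_dsum_sym MXY) X0.
by apply: ML => //; exact: mod_quotient_trans MY YL.
Qed.

Definition local_gen M (i : vertex Q) (x : M) : Prop :=
  [/\ x <> 0, x *< ve i = x & forall y, exists a, y = x *< a].

Hypothesis cyc : cycles_vanish I.

Lemma local_line M i (x y : M) : local_gen i x -> y *< ve i = y ->
  exists c, y = x *< sc c.
Proof.
move=> [x0 xi gen] yi; have [a ya] := gen y.
have [c e] := corner_cycles cyc i a; exists c.
by rewrite -yi ya -xi -!ractA mulrA e sc_central ractA xi.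
Qed.

Lemma local_surj M i (x : M) Z (f : {linear Z -> M}) : local_gen i x ->
  (exists z, f z *< ve i <> 0) -> forall y, exists z, f z = y.
Proof.
move=> xg [z fz] y; have [c e] : exists c, f z *< ve i = x *< sc c.
  by apply: (local_line xg); rewrite -ractA ve_idem.
have [x0 xi gen] := xg; have [a ->] := gen y.
have c0 : c != 0 by apply/eqP => c0; apply: fz; rewrite e c0 sc0 ract0r.
exists (z *< ve i *< (sc c^-1 * a)); rewrite !ract_lin e -ractA mulrA -scM divff //.
by rewrite sc1 mul1r.
Qed.

(** The generator x = x e_i is a sum of images from X and Y, so one of the restrictions is nonzero
    at i. As P e_i = kx, its image contains x. *)
Lemma local_prime P i (x : P) Z X Y : local_gen i x -> mod_dsum Z X Y ->
  mod_quotient Z P -> mod_quotient X P \/ mod_quotient Y P.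
Proof.
move=> xg ZXY [f f_surj]; have [jX [jY [pX [pY [_ _ _ _ zE]]]]] := mod_dsum_biprod ZXY.
have lX : linear (fun u => f (jX u)) by move=> a u v; rewrite !linearP.
have lY : linear (fun u => f (jY u)) by move=> a u v; rewrite !linearP.
have [z fz] := f_surj x; have [x0 xi _] := xg.
have [X0|X0] := EM (linear_of lX (pX z) *< ve i = 0); last first.
  by left; exists (linear_of lX); apply: (local_surj xg); exists (pX z).
right; exists (linear_of lY); apply: (local_surj xg); exists (pY z) => Y0.
by apply: x0; rewrite -xi -fz (zE z) linearD ractDl [X in X + _]X0 [X in _ + X]Y0 addr0.
Qed.

(** [M] is generated by M e_i, that is, its top is concentrated at i. *)
Definition top_at i M : Prop := forall S : M -> Prop, is_submod S ->
  (forall y, y *< ve i = y -> S y) -> forall y, S y.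

Lemma submod_preim M N (f : {linear M -> N}) (S : N -> Prop) :
  is_submod S -> is_submod (fun x => S (f x)).
Proof.
move=> [S0 SD SZ]; split=> [|x y Sx Sy|x a Sx].
- by rewrite linear0.
- by rewrite linearD; exact: SD.
- by rewrite ract_lin; exact: SZ.
Qed.

Lemma top_at_pretorsion i : pretorsion (top_at i).
Proof.
split=> [M M0 S subS _ y|M N [f f_surj] Mi S subS Si y|M X Y MXY Xi Yi S subS Si y].
- by rewrite (M0 y); exact: submod0 subS.
- have [x <-] := f_surj y; apply: (Mi _ (submod_preim f subS)) => z zi.
  by apply: Si; rewrite -ract_lin zi.
have [f [g [p [q [_ _ _ _ zE]]]]] := mod_dsum_biprod MXY.
rewrite (zE y); apply: (submodD subS).
  by apply: (Xi _ (submod_preim f subS)) => z zi; apply: Si; rewrite -ract_lin zi.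
by apply: (Yi _ (submod_preim g subS)) => z zi; apply: Si; rewrite -ract_lin zi.
Qed.

Lemma top_at_extension i L E N : mod_extension L E N -> top_at i L -> top_at i N ->
  top_at i E.
Proof.
move=> [f [g [_ g_surj ex]]] Li Ni S subS Si y.
have Sf l : S (f l).
  by apply: (Li _ (submod_preim f subS)) => z zi; apply: Si; rewrite -ract_lin zi.
have [e [Se ge]] : exists e, S e /\ g e = g y.
  apply: (Ni (fun n => exists e, S e /\ g e = n)) => [|n ni].
    split=> [|_ _ [u [Su <-]] [v [Sv <-]]|_ a [u [Su <-]]].
    - by exists 0; rewrite linear0; split=> //; exact: submod0 subS.
    - by exists (u + v); rewrite linearD; split=> //; exact: submodD subS _ _ Su Sv.
    - by exists (u *< a); rewrite ract_lin; split=> //; exact: submodZ subS _ a Su.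
  have [u gu] := g_surj n; exists (u *< ve i); rewrite ract_lin gu ni; split=> //.
  by apply: Si; rewrite -ractA ve_idem.
rewrite -(subrK e y); apply: (submodD subS) => //.
by have [|l <-] := (ex (y - e)).1; first by rewrite linearB ge subrr.
Qed.

Lemma local_top_at M i (x : M) : local_gen i x -> top_at i M.
Proof.
move=> [_ xi gen] S subS Si y; have [a ->] := gen y.
by apply: (submodZ subS); exact: Si.
Qed.

(** If the map from L to P is nonzero at i, it hits the generator, because P e_i = kx. Otherwise it
    kills L e_i, hence all of L, and E -> P factors through N. *)
Lemma extension_quotient i L E N P (x : P) : mod_extension L E N -> top_at i L ->
  local_gen i x -> mod_quotient E P -> mod_quotient L P \/ mod_quotient N P.
Proof.
move=> [f [g [_ g_surj ex]]] Li xg [h h_surj].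
have l : linear (fun u => h (f u)) by move=> a u v; rewrite !linearP.
have [[u hu]|nu] := EM (exists u, linear_of l u *< ve i <> 0).
  by left; exists (linear_of l); apply: (local_surj xg); exists u.
right; apply: (mod_quotient_factor g_surj h_surj) => y /(ex y).1 [u <-].
pose S u := linear_of l u = 0.
have subS : is_submod S.
  rewrite /S; split=> [|u' v' u0 v0|u' a u0]; first exact: linear0.
  - by rewrite linearD u0 v0 addr0.
  - by rewrite ract_lin u0 ract0l.
apply: (Li S subS) => v vi; apply: contrapT => n; apply: nu; exists v.
by rewrite -ract_lin vi.
Qed.

(** If i and j differ, then e_j A e_i A e_j = 0, so the submodule generated by P e_i, which is P,
    has no component at j; but x = x e_j. *)
Lemma local_vertex_unique P i j (x : P) : local_gen j x -> top_at i P -> i = j.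
Proof.
move=> [x0 xj gen] Pi; apply: contrapT => ij; apply: x0.
rewrite -xj -[ve j]mul1r; move: (1 : A).
apply: (Pi (fun z => forall a, z *< (a * ve j) = 0)) => [|z zi a].
  split=> [a|u v u0 v0 a|u b u0 a]; first exact: ract0l.
  - by rewrite ractDl u0 v0 addr0.
  - by rewrite -ractA mulrA u0.
have [b zb] := gen z; rewrite -zi zb -xj -!ractA !mulrA corner_round ?ract0r //.
exact: nesym.
Qed.

Hypothesis indec_local : forall M, indecomposable M -> exists i (x : M), local_gen i x.

(** By [local_prime], the modules whose indecomposable quotients are all quotients of members of [S]
    form a pretorsion class. *)
Lemma generated_quotient (S : fgmod A -> Prop) P : indecomposable P ->
  generated (@pretorsion A) S P -> exists2 M, S M & mod_quotient M P.
Proof.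
move=> Pi; pose C N := forall P, indecomposable P -> mod_quotient N P ->
  exists2 M, S M & mod_quotient M P.
suff PC : pretorsion C.
  move=> /(_ C); apply => //; last exact: mod_quotient_refl.
  by split=> // M SM L _ ML; exists M.
split=> [M M0 L [L0 _] [f f_surj]|M N MN CM L Li NL|M X Y MXY CX CY L Li ML].
- by case: L0 => y; have [z <-] := f_surj y; rewrite (M0 z) linear0.
- by apply: CM => //; exact: mod_quotient_trans MN NL.
have [i [x xg]] := indec_local Li.
by case: (local_prime xg MXY ML); [exact: CX | exact: CY].
Qed.

(** All modules of [Gen M] have their top at i, hence so has an extension E of two of them. An
    indecomposable quotient of E is then local at i and a quotient of one of the two ends. *)
Lemma indec_Gen_torsion M : indecomposable M -> torsion (sval (Gen M)).
Proof.
move=> Mi; split=> [|L E N LEN GL GN]; first exact: Gen_pretorsion.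
have [i [x xg]] := indec_local Mi.
have topG := Gen_le (top_at_pretorsion i) (local_top_at xg).
have Ei := top_at_extension LEN (topG _ GL) (topG _ GN).
have [_ GQ _] := Gen_pretorsion M.
apply: (pretorsion_of_indec (Gen_pretorsion M)) => P Pi EP.
have [j [y yg]] := indec_local Pi.
have Ptop : top_at i P by have [_ h _] := top_at_pretorsion i; exact: h EP Ei.
have ij := local_vertex_unique yg Ptop; rewrite -ij in yg.
by case: (extension_quotient LEN (topG _ GL) yg EP) => h; [apply: GQ h GL|apply: GQ h GN].
Qed.

Definition tors_Gen M (Mi : indecomposable M) : tors A := exist _ _ (indec_Gen_torsion Mi).

Lemma tors_Gen_incl M (Mi : indecomposable M) : tors_incl (tors_Gen Mi) = Gen M.
Proof. exact: sig_pred_ext. Qed.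

Lemma torsion_zero : torsion (@zero_mod A).
Proof.
split; first split=> // [M N [f f_surj] M0 y|M X Y MXY X0 Y0 y].
- by have [x <-] := f_surj y; rewrite (M0 x) linear0.
- have [f [g [p [q [_ _ _ _ zE]]]]] := mod_dsum_biprod MXY.
  by rewrite (zE y) (X0 (p y)) (Y0 (q y)) !linear0 addr0.
move=> L M N [f [g [_ _ ex]]] L0 N0 y.
by have [|l <-] := (ex y).1; [exact: N0 | rewrite (L0 l) linear0].
Qed.

(** The modules of [Gen M] without [M] as a quotient form a torsion class C. If neither a nor b
    contains [M], both lie in C, hence so does their join, although [M] does not. *)
Lemma tors_Gen_join_irreducible M (Mi : indecomposable M) : join_irreducible (tors_Gen Mi).
Proof.
split=> [e|a b e].
  have : sval (tors_Gen Mi) M by exact: Gen_self.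
  rewrite e => /(_ (@zero_mod A)) h; case: (Mi) => + _; apply; apply: h.
  by split=> //; exact: torsion_zero.
have [la lb] := (lat_joinP a b _).1 (lat_refl _).
have le_of c : lat_le c (tors_Gen Mi) -> sval c M -> tors_Gen Mi = c.
  move=> lc cM; apply: lat_anti => //; apply: Gen_le cM => //.
  by have [] := svalP c.
have [aM|aM] := EM (sval a M); first by left; apply: le_of aM; rewrite e.
have [bM|bM] := EM (sval b M); first by right; apply: le_of bM; rewrite e.
have [i [x xg]] := indec_local Mi.
have topG := Gen_le (top_at_pretorsion i) (local_top_at xg).
have [[G0 GQ GD] GE] := indec_Gen_torsion Mi.
pose C X := sval (Gen M) X /\ ~ mod_quotient X M.
have TC : torsion C.
  split; first split.
  - move=> Z Z0; split; first exact: G0.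
    move=> [f f_surj]; case: (Mi) => + _; apply=> y.
    by have [z <-] := f_surj y; rewrite (Z0 z) linear0.
  - move=> X Y XY [GX nX]; split; first exact: GQ XY GX.
    by move=> /(mod_quotient_trans XY).
  - move=> Z X Y ZXY [GX nX] [GY nY]; split; first exact: GD ZXY GX GY.
    by move=> /(local_prime xg ZXY) [].
  - move=> L E N LEN [GL nL] [GN nN]; split; first exact: GE LEN GL GN.
    by move=> /(extension_quotient LEN (topG _ GL) xg) [].
have sub c : lat_le c (tors_Gen Mi) -> ~ sval c M -> forall X, sval c X -> C X.
  move=> lc cM X cX; split; first exact: lc.
  by move=> XM; apply: cM; have [[_ h _] _] := svalP c; exact: h XM cX.
have : sval (tors_Gen Mi) M by exact: Gen_self.
rewrite {1}e => /(_ C) [|_]; last by case; exact: mod_quotient_refl.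
split=> // X [aX|bX]; [apply: (sub a) aX => //|apply: (sub b) bX => //]; by rewrite e.
Qed.

End LocalModules.

(** * The equivalence *)

Section Sufficiency.
Variables (k : fieldType) (Q : quiver) (I : tsIdeal (path_algebra k Q)).
Hypothesis I_adm : admissible I.
Hypotheses (in1 : at_most_one_in Q) (out2 : at_most_two_out Q).
Hypotheses (br : branching_relations I) (cyc : cycles_vanish I).
Local Notation A := (quotient_ring I).
Local Notation sc := (@alg_scalar k Q I).
Local Notation ve := (@alg_idem k Q I).
Local Notation arr := (@alg_word k Q I).
Implicit Types (M N L E X Y Z P : fgmod A).

Lemma submod_cyclic M (x : M) : is_submod (fun m => exists a : A, m = x *< a).
Proof.
split=> [|_ _ [a ->] [b ->]|_ a [b ->]].
- by exists 0; rewrite ract0r.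
- by exists (a + b); rewrite ractDr.
- by exists (b * a); rewrite ractA.
Qed.

Lemma indec_local M : indecomposable M -> exists i (x : M), local_gen i x.
Proof.
move=> [M0 Mi]; have [i [x [N [x0 xi subN xN MN]]]] := local_summand I_adm in1 cyc out2 br M0.
exists i, x; split=> // y.
have sd : mod_dsum M (fgquot subN) (fgquot (submod_cyclic x)).
  apply: submod_dsum => [z Nz [a ez]|z]; first by rewrite ez; apply: xN; rewrite -ez.
  have [a [n [Nn ->]]] := MN z; exists n, (x *< a); rewrite addrC; split=> //.
  by exists a.
case: (Mi _ _ sd) => z0.
- case: x0; rewrite -[x]ract1; apply: xN; rewrite ract1.
  by apply/(fgquot_ker subN); exact: z0.
- by apply/(fgquot_ker (submod_cyclic x)); exact: z0.
Qed.

Lemma indec_brick : locally_representation_directed A.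
Proof.
move=> M Mi; split; first by case: Mi.
have [i [x xg]] := indec_local Mi; have [x0 xi gen] := xg.
move=> f [y fy]; have [c fx] : exists c, f x = x *< sc c.
  by apply: (local_line cyc xg); rewrite -ract_lin xi.
have fE z : f z = z *< sc c.
  by have [a ->] := gen z; rewrite ract_lin fx ract_scC.
have c0 : c != 0 by apply/eqP => c0; apply: fy; rewrite fE c0 sc0 ract0r.
have l : linear (fun z : M => z *< sc c^-1).
  by apply: linear_ract => [u v|u a]; [exact: ractDl | rewrite ract_scC].
exists (linear_of l); split=> z; rewrite /= fE -ractA -scM ?mulfV ?mulVf //;
  by rewrite sc1 ract1.
Qed.

Definition support M : {set vertex Q} := [set v | `[< exists m : M, m *< ve v <> 0 >]].

(** A finite invariant that determines a local module up to mutual quotients: the vertex of its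
    generator and its support. *)
Definition has_type M (t : vertex Q * {set vertex Q}) : Prop :=
  (exists x : M, local_gen t.1 x) /\ support M = t.2.

(** The annihilator of x is contained in that of y: if ys is nonzero, the end of s lies in the
    common support, and xs is nonzero because s spans the paths between its ends. *)
Lemma has_type_quotient M N t : has_type M t -> has_type N t -> mod_quotient M N.
Proof.
move=> [[x [x0 xi xgen]] Mt] [[y [y0 yi ygen]] Nt].
have [g gE] := regmod_hom x; have [f fE] := regmod_hom y.
apply: (mod_quotient_factor (g := g) (f := f)).
- by move=> m; have [a ->] := xgen m; exists a.
- by move=> m; have [a ->] := ygen m; exists a.
move=> a; rewrite gE fE => xa; rewrite (ract_sum_ve (y *< a)) big1 // => v _.
have ye b : y *< b *< ve v = y *< (ve t.1 * b * ve v) by rewrite !ractA yi.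
have xe b : x *< b *< ve v = x *< (ve t.1 * b * ve v) by rewrite !ractA xi.
rewrite ye; have [->|[s [c [s0 sv e]]]] := corner_dim1 in1 cyc t.1 v a.
  exact: ract0r.
have eM (Z : fgmod A) (z : Z) d : z *< ve t.1 = z ->
    z *< (sc d * (ve t.1 * arr s)) = z *< arr s *< sc d.
  by move=> zi; rewrite sc_central ractA ractA zi.
have := xa; move=> /(congr1 (fun m => m *< ve v)); rewrite ract0l xe e eM // => xs.
rewrite eM //; have [->|c0] := EM (c = 0); first by rewrite sc0 ract0r.
have {}xs := ract_sc_eq0 xs c0.
have [ys|ys] := EM (y *< arr s = 0); first by rewrite ys ract0l.
have : v \in support M.
  rewrite Mt -Nt inE; apply/asboolP; exists (y *< arr s).
  have cs := composable_neq0 s0.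
  by rewrite -{1}yi -!ractA ?mulrA -sv (arr_end I cs) ractA yi.
rewrite inE => /asboolP [m]; have [b ->] := xgen m; rewrite xe -sv.
by have [d ->] := corner_word in1 cyc b s0; rewrite eM // xs ract0l.
Qed.

Lemma indec_has_type M : indecomposable M -> exists t, has_type M t.
Proof.
move=> Mi; have [i [x xg]] := indec_local Mi.
by exists (i, support M); split=> //; exists x.
Qed.

Lemma pretorsion_has_type (C : fgmod A -> Prop) M N t : pretorsion C ->
  has_type M t -> has_type N t -> C M -> C N.
Proof. by move=> [_ CQ _] Mt Nt; apply: CQ; exact: has_type_quotient Mt Nt. Qed.

Lemma pretors_finite : FinFun.Finite (pretors A).
Proof.
pose code (T : pretors A) : {set vertex Q * {set vertex Q}} :=
  [set t | `[< exists2 M, has_type M t & sval T M >]].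
apply: (finite_of_injective (f := code)).
have le T T' : code T = code T' -> forall X, sval T X -> sval T' X.
  move=> e X TX; have [PT PT'] := (svalP T, svalP T').
  apply: (pretorsion_of_indec I_adm PT') => L Li XL; have [t Lt] := indec_has_type Li.
  have : t \in code T.
    rewrite inE; apply/asboolP; exists L => //.
    by case: PT => _ CQ _; exact: CQ XL TX.
  rewrite e inE => /asboolP [M Mt T'M]; exact: pretorsion_has_type PT' Mt Lt T'M.
move=> T T' e; apply: sig_pred_ext => X; split; apply: le => //.
Qed.

Let GenT M (Mi : indecomposable M) : tors A := tors_Gen I_adm cyc indec_local Mi.

(** A torsion class is the join of the [Gen M] over the types of its indecomposable modules. There
    are finitely many types, so a join-irreducible class equals one of these terms. *)
Lemma join_irreducible_Gen (x : tors A) : join_irreducible x ->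
  exists M, indecomposable M /\ tors_incl x = Gen M.
Proof.
move=> xji; have [x0 _] := xji.
(* A type without an indecomposable representative in x gets the bottom element, which does not
   affect the join. *)
pose R t (y : tors A) :=
  (exists M (Mi : indecomposable M), [/\ has_type M t, sval x M & y = GenT Mi]) \/
  (~ (exists M, [/\ indecomposable M, has_type M t & sval x M]) /\ y = lat_bot (tors A)).
have Rex t : exists y, R t y.
  have [[M [Mi Mt xM]]|n] := EM (exists M, [/\ indecomposable M, has_type M t & sval x M]).
    by exists (GenT Mi); left; exists M, Mi.
  by exists (lat_bot (tors A)); right.
pose F t := sval (cid (Rex t)); have FR t : R t (F t) := svalP (cid (Rex t)).
have xP : pretorsion (sval x) by case: (svalP x).
have Fx t : lat_le (F t) x.
  case: (FR t) => [[M [Mi [_ xM ->]]]|[_ ->]]; last exact: lat_botP.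
  exact: Gen_le xP _ xM.
pose types := enum {: vertex Q * {set vertex Q}}.
have [|t xt] := join_irreducible_big (s := types) xji Fx; last first.
  case: (FR t) => [[M [Mi [_ _ e]]]|[_ e]]; last by case: x0; rewrite xt.
  by exists M; split=> //; rewrite xt e; exact: tors_Gen_incl.
set J := foldr _ _ _ => X xX.
have JP : pretorsion (sval J) by case: (svalP J).
apply: (pretorsion_of_indec I_adm JP) => L Li XL; have [t Lt] := indec_has_type Li.
have xL : sval x L by case: xP => _ xQ _; exact: xQ XL xX.
have FJ : lat_le (F t) J by apply: le_foldr_join; rewrite mem_enum.
case: (FR t) => [[M [Mi [Mt xM e]]]|[n _]]; last by case: n; exists L.
apply: FJ; rewrite e; apply: (quotient_Gen (has_type_quotient Mt Lt)).
Qed.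

Definition dc_ideal (T : pretors A) (G : tors A) : Prop :=
  exists M, [/\ indecomposable M, tors_incl G = Gen M & lat_le (Gen M) T].

Lemma dc_idealP T : order_ideal (dc_ideal T).
Proof.
split=> [G [M [Mi e _]]|x y xji [M [Mi e MT]] xy].
  have -> : G = GenT Mi by apply: tors_incl_inj; rewrite e tors_Gen_incl.
  exact: tors_Gen_join_irreducible.
have [N [Ni eN]] := join_irreducible_Gen xji; exists N; split=> //.
rewrite -eN; apply: (lat_trans (y := tors_incl y)); first exact: xy.
by rewrite e.
Qed.

Definition dc_iso (T : pretors A) : distributive_closure (tors A) :=
  exist _ _ (dc_idealP T).

Lemma dc_identified : dc_tors_identified A.
Proof.
exists dc_iso; split.
- move=> T G; split=> [[G' [M [Mi e MT]] eG]|[M [Mi -> MT]]].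
    by exists M; rewrite -eG e.
  by exists (GenT Mi); [exists M; split|]; rewrite ?tors_Gen_incl.
- apply: order_isomorphism => [T T'|D].
    split=> [le X TX|le G [M [Mi e MT]]]; last first.
      by exists M; split=> //; exact: lat_trans MT le.
    have [PT PT'] := (svalP T, svalP T').
    apply: (pretorsion_of_indec I_adm PT') => L Li XL.
    have TL : sval T L by case: PT => _ CQ _; exact: CQ XL TX.
    have [|M [Mi e MT']] := le (GenT Li).
      by exists L; split; rewrite ?tors_Gen_incl //; exact: Gen_le PT _ TL.
    by apply: MT'; rewrite -e; exact: Gen_self.
  (* The preimage of an order ideal D is the pretorsion class generated by the union of its
     members. *)
  pose S X := exists2 G, sval D G & sval G X.
  exists (class_gen (@pretorsionI A) S); apply: sig_pred_ext => G.
  have [DJ Ddown] := svalP D; split=> [[M [Mi e MT]]|DG].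
    (* No new indecomposable appears: M is a quotient of a module in a single member [G'] of D, so
       [G] lies below [G']. *)
    have [X [G' DG' G'X] XM] := generated_quotient cyc indec_local Mi (MT M (@Gen_self _ M)).
    apply: (Ddown G G') => //.
      have -> : G = GenT Mi by apply: tors_incl_inj; rewrite e tors_Gen_incl.
      exact: tors_Gen_join_irreducible.
    have G'P : pretorsion (sval G') by case: (svalP G').
    have G'M : sval G' M by case: (G'P) => _ h _; exact: h XM G'X.
    rewrite -[lat_le _ _]/(lat_le (tors_incl G) (tors_incl G')) e.
    exact: Gen_le G'P _ G'M.
  have [M [Mi e]] := join_irreducible_Gen (DJ _ DG); exists M; split=> //.
  have GM : sval (tors_incl G) M by rewrite e; exact: Gen_self.
  apply: Gen_le; first exact: generatedP (@pretorsionI A) _.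
  by move=> C [_]; apply; exists G.
move=> T; apply: sig_pred_ext => G; split=> [[Gji GT]|[M [Mi e MT]]].
  have [M [Mi e]] := join_irreducible_Gen Gji; exists M; split=> //.
  by rewrite -e; exact: GT.
split.
  have -> : G = GenT Mi by apply: tors_incl_inj; rewrite e tors_Gen_incl.
  exact: tors_Gen_join_irreducible.
by rewrite -[lat_le _ _]/(lat_le (tors_incl G) (tors_incl T)) e.
Qed.

End Sufficiency.

(** * From the identification to the conditions on the quiver *)

Section Necessity.
Variables (k : fieldType) (Q : quiver) (I : tsIdeal (path_algebra k Q)).
Hypothesis I_adm : admissible I.
Hypothesis dc : dc_tors_identified (quotient_ring I).

Lemma dc_at_most_one_in : at_most_one_in Q.
Proof.
move=> v; rewrite leqNgt; apply/negP => /card_gt1P [a [b [av bv ab]]].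
move: av bv; rewrite !inE => /eqP av /eqP bv.
by apply: (dc_not_two_in ab _ I_adm dc); rewrite av bv.
Qed.

Lemma dc_at_most_two_out : at_most_two_out Q.
Proof.
move=> v; rewrite leqNgt; apply/negP => /card_gt2P [a [b [c [[av bv cv] [ab bc ca]]]]].
move: av bv cv; rewrite !inE => /eqP av /eqP bv /eqP cv.
rewrite eq_sym in ca; by apply: (dc_not_three_out ab ca bc _ _ I_adm dc); rewrite av ?bv ?cv.
Qed.

Lemma dc_branching_relations : branching_relations I.
Proof.
have cyc := dc_cycles_vanish I_adm dc.
move=> v a b c va vbc bc; apply: contrapT => n.
have av : tgt a = v by exact/va.
have bv : src b = v by apply/vbc; left.
have cv : src c = v by apply/vbc; right.
have nz d : ~ (arrow_elt k a * arrow_elt k d \in I) ->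
    alg_path I (arrow_path a) * alg_path I (arrow_path d) <> 0.
  by move=> nd; rewrite alg_path.unlock -qprojM => /eqP; rewrite qproj_eq0.
apply: (@dc_not_branching _ a b c _ _ _ _ _ I_adm dc_at_most_one_in cyc _ _ dc).
- exact/eqP.
- by rewrite av bv.
- by rewrite av cv.
- by apply: nz => nb; apply: n; left.
- by apply: nz => nb; apply: n; right.
Qed.

End Necessity.

Theorem proposition4p24 (k : closedFieldType) (Q : quiver)
    (I : tsIdeal (path_algebra k Q)) (I_admissible : admissible I) :
  let A := quotient_ring I in
  [<-> FinFun.Finite (pretors A) /\ dc_tors_identified A;
       locally_representation_directed A /\
       at_most_one_in Q /\ at_most_two_out Q /\ branching_relations I;
       at_most_one_in Q /\ at_most_two_out Q /\ branching_relations I /\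
       no_loops Q /\ cycles_vanish I].
Proof.
move=> A; tfae.
- move=> [_ dc]; have in1 := dc_at_most_one_in I_admissible dc.
  have out2 := dc_at_most_two_out I_admissible dc.
  have br := dc_branching_relations I_admissible dc.
  have cyc := dc_cycles_vanish I_admissible dc.
  by split; first exact: indec_brick I_admissible in1 out2 br cyc.
- move=> [lrd [in1 [out2 br]]].
  have cyc := bricks_cycles_vanish I_admissible lrd.
  by split=> //; split=> //; split=> //; split=> //; exact: cycles_vanish_no_loops cyc.
move=> [in1 [out2 [br [_ cyc]]]]; split; first exact: pretors_finite.
exact: dc_identified.
Qed.
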